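(* Let $n\ge 1$ and let $\lambda=(\lambda_1\ge\dots\ge\lambda_n)$, $\mu=(\mu_1\ge\dots\ge\mu_n)$, $\nu=(\nu_1\ge\dots\ge\nu_n)$ be weakly decreasing sequences of real numbers. Then there exist $n\times n$ Hermitian matrices $H_\lambda,H_\mu,H_\nu$ with spectra (eigenvalues listed with multiplicity) $\lambda,\mu,\nu$ respectively such that $H_\lambda+H_\mu=H_\nu$ if and only if there exists an $n$-honeycomb with boundary values $(\lambda,\mu,-\nu)$, where $-\nu:=(-\nu_n,\dots,-\nu_1)$.
   Context: Plane and directions. Let $P=\{(x,y,z)\in\mathbb R^3: x+y+z=0\}$. The six cardinal directions are the vectors $(0,1,-1)$ (Northwest), $(-1,1,0)$ (North), $(-1,0,1)$ (Northeast), $(0,-1,1)$ (Southeast), $(1,-1,0)$ (South), $(1,0,-1)$ (Southwest). Diagrams. A diagram is a finite configuration of (possibly half-infinite) line segments in $P$, each parallel to a cardinal direction and labeled with a positive integer multiplicity. To a diagram associate the measure on $P$ which is the sum over its segments of multiplicity times one-dimensional Lebesgue measure on the segment; two diagrams are equivalent if these measures are equal. A point $v\in P$ is a zero-tension point of a diagram if in a sufficiently small neighbourhood of $v$ the diagram is equivalent to a union of rays emanating from $v$ in cardinal directions, with multiplicities, such that the sum over the rays of (multiplicity)$\cdot$(cardinal direction vector) is zero (the case of no rays is allowed). Honeycombs. A honeycomb is an equivalence class of diagrams such that (1) every point of $P$ is a zero-tension point; (2) there are only finitely many vertices, i.e. points with more than two rays emanating; (3) the semi-infinite edges go only in the Northwest,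 Northeast and South directions. The semi-infinite edges are called boundary edges. The numbers of boundary edges (counted with multiplicity) in the three directions are equal; if the common number is $n$, it is an $n$-honeycomb. Boundary values. Every edge has one coordinate that is constant along it: $x$ for Northwest edges, $y$ for Northeast edges, $z$ for South edges. The boundary values of an $n$-honeycomb are the triple of weakly decreasing $n$-tuples (entries repeated according to multiplicity) consisting of the constant coordinates of its Northwest boundary edges, of its Northeast boundary edges, and of its South boundary edges, in this order. *)

(* Defs.v *)
From HB Require Import structures.
From mathcomp Require Import all_boot all_order all_algebra.
From mathcomp Require Import all_classical all_reals all_analysis.
From mathcomp Require Import complex.
Set Implicit Arguments.
Unset Strict Implicit.
Unset Printing Implicit Defensive.
Import Order.TTheory GRing.Theory Num.Theory.
Import numFieldNormedType.Exports.
Local Open Scope classical_set_scope.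
Local Open Scope ring_scope.

Inductive cardinal :=
  Northwest | North | Northeast | Southeast | South | Southwest.

Definition cardinal_code (d : cardinal) : 'I_6 :=
  inord (match d with
         | Northwest => 0 | North => 1 | Northeast => 2
         | Southeast => 3 | South => 4 | Southwest => 5
         end).

Definition cardinal_decode (i : 'I_6) : cardinal :=
  nth Northwest [:: Northwest; North; Northeast; Southeast; South; Southwest] i.

Lemma cardinal_codeK : cancel cardinal_code cardinal_decode.
Proof. by case; rewrite /cardinal_code /cardinal_decode inordK. Qed.

HB.instance Definition _ := Finite.copy cardinal (can_type cardinal_codeK).

Section Diagrams.
Context {R : realType}.

(* Triples ((x, y), z); measurable sets are the Borel sets of R^3. *)
Definition R3 : Type :=
  (measurableTypeR R * measurableTypeR R * measurableTypeR R)%type.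

Definition plane : set (R * R * R) := [set v | v.1.1 + v.1.2 + v.2 = 0].

Definition cardinal_vec (d : cardinal) : R * R * R :=
  match d with
  | Northwest => (0, 1, -1)
  | North => (-1, 1, 0)
  | Northeast => (-1, 0, 1)
  | Southeast => (0, -1, 1)
  | South => (1, -1, 0)
  | Southwest => (1, 0, -1)
  end.

Definition constant_coord (d : cardinal) (v : R * R * R) : R :=
  match d with
  | Northwest | Southeast => v.1.1
  | Northeast | Southwest => v.1.2
  | North | South => v.2
  end.

(* The set of points origin + t dir with 0 <= t <= len; it is half-infinite when
   len = +oo. *)
Record segment := Segment {
  origin : R * R * R;
  dir : cardinal;
  len : \bar R;
  multiplicity : nat
}.

Definition segment_ok (s : segment) : bool :=
  [&& origin s \in plane, (0 < len s)%E & (0 < multiplicity s)%N].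

Definition half_infinite (s : segment) : bool := len s == +oo%E.

(* Several entries may lie on the same line, and may overlap. *)
Definition diagram (D : seq segment) : bool := all segment_ok D.

Definition segment_param (s : segment) (t : measurableTypeR R) : R3 :=
  origin s + t *: cardinal_vec (dir s).

Definition segment_dom (s : segment) : set (measurableTypeR R) :=
  [set t | 0 <= t /\ (t%:E <= len s)%E].

(* Cardinal directions have Euclidean length sqrt 2, so arc length along a
   segment is sqrt 2 times the length of the interval of parameters. *)
Definition segment_measure (s : segment) (A : set R3) : \bar R :=
  ((Num.sqrt 2)%:E *
   lebesgue_measure (segment_dom s `&` segment_param s @^-1` A))%E.

(* This is a measure on R^3 supported on the plane. *)
Definition diagram_measure (D : seq segment) (A : set R3) : \bar R :=
  (\sum_(s <- D) (multiplicity s)%:R%:E * segment_measure s A)%E.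

Definition equivalent_on (U : set (R * R * R)) (D D' : seq segment) : Prop :=
  forall A : set R3, measurable A -> A `<=` U ->
    diagram_measure D A = diagram_measure D' A.

Definition equivalent (D D' : seq segment) : Prop :=
  equivalent_on [set: R * R * R] D D'.

(* m d is the multiplicity of the ray in direction d, 0 meaning no such ray. *)
Definition rays_from (v : R * R * R) (m : cardinal -> nat) : seq segment :=
  [seq Segment v d +oo%E (m d) | d <- enum [pred d | (0 < m d)%N]].

Definition emanating (D : seq segment) (v : R * R * R) (m : cardinal -> nat) :
    Prop :=
  exists2 U : set (R * R * R), nbhs v U & equivalent_on U D (rays_from v m).

Definition zero_tension (D : seq segment) (v : R * R * R) : Prop :=
  exists2 m, emanating D v m & \sum_(d : cardinal) cardinal_vec d *+ m d = 0.

(* Rays are counted without multiplicity: interior points of an edge of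
   multiplicity greater than 1 are not vertices. *)
Definition vertex (D : seq segment) (v : R * R * R) : Prop :=
  plane v /\
  exists2 m, emanating D v m & (2 < #|[pred d : cardinal | (0 < m d)%N]|)%N.

Definition honeycomb_diagram (D : seq segment) : Prop :=
  [/\ diagram D,
      forall v, plane v -> zero_tension D v,
      finite_set (vertex D)
    & all (fun s => half_infinite s ==>
             (dir s \in [:: Northwest; Northeast; South])) D].

(* The conditions in honeycomb_diagram only depend on the class of D. *)
Definition honeycomb (H : set (seq segment)) : Prop :=
  exists2 D, honeycomb_diagram D &
    H = [set D' | diagram D' /\ equivalent D D'].

(* Constant coordinates of the half-infinite segments in direction d, repeated
   according to multiplicity, in weakly decreasing order. *)
Definition boundary (D : seq segment) (d : cardinal) : seq R :=
  sort >=%O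
    (flatten [seq nseq (multiplicity s) (constant_coord d (origin s))
             | s <- D & half_infinite s && (dir s == d)]).

(* Far out on a half-line, the measure of D is the total multiplicity of the
   half-infinite segments covering it, so that boundary D d only depends on the
   class of D, and any representative may be used. *)
Definition boundary_values (H : set (seq segment)) (b : seq R * seq R * seq R) :
    Prop :=
  exists2 D, H D &
    (boundary D Northwest, boundary D Northeast, boundary D South) = b.

Definition n_honeycomb (n : nat) (H : set (seq segment)) : Prop :=
  honeycomb H /\
  exists2 b, boundary_values H b &
    [/\ size b.1.1 = n, size b.1.2 = n & size b.2 = n].

Definition has_spectrum (n : nat) (A : 'M[R[i]]_n) (lam : n.-tuple R) : Prop :=
  char_poly A = \prod_(x <- lam) ('X - (real_complex R x)%:P).

End Diagrams.

Arguments segment R : clear implicits.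

(* Main.v *)
(** Write nu for its opposite, so that three Hermitian matrices sum to zero and
    the three boundary lists play symmetric roles.

    From matrices to honeycombs: the eigenvector flags of the matrices, weighted
    by the eigenvalues, form a semistable triple of filtrations. Moving the
    weights until some subspace becomes tight, and splitting off that subspace,
    one obtains by induction a hive (a concave function on a triangular grid)
    with the given boundary; direct sums correspond to sup-convolution of hives.
    The slopes of a hive on the unit triangles are the vertices of a honeycomb.

    From honeycombs to matrices: a honeycomb is encoded by a web, a trivalent
    bipartite graph drawn in the plane whose edges may have length zero. By
    Fredholm's alternative a web that is not a direct sum can be deformed with
    prescribed boundary displacement until an edge collapses, so the spectra of
    webs are obtained from scalar ones by direct sums and convex combinations.
    The spectra of Hermitian triples are convex too: for two triples of flags the
    line joining them meets, outside a finite set, only triples that are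
    semistable for both weights (quantifier elimination over the complex numbers
    and a compactness argument), hence for every combination of the weights, and
    a semistable triple of filtrations comes from Hermitian matrices (a stable
    one can be balanced by minimizing a Kempf-Ness function). *)
From HB Require Import structures.
Require Import Defs.
From mathcomp Require Import all_boot all_order all_algebra.
From mathcomp Require Import boolp.
From mathcomp Require Import ring lra zify.
Set Implicit Arguments.
Unset Strict Implicit.
Unset Printing Implicit Defensive.
Import Order.TTheory GRing.Theory Num.Theory.
Local Open Scope ring_scope.

(** * Webs *)

(** Convexity enters twice, at very different cost. Hives are cut out by linear inequalities, so
    averaging them is free. Hermitian triples cannot be averaged, since their eigenvectors differ;
    what is linear in the eigenvalues is King's condition for fixed flags, hence the search for one
    triple of flags that is semistable for two weights at once.

    The inductions [web_ind] and [semistable_hiveable] share one scheme: open one gap between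
    boundary values, close another, run the motion both ways until something degenerates, and
    recover the start as a convex combination of the two stopping points. This needs two gaps;
    [web_scalar] and [one_gap_unstable] exclude the case of a single one. The motion never reverses
    the order of boundary values, so the combination can be taken entry by entry on sorted lists.

    A honeycomb is a class of measures, represented by any equivalent diagram. Local multiplicities
    must therefore be recovered from the measure before vertices and edges make sense; this is the
    purpose of [germ]. *)

Lemma fredholm (F : fieldType) (I J : finType) (a : I -> J -> F) (b : J -> F) :
  (forall y : J -> F, (forall i, \sum_j a i j * y j = 0) ->
     \sum_j b j * y j = 0) ->
  exists x : I -> F, forall j, \sum_i x i * a i j = b j.
Proof.
move=> H.
pose M := \matrix_(i < #|I|, j < #|J|) a (enum_val i) (enum_val j).
pose v := \row_(j < #|J|) b (enum_val j).
have [|nsub] := boolP (v <= M)%MS.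
  case/submxP=> x xP; exists (fun i => x 0 (enum_rank i)) => j.
  have := congr1 (fun N : 'rV_ _ => N 0 (enum_rank j)) xP.
  rewrite !mxE enum_rankK => ->.
  rewrite (reindex (@enum_rank I)) /=; last first.
    by exists enum_val => i _; rewrite ?enum_rankK ?enum_valK.
  by apply: eq_bigr => i _; rewrite mxE !enum_rankK.
move: nsub; rewrite submxE => /eqP nz; case: nz.
apply/rowP => k; rewrite mxE [RHS]mxE.
(* The columns of the cokernel of [M] serve as test vectors: if [b] pairs to zero with all of them,
   then [v] lies in the row space of [M]. *)
pose y j := cokermx M (enum_rank j) k.
have Hy : \sum_j b j * y j = 0.
  apply: H => i.
  have E := congr1 (fun N : 'M_(_, _) => N (enum_rank i) k) (mulmx_coker M).
  rewrite mxE [RHS]mxE in E; apply: etrans E.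
  rewrite (reindex (@enum_val J predT)) /=; last first.
    by exists enum_rank => i' _; rewrite ?enum_rankK ?enum_valK.
  by apply: eq_bigr => j _; rewrite mxE /y enum_valK enum_rankK.
rewrite -[RHS]Hy (reindex (@enum_val J predT)) /=; last first.
  by exists enum_rank => i' _; rewrite ?enum_rankK ?enum_valK.
by apply: eq_bigr => j _; rewrite mxE /y enum_valK.
Qed.

(** Ratio test of linear programming: the least [a k / - b k] over the decreasing functions is the
    first time an inequality becomes an equality. It stops the motions of webs and of weights. *)
Lemma first_hit (R : realFieldType) (T : finType) (P : pred T) (a b : T -> R) :
  (forall k, P k -> 0 < a k) -> (exists2 k, P k & b k < 0) ->
  exists t, [/\ 0 < t, forall k, P k -> 0 <= a k + t * b k &
    exists2 k, P k & a k + t * b k = 0].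
Proof.
move=> a0 [k0 Pk0 bk0].
pose S := [pred k | P k && (b k < 0)].
have Sk0 : S k0 by rewrite /S /= Pk0.
have := @arg_minP _ _ _ k0 S (fun k => a k / - b k) Sk0.
case=> k /andP[Pk bk] kmin; exists (a k / - b k); split.
- by rewrite divr_gt0 ?oppr_gt0 ?a0.
- move=> j Pj; have [bj|bj] := ltP (b j) 0.
    have := kmin j; rewrite /S /= Pj bj => /(_ isT).
    rewrite ler_pdivlMr ?oppr_gt0 // mulrN => h.
    by rewrite -lerBlDr sub0r.
  apply: addr_ge0; first exact/ltW/a0.
  by rewrite mulr_ge0 // divr_ge0 ?oppr_ge0 ?ltW ?a0.
- exists k => //; rewrite mulrC; move: (b k) bk => x x0; field.
  by rewrite lt_eqF.
Qed.

Section Web.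
Variable R : realFieldType.
Variables U W : finType.
Implicit Types (A : {set U}) (B : {set W}) (phi : 'I_3 -> W -> U)
  (q : 'I_3 -> U -> R).

(* An up vertex u in A is the point of the plane with coordinates q s u, the
   start of one edge of each of the three boundary directions; w in B is the
   common end of the edges of type s from phi s w, possibly of length zero.
   The u outside phi s @: B start the half-infinite edges of type s. *)
Definition web A B phi q : Prop :=
  [/\ forall s, {in B &, injective (phi s)} /\ {in B, forall w, phi s w \in A},
      {in A, forall u, \sum_s q s u = 0},
      {in B, forall w, \sum_s q s (phi s w) = 0}
    & forall s, {in B, forall w, q (s + 1) (phi s w) <= q (s + 1) (phi (s + 1) w)}].

Definition web_bdry A B phi s : {set U} := A :\: phi s @: B.

(** A boundary multiset is recorded as the monic polynomial with these roots: direct sums become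
    products, and no order on the boundary has to be chosen. *)
Definition web_poly A B phi q s : {poly R} :=
  \prod_(u in web_bdry A B phi s) ('X - (q s u)%:P).

Lemma I3_case (s t : 'I_3) : [\/ t = s, t = s + 1 | t = s + 1 + 1].
Proof.
case: s t => [[|[|[|//]]] ?] [[|[|[|//]]] ?];
  by [apply: Or31; apply/val_inj | apply: Or32; apply/val_inj
     | apply: Or33; apply/val_inj].
Qed.

Lemma I3_S3 (s : 'I_3) : s + 1 + 1 + 1 = s.
Proof. by apply/val_inj; case: s => [[|[|[|//]]] ?]. Qed.

Lemma sum_I3 (V : nmodType) (f : 'I_3 -> V) (s : 'I_3) :
  \sum_i f i = f s + f (s + 1) + f (s + 1 + 1).
Proof.
rewrite (bigD1 s) //= (bigD1 (s + 1)) /=; last first.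
  by case: s => [[|[|[|//]]] ?].
rewrite (bigD1 (s + 1 + 1)) /=; last by case: s => [[|[|[|//]]] ?].
rewrite big1 ?addr0 ?addrA // => i /andP[/andP[i0 i1] i2].
by case: (I3_case s i) i0 i1 i2 => ->; rewrite eqxx.
Qed.

Lemma web_inj A B phi q s : web A B phi q -> {in B &, injective (phi s)}.
Proof. by case=> /(_ s)[]. Qed.

Lemma web_sub A B phi q s w : web A B phi q -> w \in B -> phi s w \in A.
Proof. by case=> /(_ s)[_ h] _ _ _ /h. Qed.

Lemma card_web_bdry A B phi q s : web A B phi q ->
  #|web_bdry A B phi s| = (#|A| - #|B|)%N.
Proof.
move=> wq; rewrite /web_bdry cardsD (setIidPr _).
  by rewrite card_in_imset //; apply: web_inj wq.
by apply/subsetP => u /imsetP[w wB ->]; apply: web_sub wq wB.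
Qed.

Lemma web_card_le A B phi q : web A B phi q -> (#|B| <= #|A|)%N.
Proof.
move=> wq; rewrite -(card_in_imset (@web_inj _ _ _ _ 0 wq)).
by apply/subset_leq_card/subsetP => u /imsetP[w wB ->]; apply: web_sub wq wB.
Qed.

(** Double counting: the coordinates over [A] sum to zero, and those carried by finite edges,
    regrouped at their ends in [B], sum to zero as well. *)
Lemma web_trace A B phi q : web A B phi q ->
  \sum_s \sum_(u in web_bdry A B phi s) q s u = 0.
Proof.
move=> wq; have [_ h1 h2 _] := wq.
have E s : \sum_(u in A) q s u =
    \sum_(u in web_bdry A B phi s) q s u + \sum_(w in B) q s (phi s w).
  rewrite (big_setID (phi s @: B)) /= addrC; congr (_ + _).
  rewrite (setIidPr _); last first.
    by apply/subsetP => u /imsetP[w wB ->]; apply: web_sub wq wB.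
  by rewrite big_imset //=; apply: web_inj wq.
have : \sum_s \sum_(u in A) q s u = 0.
  by rewrite exchange_big big1.
under eq_bigr do rewrite E.
rewrite big_split /= [X in _ + X]exchange_big /=.
by rewrite [X in _ + X]big1 ?addr0.
Qed.

(* A Y and an inverted Y joined by an edge of length zero form a crossing of
   two lines and can be deleted. *)
Lemma web_contract A B phi q s w : web A B phi q -> w \in B ->
  q (s + 1) (phi s w) = q (s + 1) (phi (s + 1) w) ->
  exists phi', web (A :\ phi s w) (B :\ w) phi' q /\
    forall t, web_poly (A :\ phi s w) (B :\ w) phi' q t = web_poly A B phi q t.
Proof.
move=> wq wB len0; have [h0 h1 h2 h3] := wq.
set u := phi s w.
have uA : u \in A by apply: web_sub wq wB.
(* [w] and [u] are the same point: coordinate [s] is constant along the edge joining them,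
   coordinate [s + 1] agrees by [len0], and both triples sum to zero. *)
have eqp t : q t (phi t w) = q t u.
  have E1 := h1 u uA; have E2 := h2 w wB.
  rewrite (sum_I3 _ s) in E1; rewrite (sum_I3 _ s) in E2.
  move: E1 E2 len0; rewrite /u => E1 E2 len0.
  by case: (I3_case s t) => ->; lra.
(* An edge of type [t] leaving [u] is merged with the one from [phi t w] to [w], so it now starts at
   [phi t w]. *)
pose phi' t v := if phi t v == u then phi t w else phi t v.
have qphi' t v : q t (phi' t v) = q t (phi t v).
  by rewrite /phi'; case: eqP => [->|].
have phi'u t v : v \in B :\ w -> phi' t v != u.
  rewrite !inE /phi' => /andP[vw vB]; case: ifP => [/eqP e|/negbT//].
  apply: contra vw => /eqP e'.
  by apply/eqP/(web_inj wq vB wB (s := t)); rewrite e.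
exists phi'; split.
  split=> [t|v|v|t v].
  - split=> [v v'|v vB]; last first.
      rewrite in_setD1 phi'u //=; move: vB; rewrite !inE => /andP[_ vB].
      by rewrite /phi'; case: ifP => _; apply: web_sub wq _.
    rewrite !inE => /andP[vw vB] /andP[vw' vB'].
    rewrite /phi'; case: ifP => [/eqP e|_]; case: ifP => [/eqP e'|_] //.
    + by move=> _; apply: (web_inj wq vB vB' (s := t)); rewrite e.
    + by move=> /(web_inj wq wB vB' (s := t)) ww; rewrite ww eqxx in vw'.
    + by move=> /(web_inj wq vB wB (s := t)) ww; rewrite ww eqxx in vw.
    + exact: web_inj wq _ _ vB vB'.
  - by rewrite in_setD1 => /andP[_ /h1].
  - rewrite in_setD1 => /andP[_ /h2 E]; rewrite -[RHS]E.
    by apply: eq_bigr => t _; rewrite qphi'.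
  - rewrite in_setD1 => /andP[_ vB]; rewrite qphi' {1}/phi'; case: ifP => [/eqP e|_].
      apply: le_trans (h3 t v vB); rewrite e -eqp; exact: h3.
    exact: h3.
move=> t; rewrite /web_poly.
have E : phi' t @: (B :\ w) :\: [set phi t w] =
         phi t @: B :\: [set phi t w; u].
  apply/setP => x; rewrite !inE negb_or; apply/andP/andP.
    case=> xw /imsetP[v vB e]; rewrite xw e phi'u //; split => //.
    have vB' : v \in B by move: vB; rewrite inE => /andP[].
    by rewrite /phi'; case: ifP => _; apply: imset_f.
  case=> /andP[xw xu] /imsetP[v vB e]; split=> //; apply/imsetP; exists v.
    by rewrite !inE vB andbT; apply: contra xw => /eqP <-; rewrite e.
  by rewrite /phi' -e (negPf xu).
have Ex x : x != phi t w -> (x \in phi' t @: (B :\ w)) =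
    (x != u) && (x \in phi t @: B).
  move=> xw; move/setP/(_ x): E; rewrite !inE negb_or xw /=.
  by move=> ->.
have phiwB : phi t w \in phi t @: B by apply: imset_f.
have [tu|tu] := eqVneq (phi t w) u.
  have E' : web_bdry (A :\ u) (B :\ w) phi' t = web_bdry A B phi t.
    apply/setP => x; rewrite !inE; have [->|xw] := eqVneq x (phi t w).
      by rewrite phiwB -tu eqxx andbF.
    by rewrite Ex // -tu xw.
  by rewrite E'.
have wA : phi t w \in A by apply: web_sub wq wB.
have [uB|uB] := boolP (u \in phi t @: B).
  have wI : phi t w \in phi' t @: (B :\ w).
    case/imsetP: uB => v vB e; apply/imsetP; exists v.
      by rewrite !inE vB andbT; apply: contra tu => /eqP <-; rewrite e.
    by rewrite /phi' -e eqxx.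
  have E' : web_bdry (A :\ u) (B :\ w) phi' t = web_bdry A B phi t.
    apply/setP => x; rewrite !inE; have [->|xw] := eqVneq x (phi t w).
      by rewrite phiwB wI.
    rewrite Ex //; have [->|xu] //= := eqVneq x u.
    by rewrite uB.
  by rewrite E'.
(* Here [u] starts a half-infinite edge of type [t]; after the contraction it starts at [phi t w],
   with the same constant coordinate by [eqp]. *)
have E1 : web_bdry A B phi t = u |: (web_bdry A B phi t :\ u).
  by rewrite setD1K // inE uB.
have wI : phi t w \notin phi' t @: (B :\ w).
  apply/imsetP => -[v vB]; rewrite /phi'; case: ifP => [/eqP e|_].
    case/negP: uB; rewrite -e; apply: imset_f.
    by move: vB; rewrite inE => /andP[].
  move: vB; rewrite !inE => /andP[vw vB] /(web_inj wq wB vB (s := t)) e.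
  by rewrite e eqxx in vw.
have E2 : web_bdry (A :\ u) (B :\ w) phi' t =
   phi t w |: (web_bdry A B phi t :\ u).
  apply/setP => x; rewrite !inE; have [->|xw] /= := eqVneq x (phi t w).
    by rewrite (negPf wI) tu wA.
  by rewrite Ex //; case: (x == u); rewrite ?andbF.
rewrite E1 E2 !big_setU1 /= ?eqp ?setD11 //.
by rewrite !inE phiwB /= andbF.
Qed.

(** A minimizer of coordinate [s] cannot start a finite edge of type [s]: at the end of that edge,
    the edge of type [s + 1 + 1] arrives with coordinate [s] increasing, hence from a strictly
    smaller value. *)
Lemma web_min A B phi q s u : web A B phi q ->
  (forall t w, w \in B -> q (t + 1) (phi t w) < q (t + 1) (phi (t + 1) w)) ->
  u \in A -> exists2 v, v \in web_bdry A B phi s & q s v <= q s u.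
Proof.
move=> wq len uA.
have := @arg_minP _ _ _ u (mem A) (q s) uA.
case=> v vA0 vmin; have vA : v \in A := vA0.
exists v; last exact: vmin.
rewrite inE vA andbT; apply/imsetP => -[w wB e].
have := len (s + 1 + 1) w wB; rewrite I3_S3 -e ltNge.
by rewrite vmin //; apply: web_sub wq wB.
Qed.

(** [web_min] for the two flat types bounds each boundary value of type [s] by [- (b + c)], and the
    trace identity leaves no room below this bound. *)
Lemma web_scalar A B phi q s b c u v : web A B phi q ->
  (forall t w, w \in B -> q (t + 1) (phi t w) < q (t + 1) (phi (t + 1) w)) ->
  {in web_bdry A B phi (s + 1), forall u, q (s + 1) u = b} ->
  {in web_bdry A B phi (s + 1 + 1), forall u, q (s + 1 + 1) u = c} ->
  u \in web_bdry A B phi s -> v \in web_bdry A B phi s -> q s u = q s v.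
Proof.
move=> wq len hb hc us vs.
have up x : x \in web_bdry A B phi s -> q s x <= - (b + c).
  rewrite inE => /andP[_ xA].
  have [y yb yx] := web_min (s + 1) wq len xA.
  have [z zc zx] := web_min (s + 1 + 1) wq len xA.
  have [_ /(_ x xA) + _ _] := wq; rewrite (sum_I3 _ s).
  move: yx zx; rewrite (hb y) // (hc z) //; lra.
have tr := web_trace wq; rewrite (sum_I3 _ s) in tr.
rewrite (eq_bigr _ hb) [X in _ + X](eq_bigr _ hc) in tr.
rewrite !sumr_const !(card_web_bdry _ wq) in tr.
rewrite -(card_web_bdry s wq) -!sumr_const -!big_split /= in tr.
have eqs x : x \in web_bdry A B phi s -> q s x = - (b + c).
  move=> xs; apply/eqP; rewrite eq_le up //= leNgt; apply/negP => lt.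
  move: tr; rewrite (bigD1 x) //= => tr.
  have : \sum_(i in web_bdry A B phi s | i != x) (q s i + b + c) <= 0.
    by apply: sumr_le0 => i /andP[/up ? _]; lra.
  by move: lt tr; lra.
by rewrite !eqs.
Qed.

End Web.

Lemma sum_pair (V : nmodType) (I J : finType) (F : I * J -> V) :
  \sum_i F i = \sum_i \sum_j F (i, j).
Proof. by rewrite pair_bigA; apply: eq_bigr => -[]. Qed.

(** * Induction on webs by deformation, contraction and splitting *)

Section WebInduction.
Variables (R : realFieldType) (U W : finType).
Implicit Types (A : {set U}) (B : {set W}) (phi : 'I_3 -> W -> U)
  (q : 'I_3 -> U -> R).

Definition web_short B phi q : Prop :=
  exists s w, w \in B /\ q (s + 1) (phi s w) = q (s + 1) (phi (s + 1) w).

Definition web_gaps A B phi q :=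
  [set x : 'I_3 * U * U | [&& x.1.2 \in web_bdry A B phi x.1.1,
     x.2 \in web_bdry A B phi x.1.1 & q x.1.1 x.1.2 < q x.1.1 x.2]].

(** Connectedness in the form in which the dual system of [connected_extend] meets it: a potential
    on the up vertices that agrees around each [w] is constant. *)
Definition connected A B phi := forall al : U -> R,
  (forall s t w, w \in B -> al (phi s w) = al (phi t w)) ->
  {in A &, forall u v, al u = al v}.

(** By Fredholm's alternative only the dual solutions matter. Such a solution is a potential on the
    up vertices, taken with opposite sign at the down vertices and boundary equations. Connectedness
    makes it constant, and its pairing with [de] is then a multiple of the total displacement. *)
Lemma connected_extend A B phi q (de : 'I_3 -> U -> R) :
  web A B phi q -> connected A B phi ->
  \sum_s \sum_(u in web_bdry A B phi s) de s u = 0 ->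
  exists et : 'I_3 -> U -> R,
    [/\ {in A, forall u, \sum_s et s u = 0},
        {in B, forall w, \sum_s et s (phi s w) = 0} &
        forall s, {in web_bdry A B phi s, forall u, et s u = de s u}].
Proof.
move=> wq conn tot.
(* One equation per up vertex, per down vertex and per prescribed boundary value; indices outside
   these sets give the trivial equation. *)
pose a (i : 'I_3 * U) (j : U + W + 'I_3 * U) : R :=
  match j with
  | inl (inl u) => ((u \in A) && (i.2 == u))%:R
  | inl (inr w) => ((w \in B) && (i.2 == phi i.1 w))%:R
  | inr (s, u) => ((u \in web_bdry A B phi s) && (i == (s, u)))%:R
  end.
pose b (j : U + W + 'I_3 * U) : R :=
  match j with
  | inl _ => 0
  | inr (s, u) => de s u *+ (u \in web_bdry A B phi s)
  end.
have [|x xP] := @fredholm _ _ _ a b; last first.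
  exists (fun s u => x (s, u)); split.
  - move=> u uA; have := xP (inl (inl u)); rewrite /a /b /= uA /= => E; rewrite -[RHS]E.
    rewrite sum_pair /=.
    apply: eq_bigr => s _; rewrite (bigD1 u) //= eqxx mulr1 big1 ?addr0 //.
    by move=> v /negPf ->; rewrite mulr0.
  - move=> w wB; have := xP (inl (inr w)); rewrite /a /b /= wB /= => E; rewrite -[RHS]E.
    rewrite sum_pair /=.
    apply: eq_bigr => s _; rewrite (bigD1 (phi s w)) //= eqxx mulr1.
    by rewrite big1 ?addr0 // => v /negPf ->; rewrite mulr0.
  - move=> s u us; have := xP (inr (s, u)); rewrite /a /b /= us /= mulr1n => <-.
    rewrite (bigD1 (s, u)) //= eqxx mulr1 big1 ?addr0 //.
    by move=> v /negPf ->; rewrite mulr0.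
move=> y yP.
have key s u : u \in A -> y (inl (inl u)) +
    \sum_(w in B | phi s w == u) y (inl (inr w)) +
    (y (inr (s, u))) *+ (u \in web_bdry A B phi s) = 0.
  move=> uA; have := yP (s, u); rewrite !big_sumType /= => E.
  rewrite -[RHS]E; congr (_ + _ + _).
  - rewrite (bigD1 u) //= uA eqxx mul1r big1 ?addr0 // => v.
    by rewrite eq_sym => /negPf ->; rewrite andbF mul0r.
  - rewrite big_mkcond /=; apply: eq_bigr => w _; rewrite eq_sym.
    by case: ifP; rewrite ?mul1r ?mul0r.
  - rewrite (bigD1 (s, u)) //= eqxx andbT big1 ?addr0 ?mulr_natl //.
    by move=> [t v]; rewrite eq_sym /= => /negPf ->; rewrite andbF mul0r.
pose al u := y (inl (inl u)).
have al_w s w : w \in B -> al (phi s w) = - y (inl (inr w)).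
  move=> wB; have := key s _ (web_sub s wq wB).
  rewrite /web_bdry inE imset_f //= mulr0n addr0 (bigD1 w) /=; last first.
    by rewrite wB eqxx.
  rewrite big1 ?addr0 => [|v /andP[/andP[vB /eqP e] /eqP vw]]; last first.
    by case: vw; apply: web_inj wq _ _ vB wB e.
  by rewrite /al; lra.
have al_c : {in A &, forall u v, al u = al v}.
  by apply: conn => s t w wB; rewrite !al_w.
have al_b s u : u \in web_bdry A B phi s -> y (inr (s, u)) = - al u.
  move=> us; have := us; rewrite inE => /andP[uB uA].
  have := key s u uA; rewrite us mulr1n big1; first by rewrite /al; lra.
  by move=> w /andP[wB /eqP e]; case/negP: uB; rewrite -e imset_f.
rewrite big_sumType /= [X in X + _]big1 ?add0r; last by move=> ? _; rewrite mul0r.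
rewrite sum_pair /=.
have [-> |[u0 u0A]] := set_0Vmem A.
  rewrite big1 // => s _; rewrite big1 // => u _.
  by rewrite /web_bdry !inE andbF mulr0n mul0r.
transitivity (- al u0 * \sum_s \sum_(u in web_bdry A B phi s) de s u);
  last by rewrite tot mulr0.
rewrite mulr_sumr; apply: eq_bigr => s _; rewrite mulr_sumr [RHS]big_mkcond.
apply: eq_bigr => u _; case: ifP => us; last by rewrite mulr0n mul0r.
rewrite al_b // mulr1n mulrC (al_c u u0) //.
by move: us; rewrite inE => /andP[].
Qed.

Lemma web_split A B phi q (al : U -> R) u0 : web A B phi q ->
  (forall s t w, w \in B -> al (phi s w) = al (phi t w)) ->
  forall A1 B1, A1 = [set u in A | al u == al u0] ->
    B1 = [set w in B | al (phi 0 w) == al u0] ->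
  [/\ web A1 B1 phi q, web (A :\: A1) (B :\: B1) phi q &
      forall s, web_poly A B phi q s =
        web_poly A1 B1 phi q s * web_poly (A :\: A1) (B :\: B1) phi q s].
Proof.
move=> wq alP A1 B1 eA eB; have [h0 h1 h2 h3] := wq.
have sA : A1 \subset A by rewrite eA; apply/subsetP => u; rewrite inE => /andP[].
have sB : B1 \subset B by rewrite eB; apply/subsetP => u; rewrite inE => /andP[].
have in1 s w : w \in B -> (phi s w \in A1) = (w \in B1).
  by move=> wB; rewrite eA eB !inE wB (web_sub s wq wB) (alP s 0).
split.
- split=> [s|u /(subsetP sA)/h1|w /(subsetP sB)/h2|s w /(subsetP sB)/h3] //.
  split=> [w w' /(subsetP sB) wB /(subsetP sB) wB'|w wB1].
    exact: web_inj wq _ _ wB wB'.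
  by rewrite in1 // (subsetP sB).
- split=> [s|u|w|s w]; last first.
  + by rewrite inE => /andP[_ /h3].
  + by rewrite inE => /andP[_ /h2].
  + by rewrite inE => /andP[_ /h1].
  split=> [w w'|w].
    by rewrite !inE => /andP[_ wB] /andP[_ wB']; exact: web_inj wq _ _ wB wB'.
  by rewrite !inE => /andP[wB1 wB]; rewrite in1 // wB1 (web_sub s wq wB).
move=> s; have e1 u : u \in A1 -> (u \in phi s @: B) = (u \in phi s @: B1).
  move=> uA1; apply/imsetP/imsetP => -[w wB e].
    by exists w => //; rewrite -(in1 s) // -e.
  by exists w => //; apply: (subsetP sB).
have e2 u : u \notin A1 -> (u \in phi s @: B) = (u \in phi s @: (B :\: B1)).
  move=> uA1; apply/imsetP/imsetP => -[w wB e]; exists w => //.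
    by rewrite inE wB andbT -(in1 s) // -e.
  by move: wB; rewrite inE => /andP[].
rewrite /web_poly (big_setID A1) /=; congr (_ * _); apply: eq_bigl => u.
  rewrite /web_bdry !in_setI !in_setD; case: (boolP (u \in A1)) => uA1.
    by rewrite e1 // (subsetP sA) // !andbT.
  by rewrite !andbF.
rewrite /web_bdry !in_setD; case: (boolP (u \in A1)) => uA1.
  by rewrite !andbF.
by rewrite e2.
Qed.

(** [Q n c] will say that [c] lists the characteristic polynomials of three Hermitian matrices of
    size [n] with sum zero. [Q_conv] takes decreasing families because convexity concerns ordered
    spectra. *)
Variable Q : nat -> ('I_3 -> {poly R}) -> Prop.
Hypothesis Q_ext : forall n c c', (forall s, c s = c' s) -> Q n c -> Q n c'.
Hypothesis Q_scalar : forall n (a : 'I_3 -> R), \sum_s a s = 0 ->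
  Q n (fun s => ('X - (a s)%:P) ^+ n).
Hypothesis Q_sum : forall n1 n2 c1 c2, Q n1 c1 -> Q n2 c2 ->
  Q (n1 + n2) (fun s => c1 s * c2 s).
Hypothesis Q_conv : forall n (b0 b1 : 'I_3 -> 'I_n -> R) th,
  (forall s (i j : 'I_n), (i <= j)%N -> b0 s j <= b0 s i) ->
  (forall s (i j : 'I_n), (i <= j)%N -> b1 s j <= b1 s i) ->
  Q n (fun s => \prod_i ('X - (b0 s i)%:P)) ->
  Q n (fun s => \prod_i ('X - (b1 s i)%:P)) -> 0 <= th <= 1 ->
  Q n (fun s => \prod_i ('X - ((1 - th) * b0 s i + th * b1 s i)%:P)).

(** On the boundary [q0] and [q1] are monotone in [q], so one enumeration sorted by [q] sorts all
    three families and [Q_conv] applies. *)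
Lemma web_conv A B phi q0 q1 q n th : (#|A| - #|B|)%N = n ->
  web A B phi q -> 0 <= th <= 1 ->
  (forall s u, u \in web_bdry A B phi s -> q s u = (1 - th) * q0 s u + th * q1 s u) ->
  (forall s u v, u \in web_bdry A B phi s -> v \in web_bdry A B phi s ->
     q s u <= q s v -> q0 s u <= q0 s v /\ q1 s u <= q1 s v) ->
  Q n (web_poly A B phi q0) -> Q n (web_poly A B phi q1) -> Q n (web_poly A B phi q).
Proof.
move=> cn wq th01 qE mono Q0 Q1.
have [n0|n0] := posnP n.
  apply: Q_ext Q0 => s; rewrite /web_poly !big1 // => u us; exfalso.
    by move: (card_web_bdry s wq); rewrite (cardD1 u) us; lia.
  by move: (card_web_bdry s wq); rewrite (cardD1 u) us; lia.
have [u0 _] : exists u, u \in web_bdry A B phi 0.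
  by apply/card_gt0P; rewrite (card_web_bdry 0 wq) cn.
pose l s := sort (fun u v => q s v <= q s u) (enum (web_bdry A B phi s)).
have szl s : size (l s) = n by rewrite size_sort -cardE (card_web_bdry s wq).
have lP s i : (i < n)%N -> nth u0 (l s) i \in web_bdry A B phi s.
  by move=> i_n; rewrite -mem_enum -(mem_sort (fun u v => q s v <= q s u)) mem_nth // szl.
have lmono s i j : (i <= j)%N -> (j < n)%N ->
    q s (nth u0 (l s) j) <= q s (nth u0 (l s) i).
  move=> ij jn.
  apply: (@sorted_leq_nth _ (fun u v => q s v <= q s u)) => //.
  - by move=> x y z yx zy; apply: le_trans zy yx.
  - by apply: sort_sorted => x y; apply: le_total.
  - by rewrite inE szl (leq_ltn_trans ij).
  - by rewrite inE szl.
have pE (f : 'I_3 -> U -> R) s : web_poly A B phi f s =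
    \prod_(i < n) ('X - (f s (nth u0 (l s) i))%:P).
  rewrite /web_poly -big_enum.
  rewrite -(perm_big _ (permEl (perm_sort (fun u v => q s v <= q s u) _))) /=.
  by rewrite -/(l s) (big_nth u0) szl big_mkord.
apply: (@Q_ext _ (fun s => \prod_(i < n)
   ('X - ((1 - th) * q0 s (nth u0 (l s) i) + th * q1 s (nth u0 (l s) i))%:P))).
  by move=> s; rewrite pE; apply: eq_bigr => i _; rewrite qE ?lP.
apply: (@Q_conv n (fun s i => q0 s (nth u0 (l s) i))
                  (fun s i => q1 s (nth u0 (l s) i))) => //.
- move=> s i j ij; have := mono s _ _ (lP s j (ltn_ord j)) (lP s i (ltn_ord i)).
  by case; rewrite ?lmono.
- move=> s i j ij; have := mono s _ _ (lP s j (ltn_ord j)) (lP s i (ltn_ord i)).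
  by case; rewrite ?lmono.
- by apply: Q_ext Q0 => s; rewrite pE.
- by apply: Q_ext Q1 => s; rewrite pE.
Qed.

(** The velocity of a boundary edge depends only on its constant coordinate, so equal boundary
    values stay equal; a uniform correction in type 0 makes the total displacement zero. Edge
    lengths and boundary gaps are given to [first_hit] together: the motion stops when an edge
    collapses or two distinct boundary values meet. *)
Lemma web_move A B phi q (de : 'I_3 -> R -> R) s u v :
  web A B phi q -> (0 < #|A| - #|B|)%N ->
  (forall t w, w \in B -> q (t + 1) (phi t w) < q (t + 1) (phi (t + 1) w)) ->
  connected A B phi ->
  (s, u, v) \in web_gaps A B phi q -> de s (q s v) < de s (q s u) ->
  exists t et, [/\ 0 < t :> R, web A B phi (fun s u => q s u + t * et s u),
    forall s u, u \in web_bdry A B phi s -> et s u = de s (q s u) -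
      (s == 0)%:R * (\sum_i \sum_(u in web_bdry A B phi i) de i (q i u))
        / (#|A| - #|B|)%:R,
    forall s' u v, u \in web_bdry A B phi s' -> v \in web_bdry A B phi s' ->
      q s' u <= q s' v -> q s' u + t * et s' u <= q s' v + t * et s' v &
    web_short B phi (fun s u => q s u + t * et s u) \/
    (#|web_gaps A B phi (fun s u => q s u + t * et s u)%R| <
       #|web_gaps A B phi q|)%N].
Proof.
move=> wq n_gt0 len conn gsuv desuv; have [h0 h1 h2 h3] := wq.
set ka := \sum_i _; pose n : R := (#|A| - #|B|)%:R.
have n0 : n != 0 by rewrite pnatr_eq0 -lt0n.
have [|et [et1 et2 etE]] := @connected_extend A B phi q
    (fun s u => de s (q s u) - (s == 0)%:R * ka / n) wq conn.
  under eq_bigr do rewrite sumrB sumr_const (card_web_bdry _ wq).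
  rewrite sumrB -/ka [X in _ - X](bigD1 0) //= [X in _ - (_ + X)]big1.
    by rewrite addr0 mul1r -mulrnAl -mulr_natr -/n mulfK ?subrr.
  by move=> i /negPf ->; rewrite !mul0r mul0rn.
pose P (k : 'I_3 * W + 'I_3 * U * U) : bool := match k with
  | inl x => x.2 \in B | inr x => x \in web_gaps A B phi q end.
pose L (r : 'I_3 -> U -> R) (k : 'I_3 * W + 'I_3 * U * U) : R := match k with
  | inl x => r (x.1 + 1) (phi (x.1 + 1) x.2) - r (x.1 + 1) (phi x.1 x.2)
  | inr x => r x.1.1 x.2 - r x.1.1 x.1.2 end.
have gapE x : x \in web_gaps A B phi q ->
    L et (inr x) = de x.1.1 (q x.1.1 x.2) - de x.1.1 (q x.1.1 x.1.2).
  by rewrite inE => /and3P[xu xv _] /=; rewrite !etE //; ring.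
have [||t [t0 tP [k Pk tk]]] := @first_hit _ _ P (L q) (L et).
- case=> [[i w]|x] /=; first by move=> wB; rewrite subr_gt0 len.
  by rewrite inE => /and3P[_ _]; rewrite subr_gt0.
- by exists (inr (s, u, v)) => //; rewrite gapE // subr_lt0.
have mono s' u' v' : u' \in web_bdry A B phi s' -> v' \in web_bdry A B phi s' ->
    q s' u' <= q s' v' -> q s' u' + t * et s' u' <= q s' v' + t * et s' v'.
  move=> us vs; rewrite le_eqVlt => /orP[/eqP e|lt]; first by rewrite !etE // e.
  have /= := tP (inr (s', u', v')); rewrite inE us vs lt => /(_ isT); lra.
exists t, et; split=> //.
  split=> [//|x xA|w wB|i w wB].
  - by rewrite big_split /= -mulr_sumr h1 // et1 // mulr0 addr0.
  - by rewrite big_split /= -mulr_sumr h2 // et2 // mulr0 addr0.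
  - have /= := tP (inl (i, w)); rewrite wB => /(_ isT); lra.
case: k Pk tk => [[i w]|x] /= Pk tk; [left|right].
  by exists i, w; split=> //; lra.
apply: proper_card; apply/properP; split; last first.
  by exists x => //; rewrite inE !negb_and -leNgt; apply/orP; right; apply/orP; right; lra.
apply/subsetP => y; rewrite inE => /and3P[yu yv lt]; rewrite inE yu yv /=.
by rewrite ltNge; apply/negP => le; move: lt; rewrite ltNge mono.
Qed.

(** Outer induction on the number of up vertices, which drops under contraction and splitting; inner
    induction on the number of pairs of distinct boundary values, which drops when two of them
    merge. *)
Theorem web_ind A B phi q : web A B phi q -> Q (#|A| - #|B|) (web_poly A B phi q).
Proof.
have [a le_a] := ubnP #|A|.
elim: a => [//|a IHa] in A B phi q le_a *.
have [g le_g] := ubnP #|web_gaps A B phi q|.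
elim: g => [//|g IHg] in q le_g * => wq.
have cardD x (X : {set U}) : x \in X -> #|X :\ x| = #|X|.-1.
  by move=> xX; rewrite (cardsD1 x X) xX.
have [n0|n_gt0] := posnP (#|A| - #|B|)%N.
  rewrite n0; apply: (Q_ext (c := fun s => ('X - (0 : R)%:P) ^+ 0)).
    move=> s; rewrite expr0 /web_poly big1 // => u us; exfalso.
    by move: (card_web_bdry s wq); rewrite (cardD1 u) us n0.
  by apply: (@Q_scalar 0 (fun=> 0)); rewrite big1.
have Qshort r : web A B phi r -> web_short B phi r ->
    Q (#|A| - #|B|) (web_poly A B phi r).
  move=> wr [s [w [wB e]]].
  have [phi' [wr' pE]] := web_contract wr wB e.
  have uA := web_sub s wr wB.
  apply: Q_ext pE _.
  have -> : (#|A| - #|B| = #|A :\ phi s w| - #|B :\ w|)%N.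
    rewrite cardD // [in LHS](cardsD1 w B) wB /=.
    by move: (web_card_le wr) (cardsD1 w B); rewrite wB; lia.
  by apply: IHa wr'; rewrite cardD //; move: le_a n_gt0; lia.
have [/Qshort-/(_ wq)//|nshort] := EM (web_short B phi q).
have len t w : w \in B -> q (t + 1) (phi t w) < q (t + 1) (phi (t + 1) w).
  move=> wB; rewrite lt_neqAle; apply/andP; split; last by case: wq => _ _ _; apply.
  by apply/eqP => e; apply: nshort; exists t, w.
have [conn|nconn] := EM (connected A B phi); last first.
  apply: contrapT => nQ; apply: nconn => al alP u v uA vA.
  apply: contrapT => /eqP ne; apply: nQ.
  have [w1 w2 pE] := web_split wq alP (erefl [set x in A | al x == al u]) erefl.
  apply: (Q_ext (fun s => esym (pE s))).
  set A1 := [set x in A | _] in w1 w2 *; set B1 := [set x in B | _] in w1 w2 *.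
  have sA : A1 \subset A by apply/subsetP => x; rewrite inE => /andP[].
  have sB : B1 \subset B by apply/subsetP => x; rewrite inE => /andP[].
  have := web_card_le w1; have := web_card_le w2.
  have cA := cardsID A1 A; have cB := cardsID B1 B.
  rewrite (setIidPr sA) in cA; rewrite (setIidPr sB) in cB => c2 c1.
  have -> : (#|A| - #|B| = (#|A1| - #|B1|) + (#|A :\: A1| - #|B :\: B1|))%N by lia.
  have u1 : (0 < #|A1|)%N by rewrite (cardD1 u) inE uA eqxx.
  have v2 : (0 < #|A :\: A1|)%N by rewrite (cardD1 v) !inE vA eq_sym (negPf ne).
  by apply: Q_sum; apply: IHa => //; move: le_a; lia.
pose flat s := [forall u in web_bdry A B phi s, [forall v in web_bdry A B phi s,
  q s u == q s v]].
have flatP s : flat s -> {in web_bdry A B phi s &, forall u v, q s u = q s v}.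
  by move=> /forall_inP h u v us vs; have /forall_inP/(_ v vs)/eqP := h u us.
have nflatP s : ~~ flat s -> exists u v, (s, u, v) \in web_gaps A B phi q.
  case/forall_inPn => u us /forall_inPn[v vs]; rewrite neq_lt => /orP[lt|lt].
    by exists u, v; rewrite inE us vs.
  by exists v, u; rewrite inE us vs.
have bnz s : exists u, u \in web_bdry A B phi s.
  by apply/card_gt0P; rewrite (card_web_bdry s wq).
have [/forallP allflat|/forallPn[s nfs]] := boolP [forall s, flat s].
  have [f fP] := choice bnz.
  have vE s u : u \in web_bdry A B phi s -> q s u = q s (f s).
    by move=> us; apply: flatP.
  apply: (@Q_ext _ (fun s => ('X - (q s (f s))%:P) ^+ (#|A| - #|B|))) => [s|].
    rewrite /web_poly (eq_bigr (fun=> 'X - (q s (f s))%:P)) => [|u us].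
      by rewrite prodr_const (card_web_bdry s wq).
    by rewrite vE.
  apply: Q_scalar; have := web_trace wq.
  rewrite (eq_bigr (fun s => (#|A| - #|B|)%:R * q s (f s))); last first.
    move=> s _; rewrite (eq_bigr _ (vE s)) sumr_const (card_web_bdry s wq).
    by rewrite mulr_natl.
  by rewrite -mulr_sumr => /eqP; rewrite mulf_eq0 pnatr_eq0 eqn0Ngt n_gt0 => /eqP.
(* By [web_scalar], [s] cannot be the only type with a gap. *)
have [t st nft] : exists2 t, t != s & ~~ flat t.
  apply: contrapT => nt; case/nflatP: (nfs) => u [v]; rewrite inE /=.
  case/and3P => us vs; rewrite lt_neqAle => /andP[/eqP ne _]; apply: ne.
  have fl t : t != s -> flat t by move=> ts; apply: contrapT => /negP nf; apply: nt; exists t.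
  have [x xs] := bnz (s + 1); have [y ys] := bnz (s + 1 + 1).
  apply: (@web_scalar _ _ _ _ _ _ _ s (q (s + 1) x) (q (s + 1 + 1) y)) wq len _ _ us vs.
    move=> z zs; apply: flatP zs xs; apply: fl.
    by case: (s) => [[|[|[|//]]] ?].
  move=> z zs; apply: flatP zs ys; apply: fl.
  by case: (s) => [[|[|[|//]]] ?].
have [us [vs gs]] := nflatP s nfs; have [ut [vt gt]] := nflatP t nft.
have := gs; rewrite inE /= => /and3P[_ _ lts].
have := gt; rewrite inE /= => /and3P[_ _ ltt].
(* The motion [de] opens the gap of type [s] and closes that of type [t]; its opposite does the
   reverse. So the motion is stopped in both directions. *)
pose de (i : 'I_3) (x : R) : R := if i == s then (q s us < x)%R%:R else
  if i == t then - (q t ut < x)%R%:R else 0.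
have Qmove de' s' u' v' : (s', u', v') \in web_gaps A B phi q ->
    de' s' (q s' v') < de' s' (q s' u') -> exists t r, [/\ 0 < t :> R,
    Q (#|A| - #|B|) (web_poly A B phi r),
    forall i u, u \in web_bdry A B phi i -> r i u = q i u + t * (de' i (q i u) -
      (i == 0)%:R * (\sum_i \sum_(u in web_bdry A B phi i) de' i (q i u))
        / (#|A| - #|B|)%:R) &
    forall i u v, u \in web_bdry A B phi i -> v \in web_bdry A B phi i ->
      q i u <= q i v -> r i u <= r i v].
  move=> g' lt'; have [x [et [x0 w' etE mono]]] := web_move wq n_gt0 len conn g' lt'.
  move=> sm; exists x, (fun s u => q s u + x * et s u); split=> //.
    case: sm => [sh|lt]; first exact: Qshort.
    by apply: IHg => //; apply: leq_trans lt _.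
  by move=> i u ui; rewrite etE.
have [|t1 [q1 [t10 Q1 q1E m1]]] := Qmove de t ut vt gt.
  by rewrite /de (negPf st) !eqxx ltt ltxx oppr0 oppr_lt0.
have [|t2 [q2 [t20 Q2 q2E m2]]] := Qmove (fun i x => - de i x) s us vs gs.
  by rewrite /de !eqxx lts ltxx oppr0 oppr_lt0.
(* On the boundary [q1 = q + t1 * v] and [q2 = q - t2 * v] for a common [v]; weight [t1 / (t1 + t2)]
   on [q2] gives back [q]. *)
apply: (@web_conv A B phi q1 q2 q _ (t1 / (t1 + t2))) => //.
- by rewrite divr_ge0 ?ler_pdivrMr /=; lra.
- move=> i u ui; rewrite q1E // q2E //.
  under [X in _ + _ * (_ + _ * (_ - _ * X / _))]eq_bigr do rewrite sumrN.
  by rewrite sumrN; field; rewrite pnatr_eq0 -lt0n n_gt0 /=; lra.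
- by move=> i u v ui vi le; split; [apply: m1|apply: m2].
Qed.


End WebInduction.

(** * Hives *)

Section TopSums.
Variable R : realDomainType.
Implicit Types l : seq R.

Definition top l m : R := \sum_(x <- take m l) x.

Lemma top0 l : top l 0 = 0.
Proof. by rewrite /top take0 big_nil. Qed.

Lemma top_cons x l m : top (x :: l) m.+1 = x + top l m.
Proof. by rewrite /top /= big_cons. Qed.

Lemma topS l m : (m < size l)%N -> top l m.+1 = top l m + nth 0 l m.
Proof.
by move=> ml; rewrite /top (take_nth 0) // -cats1 big_cat big_seq1.
Qed.

Lemma top_shift x l m : sorted >=%O (x :: l) -> (m <= size l)%N ->
  top l m <= top (x :: l) m.
Proof.
elim: l x m => [|y l IH] x [|m]; rewrite ?top0 // => /= /andP[yx yl] ml.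
by rewrite !top_cons; apply: lerD => //; exact: IH.
Qed.

(** With [top_merge_eq], it says that the partial sums of a merge are the sup-convolution of the
    partial sums: the boundary case of the sup-convolution of hives. *)
Lemma top_merge_ge l1 l2 m1 m2 : sorted >=%O l1 -> sorted >=%O l2 ->
  (m1 <= size l1)%N -> (m2 <= size l2)%N ->
  top l1 m1 + top l2 m2 <= top (merge >=%O l1 l2) (m1 + m2).
Proof.
elim: l1 l2 m1 m2 => [|x l1 IH1] l2 m1 m2.
  by case: m1 => // _ _ _ _; rewrite top0 add0r; case: l2.
elim: l2 m1 m2 => [|y l2 IH2] m1 m2.
  by case: m2 => // _ _ _ _; rewrite top0 addr0 addn0.
move=> s1 s2 h1 h2.
have s1' : sorted >=%O l1 by move: s1 => /= /path_sorted.
have s2' : sorted >=%O l2 by move: s2 => /= /path_sorted.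
rewrite [merge _ _ _]/=; case: ifP => xy.
  case: m1 h1 => [_|m1 h1]; last first.
    rewrite addSn !top_cons -addrA lerD2l; exact: IH1.
  case: m2 h2 => [_|m2 h2]; first by rewrite !top0 addr0.
  rewrite add0n top0 add0r !top_cons; apply: lerD; first exact: xy.
  apply: le_trans (top_shift s2 h2) _.
  have := @IH1 (y :: l2) 0%N m2 s1' s2 (leq0n _).
  by rewrite top0 add0r; apply; apply: leqW.
have yx : x <= y by case/orP: (le_total x y) => //; rewrite />=%O xy.
case: m2 h2 => [_|m2 h2]; last first.
  rewrite addnS !top_cons addrCA lerD2l; exact: IH2.
case: m1 h1 => [_|m1 h1]; first by rewrite !top0 addr0.
rewrite addn0 top0 addr0 !top_cons; apply: lerD; first exact: yx.
apply: le_trans (top_shift s1 h1) _.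
have := @IH2 m1 0%N s1 s2'.
by rewrite top0 addr0 addn0; apply => //; apply: leqW.
Qed.

Lemma top_merge_eq l1 l2 m : (m <= size l1 + size l2)%N ->
  exists m1 m2, [/\ m = (m1 + m2)%N, (m1 <= size l1)%N, (m2 <= size l2)%N &
    top (merge >=%O l1 l2) m = top l1 m1 + top l2 m2].
Proof.
elim: l1 l2 m => [|x l1 IH1] l2 m.
  by move=> ml; exists 0%N, m; rewrite top0 add0r; case: l2 ml.
elim: l2 m => [|y l2 IH2] m.
  by rewrite addn0 => ml; exists m, 0%N; rewrite top0 addr0 addn0.
case: m => [_|m ml]; first by exists 0%N, 0%N; rewrite !top0 addr0.
rewrite [merge _ _ _]/=; case: ifP => xy.
  have [|m1 [m2 [e h1 h2 E]]] := IH1 (y :: l2) m; first by move: ml => /=; lia.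
  by exists m1.+1, m2; rewrite !top_cons E addrA e.
have [|m1 [m2 [e h1 h2 E]]] := IH2 m; first by move: ml => /=; lia.
exists m1, m2.+1; split=> //; first by rewrite e addnS.
by rewrite top_cons [top (y :: l2) _]top_cons addrCA -E.
Qed.

End TopSums.

Section Hive.
Variable R : realFieldType.
Implicit Types h : nat -> nat -> nat -> R.

Definition rot3 h : nat -> nat -> nat -> R := fun i j k => h k i j.

(** Concavity across the edge shared by two unit triangles: the acute corners of the rhombus are on
    the left, the obtuse ones on the right. The other two orientations come from rotating the
    arguments. *)
Definition rhombus n h := forall i j k, (i + j + k + 2)%N = n ->
  h i.+2 j k + h i j.+1 k.+1 <= h i.+1 j.+1 k + h i.+1 j k.+1.

Definition hive n h := forall s : 'I_3, rhombus n (iter s rot3 h).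

Lemma hiveE n h : hive n h <->
  [/\ rhombus n h, rhombus n (rot3 h) & rhombus n (rot3 (rot3 h))].
Proof.
split=> [H|[h0 h1 h2] [[|[|[|//]]] ?]] //.
by split; [exact: (H ord0) | exact: (H (@Ordinal 3 1 isT))
          | exact: (H (@Ordinal 3 2 isT))].
Qed.

Lemma hive_rot n h : hive n h -> hive n (rot3 h).
Proof. by case/hiveE => h0 h1 h2; apply/hiveE. Qed.

Definition swap3 h : nat -> nat -> nat -> R := fun i j k => h i k j.

Lemma hive_swap n h : hive n h -> hive n (swap3 h).
Proof.
case/hiveE => h0 h1 h2; apply/hiveE; split=> i j k e.
- have := h0 i k j ltac:(lia); rewrite /swap3 /=; lra.
- have := h2 i k j ltac:(lia); rewrite /rot3 /swap3 /=; lra.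
- have := h1 i k j ltac:(lia); rewrite /rot3 /swap3 /=; lra.
Qed.

(** Concavity in the large: each unit displacement of the edge along which the slope is measured
    costs one or two rhombus inequalities. *)
Lemma hive_slope n h i j k i' j' k' : hive n h ->
  (i + j + k + 1)%N = n -> (i' + j' + k' + 1)%N = n -> (i' <= i)%N -> (j <= j')%N ->
  h i.+1 j k + h i' j'.+1 k' <= h i j.+1 k + h i'.+1 j' k'.
Proof.
case/hiveE => r1 r2 _.
have [m] := ubnP ((i - i') + (j' - j))%N.
elim: m i' j' k' => [//|m IH] i' j' k' hm e e' ii jj.
have [ni|ni] := leqP i i'; have [nj|nj] := leqP j' j.
- have -> : i' = i by lia.
  have -> : j' = j by lia.
  have -> : k' = k by lia.
  by rewrite addrC.
- case: j' => [|j'] in hm e' jj nj *; first by lia.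
  have := IH i' j' k'.+1 ltac:(lia) e ltac:(lia) ltac:(lia) ltac:(lia).
  have := r2 j' k' i' ltac:(lia); rewrite /rot3; lra.
- case: k' => [|k'] in hm e' *; first by lia.
  have := IH i'.+1 j' k' ltac:(lia) e ltac:(lia) ltac:(lia) ltac:(lia).
  have := r1 i' j' k' ltac:(lia); lra.
- case: j' => [|j'] in hm e' jj nj *; first by lia.
  have := IH i'.+1 j' k' ltac:(lia) e ltac:(lia) ltac:(lia) ltac:(lia).
  have := r1 i' j' k' ltac:(lia).
  have := r2 j' k' i' ltac:(lia); rewrite /rot3; lra.
Qed.

Definition supconv n1 n2 h1 h2 h :=
  (forall i1 j1 k1 i2 j2 k2, (i1 + j1 + k1)%N = n1 -> (i2 + j2 + k2)%N = n2 ->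
     h1 i1 j1 k1 + h2 i2 j2 k2 <= h (i1 + i2)%N (j1 + j2)%N (k1 + k2)%N) /\
  (forall i j k, (i + j + k)%N = (n1 + n2)%N -> exists i1 j1 k1 i2 j2 k2,
     [/\ (i1 + j1 + k1)%N = n1, (i2 + j2 + k2)%N = n2, i = (i1 + i2)%N &
       [/\ j = (j1 + j2)%N, k = (k1 + k2)%N & h i j k = h1 i1 j1 k1 + h2 i2 j2 k2]]).

Lemma supconv_rot n1 n2 h1 h2 h : supconv n1 n2 h1 h2 h ->
  supconv n1 n2 (rot3 h1) (rot3 h2) (rot3 h).
Proof.
case=> ub at_; split=> [i1 j1 k1 i2 j2 k2 e1 e2|i j k e].
  by apply: ub; lia.
have [k1 [i1 [j1 [k2 [i2 [j2 [e1 e2 -> [-> -> E]]]]]]]] := at_ k i j ltac:(lia).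
by exists i1, j1, k1, i2, j2, k2; split=> //; lia.
Qed.

Lemma supconv_sym n1 n2 h1 h2 h : supconv n1 n2 h1 h2 h -> supconv n2 n1 h2 h1 h.
Proof.
case=> ub at_; split=> [i1 j1 k1 i2 j2 k2 e1 e2|i j k e].
  by rewrite addrC (addnC i1) (addnC j1) (addnC k1); apply: ub.
have [i1 [j1 [k1 [i2 [j2 [k2 [e1 e2 -> [-> -> E]]]]]]]] := at_ i j k ltac:(lia).
by exists i2, j2, k2, i1, j1, k1; rewrite E addrC; split; try lia; split=> //; lia.
Qed.

Lemma supconv_exists n1 n2 h1 h2 : exists h, supconv n1 n2 h1 h2 h.
Proof.
have /choice[h hP] : forall x : nat * nat * nat, exists v,
  (x.1.1 + x.1.2 + x.2)%N = (n1 + n2)%N ->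
  (forall i1 j1 k1 i2 j2 k2, (i1 + j1 + k1)%N = n1 -> (i2 + j2 + k2)%N = n2 ->
    x = (i1 + i2, j1 + j2, k1 + k2)%N -> h1 i1 j1 k1 + h2 i2 j2 k2 <= v) /\
  exists i1 j1 k1 i2 j2 k2, [/\ (i1 + j1 + k1)%N = n1, (i2 + j2 + k2)%N = n2,
    x = (i1 + i2, j1 + j2, k1 + k2)%N & v = h1 i1 j1 k1 + h2 i2 j2 k2].
  move=> [[i j] k] /=.
  have [e|ne] := eqVneq (i + j + k)%N (n1 + n2)%N; last by exists 0 => e; rewrite e eqxx in ne.
  pose P (x : 'I_n1.+1 * 'I_n1.+1) := [&& (x.1 + x.2 <= n1)%N, (x.1 <= i)%N,
    (x.2 <= j)%N & (n1 - x.1 - x.2 <= k)%N].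
  pose v (x : 'I_n1.+1 * 'I_n1.+1) := h1 x.1 x.2 (n1 - x.1 - x.2)%N +
    h2 (i - x.1)%N (j - x.2)%N (k - (n1 - x.1 - x.2))%N.
  have b1 : (minn i n1 < n1.+1)%N by lia.
  have b2 : (minn j (n1 - minn i n1) < n1.+1)%N by lia.
  have P0 : P (Ordinal b1, Ordinal b2) by rewrite /P /=; lia.
  have [[a b] Pab vmax] := @arg_maxP _ _ _ _ P v P0.
  exists (v (a, b)) => _; split.
    move=> i1 j1 k1 i2 j2 k2 e1 e2 [ei ej ek].
    have c1 : (i1 < n1.+1)%N by lia.
    have c2 : (j1 < n1.+1)%N by lia.
    have := vmax (Ordinal c1, Ordinal c2); rewrite /P /v /= => /(_ ltac:(lia)).
    have -> : (n1 - i1 - j1)%N = k1 by lia.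
    have -> : (i - i1)%N = i2 by lia.
    have -> : (j - j1)%N = j2 by lia.
    by have -> : (k - k1)%N = k2 by lia.
  move: Pab; rewrite /P /= => Pab.
  exists a, b, (n1 - a - b)%N, (i - a)%N, (j - b)%N, (k - (n1 - a - b))%N.
  by split; rewrite ?lia //; try lia; congr (_, _, _); lia.
exists (fun i j k => h (i, j, k)); split.
  move=> i1 j1 k1 i2 j2 k2 e1 e2.
  have [|ub _] := hP (i1 + i2, j1 + j2, k1 + k2)%N; first by rewrite /=; lia.
  exact: ub.
move=> i j k e; have [//|_ [i1 [j1 [k1 [i2 [j2 [k2 [e1 e2 [-> -> ->] E]]]]]]]] :=
  hP (i, j, k).
by exists i1, j1, k1, i2, j2, k2.
Qed.

(** Exchange argument. Take optimal decompositions at the two acute corners. In one summand the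
    first index is larger at the first corner; there one unit is moved out of the first index in one
    decomposition and into it in the other. By [hive_slope] the sum does not decrease, and the
    results decompose the obtuse corners. *)
Lemma supconv_rhombus n1 n2 h1 h2 h : hive n1 h1 -> hive n2 h2 ->
  supconv n1 n2 h1 h2 h -> rhombus (n1 + n2) h.
Proof.
move=> H1 H2 sc i j k e; have [_ at_] := sc.
have [i1 [j1 [k1 [i2 [j2 [k2 [e1 e2 ei [ej ek ->]]]]]]]] := at_ i.+2 j k ltac:(lia).
have [x1 [y1 [z1 [x2 [y2 [z2 [f1 f2 fi [fj fk ->]]]]]]]] := at_ i j.+1 k.+1 ltac:(lia).
wlog lt1 : n1 n2 h1 h2 H1 H2 sc e at_ i1 j1 k1 i2 j2 k2 e1 e2 ei ej ek
    x1 y1 z1 x2 y2 z2 f1 f2 fi fj fk / (x1 < i1)%N.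
  move=> wl; have [lt1|ge1] := ltnP x1 i1.
    exact: (wl n1 n2 h1 h2 H1 H2 sc e at_ i1 j1 k1 i2 j2 k2 e1 e2 ei ej ek
      x1 y1 z1 x2 y2 z2 f1 f2 fi fj fk lt1).
  have sc' := supconv_sym sc.
  have := wl n2 n1 h2 h1 H2 H1 sc' ltac:(lia) (proj2 sc') i2 j2 k2 i1 j1 k1 e2 e1
    ltac:(lia) ltac:(lia) ltac:(lia) x2 y2 z2 x1 y1 z1 f2 f1
    ltac:(lia) ltac:(lia) ltac:(lia) ltac:(lia).
  lra.
have [ub _] := sc.
case: i1 => [//|i1] in e1 ei lt1 *.
(* Both triples in the first summand sum to [n1], so [x1 < i1] forces [j1 < y1] or [k1 < z1]; the
   second case is the mirror image. *)
have [lt|ge] := ltnP j1 y1.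
  case: y1 => [//|y1] in f1 fj lt *.
  have := hive_slope H1 (i := i1) (j := j1) (k := k1) (i' := x1) (j' := y1) (k' := z1)
    ltac:(lia) ltac:(lia) ltac:(lia) ltac:(lia).
  have := ub i1 j1.+1 k1 i2 j2 k2 ltac:(lia) ltac:(lia).
  have := ub x1.+1 y1 z1 x2 y2 z2 ltac:(lia) ltac:(lia).
  have -> : (i1 + i2 = i.+1)%N by lia.
  have -> : (j1.+1 + j2 = j.+1)%N by lia.
  have -> : (k1 + k2 = k)%N by lia.
  have -> : (x1.+1 + x2 = i.+1)%N by lia.
  have -> : (y1 + y2 = j)%N by lia.
  have -> : (z1 + z2 = k.+1)%N by lia.
  lra.
have lt : (k1 < z1)%N by lia.
case: z1 => [//|z1] in f1 fk lt *.
have := hive_slope (hive_swap H1) (i := i1) (j := k1) (k := j1) (i' := x1) (j' := z1) (k' := y1)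
  ltac:(lia) ltac:(lia) ltac:(lia) ltac:(lia); rewrite /swap3.
have := ub i1 j1 k1.+1 i2 j2 k2 ltac:(lia) ltac:(lia).
have := ub x1.+1 y1 z1 x2 y2 z2 ltac:(lia) ltac:(lia).
have -> : (i1 + i2 = i.+1)%N by lia.
have -> : (j1 + j2 = j)%N by lia.
have -> : (k1.+1 + k2 = k.+1)%N by lia.
have -> : (x1.+1 + x2 = i.+1)%N by lia.
have -> : (y1 + y2 = j.+1)%N by lia.
have -> : (z1 + z2 = k)%N by lia.
lra.
Qed.

Lemma supconv_hive n1 n2 h1 h2 h : hive n1 h1 -> hive n2 h2 ->
  supconv n1 n2 h1 h2 h -> hive (n1 + n2) h.
Proof.
move=> H1 H2 sc; have r1 := hive_rot H1; have r2 := hive_rot H2.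
have sc' := supconv_rot sc; apply/hiveE; split.
- exact: supconv_rhombus H1 H2 sc.
- exact: supconv_rhombus r1 r2 sc'.
- exact: supconv_rhombus (hive_rot r1) (hive_rot r2) (supconv_rot sc').
Qed.

Definition hive_bdry n h (b : seq R) := forall m, (m <= n)%N ->
  h 0%N (n - m)%N m = h 0%N n 0%N + top b m.

Definition hiveable n (b : 'I_3 -> seq R) := exists2 h, hive n h &
  forall s, [/\ size (b s) = n, sorted >=%O (b s) & hive_bdry n (iter s rot3 h) (b s)].

Lemma supconv_bdry n1 n2 h1 h2 h b1 b2 : supconv n1 n2 h1 h2 h ->
  size b1 = n1 -> size b2 = n2 -> sorted >=%O b1 -> sorted >=%O b2 ->
  hive_bdry n1 h1 b1 -> hive_bdry n2 h2 b2 ->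
  hive_bdry (n1 + n2) h (merge >=%O b1 b2).
Proof.
move=> [ub at_] sz1 sz2 s1 s2 B1 B2.
have upper m1 m2 : (m1 <= n1)%N -> (m2 <= n2)%N ->
    h1 0%N n1 0%N + h2 0%N n2 0%N + top b1 m1 + top b2 m2 <=
    h 0%N (n1 + n2 - (m1 + m2))%N (m1 + m2)%N.
  move=> l1 l2; have := ub 0%N (n1 - m1)%N m1 0%N (n2 - m2)%N m2 ltac:(lia) ltac:(lia).
  rewrite B1 // B2 // add0n.
  have -> : (n1 - m1 + (n2 - m2) = n1 + n2 - (m1 + m2))%N by lia.
  lra.
have lower m : (m <= n1 + n2)%N -> exists m1 m2, [/\ m = (m1 + m2)%N, (m1 <= n1)%N,
    (m2 <= n2)%N & h 0%N (n1 + n2 - m)%N m =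
     h1 0%N n1 0%N + h2 0%N n2 0%N + top b1 m1 + top b2 m2].
  move=> lm; have [i1 [j1 [k1 [i2 [j2 [k2 [e1 e2 ei [ej ek ->]]]]]]]] :=
    at_ 0%N (n1 + n2 - m)%N m ltac:(lia).
  exists k1, k2; split; try lia.
  have -> : i1 = 0%N by lia.
  have -> : i2 = 0%N by lia.
  have -> : j1 = (n1 - k1)%N by lia.
  have -> : j2 = (n2 - k2)%N by lia.
  by rewrite B1 ?B2; [ring|lia|lia].
have h0 : h 0%N (n1 + n2)%N 0%N = h1 0%N n1 0%N + h2 0%N n2 0%N.
  have [m1 [m2 [e l1 l2]]] := lower 0%N (leq0n _); rewrite subn0 => ->.
  have -> : m1 = 0%N by lia.
  have -> : m2 = 0%N by lia.
  by rewrite !top0 !addr0.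
move=> m lm; rewrite h0; apply/eqP; rewrite eq_le; apply/andP; split.
  have [m1 [m2 [e l1 l2 ->]]] := lower m lm.
  rewrite -addrA lerD2l e; apply: top_merge_ge; rewrite ?sz1 ?sz2 //.
have [|m1 [m2 [e l1 l2 ->]]] := @top_merge_eq _ b1 b2 m; first by rewrite sz1 sz2.
by rewrite addrA e; apply: upper; [rewrite -sz1|rewrite -sz2].
Qed.

Lemma hiveable_sum n1 n2 b1 b2 b : hiveable n1 b1 -> hiveable n2 b2 ->
  (forall s, sorted >=%O (b s) /\ perm_eq (b s) (b1 s ++ b2 s)) -> hiveable (n1 + n2) b.
Proof.
move=> [h1 H1 B1] [h2 H2 B2] bP.
have [h sc] := supconv_exists n1 n2 h1 h2.
have bE s : b s = merge >=%O (b1 s) (b2 s).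
  have [sb pb] := bP s; have [_ s1 _] := B1 s; have [_ s2 _] := B2 s.
  apply: (@sorted_eq _ >=%O) => //.
  - by move=> x y z yx zy; apply: le_trans zy yx.
  - by move=> x y /andP[xy yx]; apply/le_anti/andP; split.
  - by apply: merge_sorted => // x y; apply: le_total.
  - by rewrite (perm_trans pb) // perm_sym perm_merge.
exists h; first exact: supconv_hive H1 H2 sc.
move=> s; have [sz1 s1 B1s] := B1 s; have [sz2 s2 B2s] := B2 s.
have [sb pb] := bP s; split=> //.
  by rewrite (perm_size pb) size_cat sz1 sz2.
rewrite bE; apply: supconv_bdry B1s B2s => //.
by case: (s) => [[|[|[|//]]] ?] //=;
  [exact: supconv_rot|exact: supconv_rot (supconv_rot sc)].
Qed.

Lemma hiveable_conv n b0 b1 b th : hiveable n b0 -> hiveable n b1 -> 0 <= th <= 1 ->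
  (forall s, [/\ size (b s) = n, sorted >=%O (b s) & forall m, (m < n)%N ->
     nth 0 (b s) m = (1 - th) * nth 0 (b0 s) m + th * nth 0 (b1 s) m]) ->
  hiveable n b.
Proof.
move=> [h0 H0 B0] [h1 H1 B1] /andP[th0 th1] bP.
exists (fun i j k => (1 - th) * h0 i j k + th * h1 i j k).
  have rh g0 g1 : rhombus n g0 -> rhombus n g1 ->
      rhombus n (fun i j k => (1 - th) * g0 i j k + th * g1 i j k).
    move=> r0 r1 i j k e; move: (r0 i j k e) (r1 i j k e) => {r0 r1}.
    set a := _ + _; set b' := _ + _; set c := _ + _; set d := _ + _ => ab cd.
    have : (1 - th) * a + th * c <= (1 - th) * b' + th * d.
      by apply: lerD; apply: ler_wpM2l; lra.
    rewrite /a /b' /c /d; lra.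
  case/hiveE: H0 => *; case/hiveE: H1 => *; apply/hiveE.
  by split; apply: rh.
move=> s; have [sz sb bE] := bP s; split=> // m.
have [sz0 _ B0s] := B0 s; have [sz1 _ B1s] := B1 s.
have itE i j k : iter s rot3 (fun i j k => (1 - th) * h0 i j k + th * h1 i j k) i j k =
    (1 - th) * iter s rot3 h0 i j k + th * iter s rot3 h1 i j k.
  by case: (s) => [[|[|[|//]]] ?].
move=> mn; rewrite !itE B0s // B1s //.
have -> : top (b s) m = (1 - th) * top (b0 s) m + th * top (b1 s) m; last by ring.
elim: m mn => [|m IH] mn; first by rewrite !top0 !mulr0 addr0.
rewrite !topS ?sz ?sz0 ?sz1 // IH ?bE //; [ring|exact: ltnW].
Qed.

Lemma hiveable_scalar n (a : 'I_3 -> R) : \sum_s a s = 0 ->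
  hiveable n (fun s => nseq n (a s)).
Proof.
rewrite !big_ord_recl big_ord0 addr0 /= => e.
(* The linear function [j * y + k * z] has slopes [z - y], [- z] and [y] on the three sides, and
   turns the rhombus inequalities into equalities. *)
pose y := a (lift ord0 (lift ord0 ord0)); pose z := - a (lift ord0 ord0).
have topE x m : (m <= n)%N -> top (nseq n x) m = m%:R * x :> R.
  move=> mn; rewrite /top take_nseq // big_nseq.
  by elim: m {mn} => [|m IH]; rewrite ?mul0r //= IH -natr1; ring.
exists (fun i j k => j%:R * y + k%:R * z).
  by apply/hiveE; split=> i j k _; rewrite /rot3 -!natr1; lra.
move=> s; split; first by rewrite size_nseq.
  by elim: n {topE} => //= -[|n] //= ->; rewrite lexx.
move=> m mn; rewrite topE //.
case: s => [[|[|[|//]]] H] /=; rewrite /rot3 ?natrB //.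
- have -> : a (Ordinal H) = a ord0 by congr a; apply: val_inj.
  have -> : a ord0 = z - y by rewrite /y /z; lra.
  ring.
- have -> : a (Ordinal H) = - z by rewrite /z opprK; congr a; apply: val_inj.
  ring.
- have -> : a (Ordinal H) = y by congr a; apply: val_inj.
  ring.
Qed.

End Hive.

(** * Chains of subspaces *)

Section Chains.
Variables (F : fieldType) (R : realFieldType) (m : nat).
Implicit Types (w : 'I_3 -> nat -> R).

Definition chain n (E : 'I_3 -> nat -> 'M[F]_n) := forall s,
  [/\ E s 0%N = 0, forall i, (E s i <= E s i.+1)%MS & row_full (E s m)].

Definition rk n p (E : 'I_3 -> nat -> 'M[F]_n) (V : 'M[F]_(p, n)) s i : R :=
  (\rank (V :&: E s i)%MS)%:R.

(** The parabolic degree of [V]: each weight is counted with the dimension of its graded piece in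
    the filtration induced on [V]. *)
Definition wdeg n p w (E : 'I_3 -> nat -> 'M[F]_n) (V : 'M[F]_(p, n)) : R :=
  \sum_s \sum_(i < m) w s i * (rk E V s i.+1 - rk E V s i).

(* King's condition for the triple of weighted filtrations E of total degree 0. *)
Definition semistable n w (E : 'I_3 -> nat -> 'M[F]_n) :=
  (forall V : 'M[F]_n, wdeg w E V <= 0) /\ wdeg w E (1%:M : 'M[F]_n) = 0.

Definition jumps n (E : 'I_3 -> nat -> 'M[F]_n) s : seq nat :=
  flatten [seq nseq (\rank (E s i.+1) - \rank (E s i))%N i | i <- iota 0 m].

Definition spectrum n w (E : 'I_3 -> nat -> 'M[F]_n) s : seq R :=
  [seq w s i | i <- jumps E s].

Lemma rk_eqmx n p p' (E : 'I_3 -> nat -> 'M[F]_n) (V : 'M[F]_(p, n))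
  (V' : 'M[F]_(p', n)) s i : (V :=: V')%MS -> rk E V s i = rk E V' s i.
Proof. by move=> e; rewrite /rk (cap_eqmx e (eqmx_refl _)). Qed.

Lemma wdeg_eqmx n p p' w (E : 'I_3 -> nat -> 'M[F]_n) (V : 'M[F]_(p, n))
  (V' : 'M[F]_(p', n)) : (V :=: V')%MS -> wdeg w E V = wdeg w E V'.
Proof.
move=> e; apply: eq_bigr => s _; apply: eq_bigr => i _.
by rewrite !(rk_eqmx _ _ _ e).
Qed.

Lemma semistable_le n p w (E : 'I_3 -> nat -> 'M[F]_n) (V : 'M[F]_(p, n)) :
  semistable w E -> wdeg w E V <= 0.
Proof. by case=> + _ => /(_ <<V>>%MS); rewrite (wdeg_eqmx _ _ (genmxE V)). Qed.

Lemma chain_le n (E : 'I_3 -> nat -> 'M[F]_n) s i j : chain E -> (i <= j)%N ->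
  (E s i <= E s j)%MS.
Proof.
move=> cE; elim: j => [|j IH]; first by rewrite leqn0 => /eqP ->.
rewrite leq_eqVlt => /predU1P[->//|]; rewrite ltnS => /IH h.
by apply: submx_trans h _; case: (cE s) => _ /(_ j).
Qed.

Lemma rk0 n p (E : 'I_3 -> nat -> 'M[F]_n) (V : 'M[F]_(p, n)) s : chain E ->
  rk E V s 0 = 0.
Proof. by move=> /(_ s)[e _ _]; rewrite /rk e capmx0 mxrank0. Qed.

Lemma rkm n p (E : 'I_3 -> nat -> 'M[F]_n) (V : 'M[F]_(p, n)) s : chain E ->
  rk E V s m = (\rank V)%:R.
Proof.
move=> /(_ s)[_ _ e]; rewrite /rk; congr (_%:R); apply: eqmx_rank.
by apply/eqmxP/capmx_idPl/submx_full.
Qed.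

Lemma rk1 n (E : 'I_3 -> nat -> 'M[F]_n) s i :
  rk E (1%:M : 'M[F]_n) s i = (\rank (E s i))%:R.
Proof.
by rewrite /rk cap1mx.
Qed.

Lemma rank_chain n (E : 'I_3 -> nat -> 'M[F]_n) s i j : chain E ->
  (i <= j)%N -> (\rank (E s i) <= \rank (E s j))%N.
Proof. by move=> cE ij; rewrite mxrankS // chain_le. Qed.

Lemma sum_jumps n (E : 'I_3 -> nat -> 'M[F]_n) s (f : nat -> R) : chain E ->
  \sum_(i <- jumps E s) f i =
  \sum_(i < m) f i * (rk E (1%:M : 'M[F]_n) s i.+1 - rk E (1%:M : 'M[F]_n) s i).
Proof.
move=> cE; rewrite big_flatten big_map /= -[in LHS](subn0 m) big_mkord.
apply: eq_bigr => i _.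
by rewrite big_nseq iter_addr_0 !rk1 -natrB ?rank_chain // mulr_natr.
Qed.

Lemma wdeg1 n w (E : 'I_3 -> nat -> 'M[F]_n) : chain E ->
  wdeg w E (1%:M : 'M[F]_n) = \sum_s \sum_(x <- spectrum w E s) x.
Proof. by move=> cE; apply: eq_bigr => s _; rewrite big_map sum_jumps. Qed.

Lemma size_jumps n (E : 'I_3 -> nat -> 'M[F]_n) s : chain E -> size (jumps E s) = n.
Proof.
move=> cE; have := sum_jumps s (fun=> 1) cE.
rewrite big_const_seq count_predT iter_addr_0.
under eq_bigr do rewrite mul1r.
rewrite -(big_mkord xpredT (fun i => rk E 1%:M s i.+1 - rk E (1%:M : 'M_n) s i)).
rewrite telescope_sumr // rkm // rk0 // subr0 mxrank1 => /eqP.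
by rewrite eqr_nat => /eqP.
Qed.

Lemma mem_jumps n (E : 'I_3 -> nat -> 'M[F]_n) s i : i \in jumps E s ->
  (i < m)%N /\ (\rank (E s i) < \rank (E s i.+1))%N.
Proof.
case/flattenP => l /mapP[j]; rewrite mem_iota add0n => /andP[_ jm] ->.
by rewrite mem_nseq => /andP[h /eqP ->]; split=> //; rewrite -subn_gt0.
Qed.

Lemma sorted_jumps n (E : 'I_3 -> nat -> 'M[F]_n) s : sorted leq (jumps E s).
Proof.
rewrite /jumps; have : sorted leq (iota 0 m) by apply: iota_sorted.
elim: (iota 0 m) => //= i l IH ps.
have [ls] := (path_sorted ps, order_path_min leq_trans ps).
move: IH => /(_ ls) IH /allP li.
rewrite sorted_pairwise; last exact: leq_trans.
rewrite pairwise_cat -!sorted_pairwise ?IH; try exact: leq_trans.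
apply/and3P; split=> //; last first.
  by elim: (_ - _)%N => //= -[|k] //= ->; rewrite leqnn.
apply/allrelP => x y; rewrite mem_nseq => /andP[_ /eqP ->].
by case/flattenP => k /mapP[j jl ->]; rewrite mem_nseq => /andP[_ /eqP ->]; apply: li.
Qed.

Lemma sorted_spectrum n w (E : 'I_3 -> nat -> 'M[F]_n) s :
  (forall i j, (i <= j < m)%N -> w s j <= w s i) -> sorted >=%O (spectrum w E s).
Proof.
move=> wm; rewrite /spectrum sorted_map.
apply: (sub_in_sorted (P := [pred i | (i < m)%N])) (sorted_jumps E s).
  by move=> i j im jm /= ij; apply: wm; rewrite ij.
by apply/allP => i /mem_jumps[].
Qed.

(* Restriction of a chain to the row space of V, and the chain it induces on
   the quotient by V. *)
Definition sub_chain n (E : 'I_3 -> nat -> 'M[F]_n) (V : 'M[F]_n) s i :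
  'M[F]_(\rank V) := kermx (row_base V *m cokermx (E s i)).

Definition quo_mx n (V : 'M[F]_n) : 'M[F]_(n, \rank (cokermx V)) := col_base (cokermx V).

Definition quo_chain n (E : 'I_3 -> nat -> 'M[F]_n) (V : 'M[F]_n) s i :
  'M[F]_(\rank (cokermx V)) := <<E s i *m quo_mx V>>%MS.

Lemma rk_sub n (E : 'I_3 -> nat -> 'M[F]_n) (V : 'M[F]_n) p
  (Z : 'M[F]_(p, \rank V)) s i : rk (sub_chain E V) Z s i = rk E (Z *m row_base V) s i.
Proof.
rewrite /rk; congr (_%:R); rewrite -(mxrankMfree _ (row_base_free V)).
apply: eqmx_rank; apply/eqmxP/eqmxP; apply/andP; split.
  rewrite sub_capmx submxMr ?capmxSl //= submxE -mulmxA -sub_kermx.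
  exact: capmxSr.
have /submxP[D e] : (Z *m row_base V :&: E s i <= Z *m row_base V)%MS by apply: capmxSl.
rewrite e mulmxA submxMr // sub_capmx submxMl /= sub_kermx mulmxA -(mulmxA D) -e.
by rewrite -submxE capmxSr.
Qed.

Lemma sub_chainP n (E : 'I_3 -> nat -> 'M[F]_n) (V : 'M[F]_n) : chain E ->
  chain (sub_chain E V).
Proof.
move=> cE s; have [e0 le full] := cE s; split.
- apply/eqP; rewrite -mxrank_eq0; have := @rk_sub n E V _ 1%:M s 0.
  by rewrite [RHS]rk0 // /rk cap1mx => /eqP; rewrite pnatr_eq0.
- move=> i; rewrite sub_kermx; have /submxP[D De] := le i.
  have /eqP : sub_chain E V s i *m (row_base V *m cokermx (E s i)) = 0 by apply: mulmx_ker.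
  rewrite mulmxA -submxE => h; rewrite mulmxA -submxE.
  exact: submx_trans h (le i).
- rewrite -sub1mx sub_kermx mul1mx -submxE; exact: submx_full.
Qed.

Lemma quo_mxP n (V : 'M[F]_n) : (kermx (quo_mx V) :=: V)%MS.
Proof.
apply/eqmxP/andP; split.
  rewrite submxE -{2}(mulmx_base (cokermx V)) mulmxA mulmx_ker mul0mx //.
rewrite sub_kermx; apply/eqP.
apply: (row_free_inj (row_base_free (cokermx V))).
by rewrite mul0mx -mulmxA mulmx_base mulmx_coker.
Qed.

Definition quo_pre n (V : 'M[F]_n) p (Z : 'M[F]_(p, \rank (cokermx V))) : 'M[F]_n :=
  kermx (quo_mx V *m cokermx Z).

Lemma quo_preP n (V : 'M[F]_n) p (Z : 'M[F]_(p, \rank (cokermx V))) q (X : 'M_(q, n)) :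
  (X <= quo_pre Z)%MS = (X *m quo_mx V <= Z)%MS.
Proof. by rewrite sub_kermx mulmxA submxE. Qed.

(** Rank-nullity for [quo_mx V] on the intersection of [E s i] with the preimage of [Z]; the kernel
    is the intersection of [V] with [E s i]. *)
Lemma rk_quo n (E : 'I_3 -> nat -> 'M[F]_n) (V : 'M[F]_n) p
  (Z : 'M[F]_(p, \rank (cokermx V))) s i :
  rk (quo_chain E V) Z s i = rk E (quo_pre Z) s i - rk E V s i.
Proof.
apply/eqP; rewrite eq_sym subr_eq eq_sym /rk -natrD eqr_nat; apply/eqP.
have Vpre : (V <= quo_pre Z)%MS.
  by rewrite quo_preP -(eqmxMr _ (quo_mxP V)) mulmx_ker sub0mx.
rewrite -[RHS](mxrank_mul_ker _ (quo_mx V)); congr (_ + _)%N; last first.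
  apply: eqmx_rank; apply/eqmxP.
  apply: (eqmx_trans _ (cap_eqmx (eqmx_refl _) (eqmx_sym (quo_mxP V)))).
  apply/eqmxP/andP; split; rewrite !sub_capmx ?capmxSl ?capmxSr ?andbT.
    by rewrite (submx_trans (capmxSl _ _)).
  by rewrite (submx_trans (capmxSl _ _)) // capmxSr.
apply: eqmx_rank; apply/eqmxP.
apply: (eqmx_trans (cap_eqmx (eqmx_refl _) (genmxE _))).
apply/eqmxP/andP; split; last first.
  by rewrite sub_capmx -quo_preP capmxSl /= submxMr // capmxSr.
have /submxP[D e] : (Z :&: E s i *m quo_mx V <= E s i *m quo_mx V)%MS by apply: capmxSr.
rewrite e mulmxA submxMr // sub_capmx submxMl andbT quo_preP -mulmxA -e.
exact: capmxSl.
Qed.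

Lemma quo_chainP n (E : 'I_3 -> nat -> 'M[F]_n) (V : 'M[F]_n) : chain E ->
  chain (quo_chain E V).
Proof.
move=> cE s; have [e0 le full] := cE s; split.
- by rewrite /quo_chain e0 mul0mx genmx0.
- by move=> i; rewrite /quo_chain !genmxE submxMr.
- rewrite -sub1mx genmxE; have /submxP[D e] : (1%:M <= E s m)%MS by rewrite sub1mx.
  rewrite -[X in (X <= _)%MS](mul1mx).
  have : row_full (quo_mx V) by apply: col_base_full.
  rewrite -sub1mx => /submxP[D' ->]; rewrite mulmxA submxMr //.
  by rewrite submx_full.
Qed.

(** Degrees are additive: a subspace of the quotient has the degree of its preimage minus that of
    [V], which is zero. So both induced triples inherit semistability, and the dimensions of graded
    pieces add up. *)
Lemma chain_split n w (E : 'I_3 -> nat -> 'M[F]_n) (V : 'M[F]_n) :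
  chain E -> semistable w E -> (0 < \rank V < n)%N -> wdeg w E V = 0 ->
  exists a b (E1 : 'I_3 -> nat -> 'M[F]_a) (E2 : 'I_3 -> nat -> 'M[F]_b),
  [/\ [/\ (a + b)%N = n, (0 < a)%N & (0 < b)%N], chain E1 /\ chain E2,
      semistable w E1, semistable w E2 &
      forall s, perm_eq (spectrum w E s) (spectrum w E1 s ++ spectrum w E2 s)].
Proof.
move=> cE ss /andP[V0 Vn] dV.
have wsub p (Z : 'M[F]_(p, \rank V)) : wdeg w (sub_chain E V) Z = wdeg w E (Z *m row_base V).
  by apply: eq_bigr => s _; apply: eq_bigr => i _; rewrite !rk_sub.
have wquo p (Z : 'M[F]_(p, \rank (cokermx V))) :
    wdeg w (quo_chain E V) Z = wdeg w E (quo_pre Z).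
  rewrite -[RHS]subr0 -dV -sumrB; apply: eq_bigr => s _; rewrite -sumrB.
  by apply: eq_bigr => i _; rewrite !rk_quo; ring.
exists (\rank V), (\rank (cokermx V)), (sub_chain E V), (quo_chain E V).
have cS := sub_chainP V cE; have cQ := quo_chainP V cE.
have pre1 : (quo_pre (1%:M : 'M_(\rank (cokermx V))) :=: (1%:M : 'M_n))%MS.
  by apply/eqmxP/andP; rewrite submx1 quo_preP submx1.
have sub1 : (1%:M *m row_base V :=: V)%MS.
  by rewrite mul1mx; apply/eqmxP; rewrite !eq_row_base !submx_refl.
split=> //.
- by rewrite mxrank_coker; split; lia.
- split; first by move=> Z; rewrite wsub; apply: semistable_le.
  by rewrite wsub (wdeg_eqmx _ _ sub1).
- split; first by move=> Z; rewrite wquo; apply: semistable_le.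
  by rewrite wquo (wdeg_eqmx _ _ pre1); case: ss.
move=> s; rewrite -map_cat perm_map //.
rewrite /jumps; elim: (iota 0 m) => //= i l IH.
have ke : (\rank (E s i.+1) - \rank (E s i) =
   (\rank (sub_chain E V s i.+1) - \rank (sub_chain E V s i)) +
   (\rank (quo_chain E V s i.+1) - \rank (quo_chain E V s i)))%N.
  have h1 j : (\rank (sub_chain E V s j))%:R = rk E V s j :> R.
    by rewrite -rk1 rk_sub (rk_eqmx _ _ _ sub1).
  have h2 j : (\rank (quo_chain E V s j))%:R = (\rank (E s j))%:R - rk E V s j :> R.
    by rewrite -rk1 rk_quo (rk_eqmx _ _ _ pre1) rk1.
  apply/eqP; rewrite -(eqr_nat R) natrD !natrB ?rank_chain // !h1 !h2.
  by apply/eqP; ring.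
rewrite ke nseqD -!catA; rewrite perm_cat2l perm_sym perm_catCA perm_cat2l.
by rewrite perm_sym.
Qed.

End Chains.

Lemma sum_step (R : pzRingType) m i0 (f : nat -> R) : (i0 < m)%N ->
  \sum_(i < m) (i <= i0)%N%:R * (f i.+1 - f i) = f i0.+1 - f 0%N.
Proof.
move=> i0m; rewrite -(big_mkord xpredT (fun i => (i <= i0)%N%:R * (f i.+1 - f i))).
rewrite (big_cat_nat (n := i0.+1)) //= [X in _ + X]big_nat [X in _ + X]big1 ?addr0; last first.
  by move=> i /andP[h _]; rewrite leqNgt h mul0r.
rewrite -telescope_sumr // !big_nat; apply: eq_bigr => i /andP[_ h].
by rewrite -ltnS h mul1r.
Qed.

Lemma drop_ex (R : realDomainType) (w : nat -> R) i j : (i <= j)%N -> w j < w i ->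
  exists k, (i <= k < j)%N /\ w k.+1 < w k.
Proof.
elim: j => [|j IH]; first by rewrite leqn0 => /eqP ->; rewrite ltxx.
rewrite leq_eqVlt => /predU1P[->|]; first by rewrite ltxx.
rewrite ltnS => ij lt; have [lt'|ge] := ltP (w j) (w i).
  by have [k [kP h]] := IH ij lt'; exists k; split=> //; lia.
by exists j; split; [lia | apply: lt_le_trans lt ge].
Qed.

Lemma noninc_nat (R : realDomainType) (w : nat -> R) m :
  (forall i, (i.+1 < m)%N -> w i.+1 <= w i) ->
  forall i j, (i <= j < m)%N -> w j <= w i.
Proof.
move=> h i j /andP[ij jm]; rewrite leNgt; apply/negP => lt.
have [k [kP]] := @drop_ex _ (fun k => - w k) i j ij ltac:(by rewrite ltrN2).
by rewrite ltrN2 ltNge h //; lia.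
Qed.

(** * Hives from semistable triples of filtrations *)

Section SemistableHive.
Variables (F : fieldType) (R : realFieldType) (m : nat).
Implicit Types (w : 'I_3 -> nat -> R).

(** A drop of weight counts only at a proper nonzero subspace, where it separates two entries of the
    spectrum. *)
Definition weight_gap n w (E : 'I_3 -> nat -> 'M[F]_n) s i :=
  [&& (i.+1 < m)%N, w s i.+1 < w s i & (0 < \rank (E s i.+1) < n)%N].

Lemma weight_const n w (E : 'I_3 -> nat -> 'M[F]_n) s i j : chain m E ->
  (forall i j, (i <= j < m)%N -> w s j <= w s i) -> (i <= j < m)%N ->
  (forall k, (i <= k < j)%N -> ~~ weight_gap w E s k) ->
  (0 < \rank (E s i.+1))%N -> (\rank (E s j) < n)%N -> w s i = w s j.
Proof.
move=> cE wm /andP[ij jm] ng r0 rn; apply/eqP; rewrite eq_le [X in _ && X]wm ?ij //.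
rewrite andbT leNgt; apply/negP => lt; have [k [/andP[ik kj] h]] := drop_ex ij lt.
have := ng k; rewrite ik kj => /(_ isT)/negP; apply; rewrite /weight_gap h /=.
rewrite (leq_trans r0) ?(rank_chain _ cE) //= (leq_ltn_trans _ rn) ?(rank_chain _ cE) //.
by rewrite andbT; lia.
Qed.

Lemma rank_jump n p (E : 'I_3 -> nat -> 'M[F]_n) (V : 'M[F]_(p, n)) s i : chain m E ->
  rk R E V s i.+1 != rk R E V s i -> (\rank (E s i) < \rank (E s i.+1))%N.
Proof.
move=> cE ne; have sE : (E s i <= E s i.+1)%MS by apply: chain_le cE _.
rewrite ltn_neqAle mxrankS // andbT; apply: contra ne => /eqP er.
have e : (E s i.+1 :=: E s i)%MS.
  by apply/eqmxP; rewrite sE andbT -(geq_leqif (mxrank_leqif_sup sE)) er.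
by rewrite /rk (cap_eqmx (eqmx_refl _) e).
Qed.

Lemma sum_const_jumps n p w (E : 'I_3 -> nat -> 'M[F]_n) (V : 'M[F]_(p, n)) s c :
  chain m E -> (forall i, (i < m)%N -> rk R E V s i.+1 != rk R E V s i -> w s i = c) ->
  \sum_(i < m) w s i * (rk R E V s i.+1 - rk R E V s i) = c * (\rank V)%:R.
Proof.
move=> cE h; transitivity (c * \sum_(i < m) (rk R E V s i.+1 - rk R E V s i)).
  rewrite mulr_sumr; apply: eq_bigr => i _.
  have [->|/h ->//] := eqVneq (rk R E V s i.+1) (rk R E V s i).
  by rewrite subrr !mulr0.
rewrite -(big_mkord xpredT (fun i => rk R E V s i.+1 - rk R E V s i)).
by rewrite telescope_sumr // (rkm _ _ _ cE) (rk0 _ _ _ cE) subr0.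
Qed.

(** The counterpart of [web_scalar]. The other two filtrations contribute a constant times the
    dimension; if the whole space has degree zero, the subspace at the only gap, which carries the
    larger weight, has positive degree. *)
Lemma one_gap_unstable n w (E : 'I_3 -> nat -> 'M[F]_n) s i : chain m E ->
  (forall s i j, (i <= j < m)%N -> w s j <= w s i) -> weight_gap w E s i ->
  (forall t j, weight_gap w E t j -> (t, j) = (s, i)) -> ~ semistable m w E.
Proof.
move=> cE wm /and3P[im lt /andP[r0 rn]] uniq [ss w1].
pose V := E s i.+1; set r := \rank V in r0 rn.
have ng t : t != s -> forall k, ~~ weight_gap w E t k.
  by move=> ts k; apply/negP => /uniq[] e _; rewrite e eqxx in ts.
have /choice[j0 j0P] : forall t : 'I_3, exists j, (j < m)%N /\
    (\rank (E t j) < \rank (E t j.+1))%N.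
  move=> t.
  have : size (jumps m E t) = n by exact: (@size_jumps F R m n E t cE).
  case ej : (jumps m E t) => [|j l] sz; first by by have := leq_ltn_trans (ltnW r0) rn; rewrite -[X in (_ < X)%N]sz.
  by exists j; apply: mem_jumps; rewrite ej mem_head.
pose c t := w t (j0 t).
have cP t k : t != s -> (k < m)%N -> (\rank (E t k) < \rank (E t k.+1))%N -> w t k = c t.
  move=> ts km jk; have [h1 h2] := j0P t.
  have b1 := rank_leq_row (E t k.+1); have b2 := rank_leq_row (E t (j0 t).+1).
  have [le|le] := leqP k (j0 t).
    apply: weight_const (cE) (wm t) _ _ _ _; [lia|move=> ? _; exact: ng|lia|lia].
  by apply/esym/(weight_const cE (wm t)); [lia|move=> ? _; exact: ng|lia|lia].
have sumt t p (X : 'M[F]_(p, n)) : t != s ->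
   \sum_(i < m) w t i * (rk R E X t i.+1 - rk R E X t i) = c t * (\rank X)%:R.
  move=> ts; apply: sum_const_jumps => // k km ne; apply: cP => //.
  exact: rank_jump ne.
have lo k : (k <= i)%N -> (\rank (E s k) < \rank (E s k.+1))%N -> w s k = w s i.
  move=> ki jk; apply: weight_const (cE) (wm s) _ _ _ _; try lia.
    by move=> l lP; apply/negP => /uniq[]; lia.
  by apply: leq_ltn_trans rn; apply: rank_chain cE _.
have hi k : (i < k < m)%N -> (\rank (E s k) < \rank (E s k.+1))%N -> w s k = w s i.+1.
  move=> ki jk; have b1 := rank_leq_row (E s k.+1).
  apply/esym/(weight_const (cE) (wm s)); try lia.
    by move=> l lP; apply/negP => /uniq[]; lia.
  by apply: leq_trans r0 _; apply: rank_chain cE _.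
have dV : wdeg m w E V = (w s i + c (s + 1) + c (s + 1 + 1)) * r%:R.
  rewrite /wdeg (sum_I3 _ s) (sumt (s + 1)) ?(sumt (s + 1 + 1)) ?(@sum_const_jumps _ _ _ _ _ _ (w s i)) ?mulrDl //.
  - move=> k km ne; have jk := rank_jump cE ne; apply: lo => //.
    rewrite leqNgt; apply: contra ne => ik; rewrite /rk.
    have full j : (i < j)%N -> (V :&: E s j :=: V)%MS.
      by move=> ij; apply/capmx_idPl/chain_le.
    by rewrite !full // ltnW.
  - by case: (s) => [[|[|[|//]]] ?].
  - by case: (s) => [[|[|[|//]]] ?].
have d1 : wdeg m w E (1%:M : 'M_n) =
    (w s i.+1 + c (s + 1) + c (s + 1 + 1)) * n%:R + (w s i - w s i.+1) * r%:R.
  rewrite /wdeg (sum_I3 _ s) (sumt (s + 1)) ?(sumt (s + 1 + 1)) ?mxrank1; first last.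
  - by case: (s) => [[|[|[|//]]] ?].
  - by case: (s) => [[|[|[|//]]] ?].
  pose w' (t : 'I_3) k := w s i.+1 + (w s i - w s i.+1) * (k <= i)%N%:R.
  have -> : \sum_(k < m) w s k * (rk R E (1%:M : 'M_n) s k.+1 - rk R E (1%:M : 'M_n) s k) =
      \sum_(k < m) w' s k * (rk R E (1%:M : 'M_n) s k.+1 - rk R E (1%:M : 'M_n) s k).
    apply: eq_bigr => k _; have [->|ne] := eqVneq (rk R E (1%:M : 'M_n) s k.+1)
      (rk R E (1%:M : 'M_n) s k); first by rewrite subrr !mulr0.
    have jk := rank_jump cE ne; congr (_ * _); rewrite /w'.
    have [ki|ki] := leqP k i; first by rewrite lo // mulr1 addrC subrK.
    by rewrite hi ?ki ?ltn_ord // mulr0 addr0.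
  rewrite /w'; under eq_bigr do rewrite mulrDl -mulrA.
  rewrite big_split /= -!mulr_sumr sum_step; last by lia.
  rewrite -(big_mkord xpredT (fun k => rk R E (1%:M : 'M_n) s k.+1 - rk R E (1%:M : 'M_n) s k)).
  rewrite telescope_sumr // (rkm _ _ _ cE) (rk0 _ _ _ cE) !rk1 mxrank1 -/r.
  ring.
have := ss V; rewrite dV; move: d1; rewrite w1.
have n0 : (0 : R) < n%:R by rewrite ltr0n; lia.
have r0' : (0 : R) < r%:R by rewrite ltr0n.
have rn' : (r%:R : R) < n%:R by rewrite ltr_nat.
set K := c (s + 1) + c (s + 1 + 1).
rewrite -(addrA (w s i)) -(addrA (w s i.+1)) -/K.
move: (w s i) (w s i.+1) K (n%:R : R) (r%:R : R) lt n0 r0' rn'.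
move=> a b K' N r' ab N0 r0' rN E1 E2.
have E3 : (b + K') * N = - ((a - b) * r') by lra.
have E4 : (a + K') * r' * N = (a - b) * r' * (N - r').
  have -> : (a + K') * r' * N = (a - b) * r' * N + (b + K') * N * r' by ring.
  rewrite E3; ring.
have : 0 < (a + K') * r' * N.
  by rewrite E4 !mulr_gt0 // subr_gt0.
by rewrite pmulr_lgt0 // ltNge E2.
Qed.
Lemma hiveable_ext n (b b' : 'I_3 -> seq R) : (forall s, b s = b' s) ->
  hiveable n b -> hiveable n b'.
Proof. by move=> e [h H B]; exists h => // s; rewrite -e. Qed.

Lemma wdeg_line n p w d t (E : 'I_3 -> nat -> 'M[F]_n) (V : 'M[F]_(p, n)) :
  wdeg m (fun s i => w s i + t * d s i) E V = wdeg m w E V + t * wdeg m d E V.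
Proof.
rewrite mulr_sumr -big_split; apply: eq_bigr => s _ /=.
rewrite mulr_sumr -big_split; apply: eq_bigr => i _ /=; ring.
Qed.

(** Opens the gap [x] and closes the gap [y] at unit speed; the last term, constant on filtration 0,
    keeps the total degree at zero. *)
Definition gap_shift n (E : 'I_3 -> nat -> 'M[F]_n) (x y : 'I_3 * 'I_m) (s : 'I_3) i : R :=
  (s == x.1)%:R * (i <= x.2)%N%:R - (s == y.1)%:R * (i <= y.2)%N%:R -
  (s == 0)%:R * (((\rank (E x.1 x.2.+1))%:R - (\rank (E y.1 y.2.+1))%:R) / n%:R).

Lemma wdeg_gap_shift n (E : 'I_3 -> nat -> 'M[F]_n) x y : (0 < n)%N -> chain m E ->
  wdeg m (gap_shift E x y) E (1%:M : 'M_n) = 0.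
Proof.
move=> n0 cE; have nz : n%:R != 0 :> R by rewrite pnatr_eq0 -lt0n.
set ka : R := ((\rank (E x.1 x.2.+1))%:R - (\rank (E y.1 y.2.+1))%:R) / n%:R.
have part (z : 'I_3 * 'I_m) : \sum_s \sum_(i < m) (s == z.1)%:R * (i <= z.2)%N%:R *
    (rk R E (1%:M : 'M_n) s i.+1 - rk R E (1%:M : 'M_n) s i) = (\rank (E z.1 z.2.+1))%:R.
  rewrite (bigD1 z.1) //= [X in _ + X]big1 ?addr0.
    under eq_bigr do rewrite eqxx mul1r.
    by rewrite sum_step ?ltn_ord // (rk0 _ _ _ cE) subr0 rk1.
  by move=> s /negPf ->; rewrite big1 // => i _; rewrite !mul0r.
transitivity (\sum_s \sum_(i < m) (s == x.1)%:R * (i <= x.2)%N%:R *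
    (rk R E (1%:M : 'M_n) s i.+1 - rk R E (1%:M : 'M_n) s i) -
  \sum_s \sum_(i < m) (s == y.1)%:R * (i <= y.2)%N%:R *
    (rk R E (1%:M : 'M_n) s i.+1 - rk R E (1%:M : 'M_n) s i) - ka * n%:R); last first.
  by rewrite !part /ka divfK // subrr.
have -> : ka * n%:R = \sum_(s : 'I_3) \sum_(i < m) (s == 0)%:R * ka *
    (rk R E (1%:M : 'M_n) s i.+1 - rk R E (1%:M : 'M_n) s i).
  rewrite (bigD1 0) //= [X in _ + X]big1 ?addr0 => [|s /negPf ->]; last first.
    by rewrite big1 // => i _; rewrite !mul0r.
  rewrite -mulr_sumr mul1r; congr (_ * _).
  rewrite -(big_mkord xpredT (fun k => rk R E (1%:M : 'M_n) 0 k.+1 - rk R E (1%:M : 'M_n) 0 k)).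
  by rewrite telescope_sumr // (rkm _ _ _ cE) (rk0 _ _ _ cE) mxrank1 subr0.
rewrite -!sumrB; apply: eq_bigr => s _; rewrite -!sumrB; apply: eq_bigr => i _.
by rewrite /gap_shift -/ka; ring.
Qed.

Definition wgaps n w (E : 'I_3 -> nat -> 'M[F]_n) : {set 'I_3 * 'I_m} :=
  [set x : 'I_3 * 'I_m | weight_gap w E x.1 x.2].

(** There may be infinitely many subspaces to respect, but the degree depends only on ranks of
    intersections, and these form finitely many functions [rkf]. So [first_hit] applies; the motion
    ends when a proper subspace becomes tight or a gap closes. *)
Lemma weight_move n w (E : 'I_3 -> nat -> 'M[F]_n) (x y : 'I_3 * 'I_m) : chain m E ->
  (forall s i j, (i <= j < m)%N -> w s j <= w s i) -> semistable m w E ->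
  (forall V : 'M[F]_n, (0 < \rank V < n)%N -> wdeg m w E V < 0) ->
  x \in wgaps w E -> y \in wgaps w E -> x != y ->
  exists t, let w' := fun s i => w s i + t * gap_shift E x y s i in
  [/\ 0 < t, forall s i j, (i <= j < m)%N -> w' s j <= w' s i, semistable m w' E &
    (exists2 V : 'M[F]_n, (0 < \rank V < n)%N & wdeg m w' E V = 0) \/
    (#|wgaps w' E| < #|wgaps w E|)%N].
Proof.
move=> cE wm [ss w1] st xg yg xy; set d := gap_shift E x y.
have n0 : (0 < n)%N.
  by move: xg; rewrite inE => /and3P[_ _ /andP[_]]; apply: leq_ltn_trans.
have flat s i : (i.+1 < m)%N -> (forall z, z \in wgaps w E -> (s, i) != (z.1, val z.2)) ->
    d s i.+1 = d s i.
  move=> im nz; have h z : z \in wgaps w E ->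
      (s == z.1)%:R * (i.+1 <= z.2)%N%:R = (s == z.1)%:R * (i <= z.2)%N%:R :> R.
    move=> zg; have := nz z zg; rewrite xpair_eqE; case: eqP => //= _ ne; rewrite ?mul0r //.
    by congr (_ * (_ : bool)%:R); move: ne; lia.
  by rewrite /d /gap_shift !h.
pose rkf (V : 'M[F]_n) : {ffun 'I_3 * 'I_m.+1 -> 'I_n.+1} :=
  [ffun z : 'I_3 * 'I_m.+1 => inord (\rank (V :&: E z.1 z.2)%MS)].
pose L (v : 'I_3 -> nat -> R) (k : 'I_3 * 'I_m + {ffun 'I_3 * 'I_m.+1 -> 'I_n.+1}) : R :=
  match k with
  | inl z => v z.1 z.2 - v z.1 z.2.+1
  | inr f => - \sum_s \sum_(i < m) v s i * ((f (s, inord i.+1))%:R - (f (s, inord i))%:R)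
  end.
pose P (k : 'I_3 * 'I_m + {ffun 'I_3 * 'I_m.+1 -> 'I_n.+1}) : bool := match k with
  | inl z => z \in wgaps w E
  | inr f => `[< exists2 V : 'M[F]_n, (0 < \rank V < n)%N & f = rkf V >] end.
have LE v (V : 'M[F]_n) : L v (inr (rkf V)) = - wdeg m v E V.
  rewrite /L /wdeg; congr (- _); apply: eq_bigr => s _; apply: eq_bigr => i _.
  have rkE j : (j <= m)%N -> (rkf V (s, inord j))%:R = rk R E V s j.
    move=> jm; rewrite ffunE /rk /= !inordK //.
    by rewrite ltnS (leq_trans (mxrankS (capmxSl _ _))) // rank_leq_row.
  by rewrite !rkE // ltnW.
have [||t [t0 tP [k Pk tk]]] := @first_hit _ _ P (L w) (L d).
- case=> [z|f] /=; first by rewrite inE => /and3P[_ lt _]; rewrite subr_gt0.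
  by case/asboolP => V Vn ->; rewrite -/(L w (inr _)) LE oppr_gt0 st.
- exists (inl y) => //=; rewrite /d /gap_shift eqxx leqnn ltnn.
  have -> : (y.1 == x.1)%:R * (y.2.+1 <= x.2)%N%:R =
            (y.1 == x.1)%:R * (y.2 <= x.2)%N%:R :> R.
    have [e|] := eqVneq y.1 x.1; last by rewrite !mul0r.
    congr (_ * (_ : bool)%:R); have : y.2 != x.2 :> nat.
      apply: contra xy => /eqP e2; apply/eqP; case: (x) (y) e e2 => [a b] [a' b'] /= -> e2.
      by congr (_, _); apply: val_inj.
    lia.
  move: (_ * (y.2 <= x.2)%N%:R) ((y.1 == 0)%:R * _) => a b /=; lra.
have Lline k' : L (fun s i => w s i + t * d s i) k' = L w k' + t * L d k'.
  case: k' => [z|f] /=; first by ring.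
  rewrite mulrN -opprD; congr (- _).
  rewrite mulr_sumr -big_split; apply: eq_bigr => s _ /=.
  rewrite mulr_sumr -big_split; apply: eq_bigr => i _ /=; ring.
have nogap s i : (i.+1 < m)%N -> ~~ weight_gap w E s i -> d s i.+1 = d s i.
  move=> im ng; apply: flat => // z; rewrite inE => zg.
  by apply: contra ng => /eqP[-> ->].
exists t => w'; split=> //.
- move=> s; apply: noninc_nat => i im.
  have [g|ng] := boolP (weight_gap w E s i).
    have := tP (inl (s, Ordinal (ltnW im))); rewrite -Lline /= inE g subr_ge0.
    exact.
  rewrite /w' -/d nogap // lerD2r; apply: wm; lia.
- split; last by rewrite wdeg_line w1 wdeg_gap_shift // mulr0 addr0.
  move=> V; have [Vn|/nandP Vn] := boolP (0 < \rank V < n)%N.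
    have := tP (inr (rkf V)); rewrite -Lline LE oppr_ge0; apply.
    by apply/asboolP; exists V.
  case: Vn => [|Vn].
    rewrite -leqNgt leqn0 mxrank_eq0 => /eqP ->; rewrite /wdeg big1 // => s _.
    by rewrite big1 // => i _; rewrite /rk !cap0mx !mxrank0 subrr mulr0.
  have e : (V :=: (1%:M : 'M_n))%MS.
    apply/eqmxP; rewrite submx1 sub1mx /row_full eqn_leq rank_leq_row leqNgt.
    exact: Vn.
  by rewrite (wdeg_eqmx _ _ _ e) wdeg_line w1 wdeg_gap_shift // mulr0 addr0.
move: Pk tk; rewrite -Lline; case: k => [z|f] Pk tk; [right|left].
  apply: proper_card; apply/properP; split; last first.
    exists z => //; rewrite inE; apply/negP => /and3P[_ + _].
    by move/subr0_eq: tk => /= tk; rewrite /w' -/d tk ltxx.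
  apply/subsetP => [[s i]]; rewrite !inE /= => g'.
  have [im lt' rg] := and3P g'; apply: contraTT lt' => ng.
  rewrite -leNgt /w' -/d nogap // lerD2r leNgt; apply: contra ng => lt.
  by rewrite /weight_gap im lt.
case/asboolP: Pk => V Vn fV; exists V => //.
by apply/eqP; rewrite -oppr_eq0 -LE -fV tk.
Qed.

(** The scheme of [web_ind], by induction on [n] and then on the number of gaps: a tight subspace
    gives a sup-convolution, no gap a linear hive, and two gaps a motion in both directions. *)
Theorem semistable_hiveable n w (E : 'I_3 -> nat -> 'M[F]_n) : chain m E ->
  (forall s i j, (i <= j < m)%N -> w s j <= w s i) -> semistable m w E ->
  hiveable n (spectrum m w E).
Proof.
have [N leN] := ubnP n; elim: N => [//|N IHN] in n w E leN *.
have [g leg] := ubnP #|wgaps w E|; elim: g => [//|g IHg] in w leg * => cE wm ss.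
have [n0|n0] := posnP n.
  have := @hiveable_scalar R 0 (fun=> 0) ltac:(by rewrite big1) => H.
  rewrite -[X in hiveable X _]n0 in H; apply: hiveable_ext H => s /=.
  apply/esym/size0nil; rewrite size_map (@size_jumps F R m n E s cE) //.
have Htight (v : 'I_3 -> nat -> R) : (forall s i j, (i <= j < m)%N -> v s j <= v s i) -> semistable m v E ->
    (exists2 V : 'M[F]_n, (0 < \rank V < n)%N & wdeg m v E V = 0) ->
    hiveable n (spectrum m v E).
  move=> vm sv [V Vn dV].
  have [a [b [E1 [E2 [[ab a0 b0] [c1 c2] s1 s2 pe]]]]] := chain_split cE sv Vn dV.
  have H1 := IHN a v E1 ltac:(lia) c1 vm s1; have H2 := IHN b v E2 ltac:(lia) c2 vm s2.
  have := hiveable_sum H1 H2 (b := spectrum m v E); rewrite ab; apply=> s.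
  by split; [exact: sorted_spectrum (vm s) | apply: pe].
have [/(Htight w wm ss)//|nt] := EM (exists2 V : 'M[F]_n, (0 < \rank V < n)%N & wdeg m w E V = 0).
have st (V : 'M[F]_n) : (0 < \rank V < n)%N -> wdeg m w E V < 0.
  move=> Vn; rewrite lt_neqAle (semistable_le V ss) andbT; apply/eqP => e.
  by apply: nt; exists V.
have sz s : size (jumps m E s) = n by apply: (@size_jumps F R m n E s cE).
have [x xg|ng] := pickP (mem (wgaps w E)); last first.
  have wc s i j : i \in jumps m E s -> j \in jumps m E s -> (i <= j)%N -> w s i = w s j.
    move=> /mem_jumps[im ir] /mem_jumps[jm jr] ij.
    apply: weight_const (cE) (wm s) _ _ _ _; [lia| |lia|]; last first.
      by apply: leq_trans jr _; apply: rank_leq_row.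
    move=> k kj; apply/negP => gk; have km : (k < m)%N by lia.
    by have := ng (s, Ordinal km); rewrite /= inE gk.
  pose a s := w s (head 0%N (jumps m E s)).
  have sE s : spectrum m w E s = nseq n (a s).
    rewrite -[in RHS](sz s) -(size_map (w s)); apply/all_pred1P/allP => v /mapP[i ij ->] /=.
    have hj : head 0%N (jumps m E s) \in jumps m E s.
      by case: (jumps m E s) ij => // j l _; rewrite mem_head.
    rewrite /a; case: (leqP i (head 0%N (jumps m E s))) => h.
      by rewrite (wc s _ _ ij hj h).
    by rewrite -(wc s _ _ hj ij (ltnW h)).
  apply: (@hiveable_ext n (fun s => nseq n (a s))) => [s|]; first by rewrite sE.
  apply: hiveable_scalar; case: ss => _; rewrite (wdeg1 _ cE).
  under eq_bigr do rewrite sE big_nseq iter_addr_0 -mulr_natl.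
  by rewrite -mulr_sumr => /eqP; rewrite mulf_eq0 pnatr_eq0 eqn0Ngt n0 => /eqP.
have [y /andP[/= yx yg]|uniq] := pickP [pred y | (y != x) && (y \in wgaps w E)]; last first.
  have xg' := xg; rewrite /= inE in xg'.
  case: (one_gap_unstable cE wm xg') => // t j gj.
  have jm : (j < m)%N by case/and3P: gj => jm _ _; apply: ltnW.
  have := uniq (t, Ordinal jm); rewrite /= inE /= gj andbT => /negbFE/eqP <- //.
have Hmove z z' : z \in wgaps w E -> z' \in wgaps w E -> z != z' -> exists2 t, 0 < t &
    hiveable n (spectrum m (fun s i => w s i + t * gap_shift E z z' s i) E).
  move=> zg zg' zz; have [t [t0 wm' ss' ev]] := weight_move cE wm ss st zg zg' zz.
  exists t => //; case: ev => [ev|lt]; first exact: Htight.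
  by apply: IHg => //; apply: leq_trans lt _.
have xy : x != y by rewrite eq_sym.
have [t1 t10 H1] := Hmove x y xg yg xy; have [t2 t20 H2] := Hmove y x yg xg yx.
(* Exchanging [x] and [y] reverses the motion, so [w] is a convex combination of the two stopping
   points. *)
apply: (@hiveable_conv _ n _ _ _ (t1 / (t1 + t2)) H1 H2).
  by rewrite divr_ge0 ?ler_pdivrMr /=; lra.
move=> s; split; [by rewrite size_map sz | exact: sorted_spectrum (wm s) | move=> k kn].
rewrite !(nth_map 0%N) ?sz //.
have -> : gap_shift E y x s (nth 0%N (jumps m E s) k) =
    - gap_shift E x y s (nth 0%N (jumps m E s) k).
  by rewrite /gap_shift; ring.
by field; lra.
Qed.

End SemistableHive.

(** * The web dual to a hive *)

Section HiveWeb.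
Variables (R : realFieldType) (n : nat) (h : nat -> nat -> nat -> R).
Local Notation T := ('I_n.+1 * 'I_n.+1 * 'I_n.+1)%type.

(** The hive has size [n.+1]. Adding 1 to one index gives the corners of an up triangle, adding 1 to
    two indices those of a down triangle; so their index sums are [n] and one less. *)
Definition up_triangles : {set T} := [set u : T | (u.1.1 + u.1.2 + u.2 == n)%N].
Definition down_triangles : {set T} := [set u : T | (u.1.1 + u.1.2 + u.2).+1 == n].

Definition coordinate (s : 'I_3) (u : T) : 'I_n.+1 :=
  match val s with 0%N => u.1.1 | 1%N => u.1.2 | _ => u.2 end.

(** In the dual graph of the triangulation, a down triangle and its image under [step_up s] share
    the side along which [slope s] is the increment of [h]. *)
Definition step_up (s : 'I_3) (u : T) : T :=
  match val s with
  | 0%N => (inord u.1.1.+1, u.1.2, u.2)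
  | 1%N => (u.1.1, inord u.1.2.+1, u.2)
  | _ => (u.1.1, u.1.2, inord u.2.+1)
  end.

Definition slope (s : 'I_3) (u : T) : R :=
  match val s with
  | 0%N => h u.1.1 u.1.2 u.2.+1 - h u.1.1 u.1.2.+1 u.2
  | 1%N => h u.1.1.+1 u.1.2 u.2 - h u.1.1 u.1.2 u.2.+1
  | _ => h u.1.1 u.1.2.+1 u.2 - h u.1.1.+1 u.1.2 u.2
  end.

Lemma I3_ind (P : 'I_3 -> Prop) : P 0 -> P 1 -> P (1 + 1) -> forall s, P s.
Proof.
move=> P0 P1 P2 [[|[|[|//]]] i].
- by rewrite (_ : Ordinal i = 0) //; apply: val_inj.
- by rewrite (_ : Ordinal i = 1) //; apply: val_inj.
- by rewrite (_ : Ordinal i = 1 + 1) //; apply: val_inj.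
Qed.

Lemma sum_I3_012 (F : 'I_3 -> R) : \sum_s F s = F 0 + F 1 + F (1 + 1).
Proof.
rewrite !big_ord_recl big_ord0 addr0 addrA; congr (F _ + F _ + F _); exact: val_inj.
Qed.

Lemma step_up_inj s : {in down_triangles &, injective (step_up s)}.
Proof.
have inc (i j : 'I_n.+1) : (i < n)%N -> (j < n)%N -> inord i.+1 = inord j.+1 :> 'I_n.+1 -> i = j.
  by move=> im jm /(congr1 (@nat_of_ord _)); rewrite !inordK ?ltnS // => -[] /ord_inj.
move: s; apply: I3_ind => -[[i j] k] [[i' j'] k']; rewrite !inE /= => /eqP e /eqP e' [].
- by move=> hi jj kk; rewrite jj kk (inc _ _ _ _ hi) //; lia.
- by move=> ii hi kk; rewrite ii kk (inc _ _ _ _ hi) //; lia.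
- by move=> ii jj hi; rewrite ii jj (inc _ _ _ _ hi) //; lia.
Qed.

Lemma step_up_bdry s u : (u \in web_bdry up_triangles down_triangles step_up s) =
  (u \in up_triangles) && (coordinate s u == 0 :> nat).
Proof.
rewrite /web_bdry in_setD andbC; case: (boolP (u \in up_triangles)) => //= uA.
have Kn (i : 'I_n.+1) : (i != 0 :> nat) -> (inord i.-1 : 'I_n.+1) = i.-1 :> nat.
  by move=> i0; rewrite inordK //; have := ltn_ord i; lia.
have K (i : 'I_n.+1) : (i != 0 :> nat) -> inord (inord i.-1 : 'I_n.+1).+1 = i.
  by move=> i0; apply: ord_inj; have := ltn_ord i; rewrite Kn // prednK ?lt0n // => ?; rewrite inordK.
apply/idP/idP => [|/eqP c0].
  apply: contraNT => c0; move: s u uA c0; apply: I3_ind => -[[i j] k];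
  rewrite !inE /coordinate /= => /eqP e c0; apply/imsetP.
  - by exists (inord i.-1, j, k); rewrite ?inE /= ?Kn /step_up /= ?K //; lia.
  - by exists (i, inord j.-1, k); rewrite ?inE /= ?Kn /step_up /= ?K //; lia.
  - by exists (i, j, inord k.-1); rewrite ?inE /= ?Kn /step_up /= ?K //; lia.
apply/imsetP => -[[[i j] k]]; rewrite inE /= => /eqP e uE; move: c0; rewrite {u uA}uE.
by move: s; apply: I3_ind; rewrite /coordinate /step_up /= inordK; lia.
Qed.

Hypothesis h_hive : hive n.+1 h.

(** Increments around a triangle sum to zero, and the length of a dual edge is the excess in a
    rhombus inequality. *)
Lemma hive_web : web up_triangles down_triangles step_up slope.
Proof.
have [r0 r1 r2] := (hiveE n.+1 h).1 h_hive; split.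
- move=> s; split; first exact: step_up_inj.
  move: s; apply: I3_ind => -[[i j] k]; rewrite !inE /= => /eqP e; rewrite inordK; lia.
- by move=> [[i j] k] _; rewrite sum_I3_012 /slope /=; lra.
- move=> [[i j] k]; rewrite !inE /= => /eqP e; rewrite sum_I3_012 /slope /step_up /=.
  by rewrite !inordK; [lra|lia..].
- apply: I3_ind => -[[i j] k]; rewrite !inE /= => /eqP e; rewrite /slope /step_up /= !inordK; try lia.
  + have := r0 i j k ltac:(lia); lra.
  + have := r1 j k i ltac:(lia); rewrite /rot3; lra.
  + have := r2 k i j ltac:(lia); rewrite /rot3; lra.
Qed.

Variable b : 'I_3 -> seq R.
Hypothesis hb : forall s, size (b s) = n.+1 /\ hive_bdry n.+1 (iter s (@rot3 R) h) (b s).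

Lemma hive_web_poly s : web_poly up_triangles down_triangles step_up slope s =
  \prod_(x <- b s) ('X - x%:P).
Proof.
pose roth (s : 'I_3) : nat -> nat -> nat -> R :=
  match val s with 0%N => h | 1%N => rot3 h | _ => rot3 (rot3 h) end.
have rothE : iter s (@rot3 R) h = roth s by case: (s) => [[|[|[|//]]]].
have nthE m : (m <= n)%N -> nth 0 (b s) m =
    roth s 0%N (n - m)%N m.+1 - roth s 0%N (n - m).+1 m.
  move=> mn; have [sz B] := hb s; rewrite rothE in B.
  have := B m.+1 ltac:(lia); have := B m ltac:(lia); rewrite topS ?sz //.
  by rewrite subSS subSn // => -> ->; lra.
rewrite (big_nth 0) big_mkord (hb s).1 /web_poly.
(* [at_ s m] is the [m]-th up triangle along side [s], in the order in which [b s] lists the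
   increments. *)
pose at_ (s : 'I_3) (m : 'I_n.+1) : T := match val s with
  | 0%N => (ord0, rev_ord m, m) | 1%N => (m, ord0, rev_ord m) | _ => (rev_ord m, m, ord0) end.
rewrite (reindex_onto (at_ s) (coordinate (s - 1))); last first.
  move=> u; rewrite step_up_bdry inE => /andP[/eqP e /eqP]; move: u e.
  clear nthE rothE; move: s; apply: I3_ind => -[[i j] k] /= e c; rewrite /at_ /coordinate /=;
   congr (_, _, _); apply: val_inj => //=; rewrite ?subSS; rewrite /coordinate /= in c; lia.
rewrite [LHS](eq_bigl xpredT); last first.
  move=> m; rewrite step_up_bdry inE; have := ltn_ord m; clear nthE rothE.
  move: s; apply: I3_ind => mn; rewrite /at_ /coordinate /= eqxx ?andbT subSS;
   apply/eqP; lia.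
apply: eq_bigr => m _; rewrite nthE; last by rewrite -ltnS.
clear nthE rothE; congr ('X - _%:P).
by move: s @roth @at_; apply: I3_ind => roth at_; rewrite /slope /at_ /roth /= subSS.
Qed.
End HiveWeb.

From mathcomp Require Import fingroup perm reals complex.
Import Order.TTheory GRing.Theory Num.Theory.

(** * Hermitian triples *)

Section Adjoint.
Variable C : numClosedFieldType.
Local Open Scope sesquilinear_scope.

Lemma adjmxM m n p (A : 'M[C]_(m, n)) (B : 'M[C]_(n, p)) :
  (A *m B)^t* = B^t* *m A^t*.
Proof. by rewrite trmx_mul map_mxM. Qed.

Lemma adjmxD m n (A B : 'M[C]_(m, n)) : (A + B)^t* = A^t* + B^t*.
Proof. by rewrite linearD map_mxD. Qed.

Lemma adjmxN m n (A : 'M[C]_(m, n)) : (- A)^t* = - A^t*.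
Proof. by rewrite linearN map_mxN. Qed.

Lemma adjmx1 n : (1%:M : 'M[C]_n)^t* = 1%:M.
Proof. by rewrite trmx1 map_mx1. Qed.

Lemma hermP n (A : 'M[C]_n) : reflect (A^t* = A) (A \is hermsymmx).
Proof.
apply: (iffP (is_hermitianmxP _ _ _)) => [{2}->|e]; by rewrite expr0 scale1r ?e.
Qed.

Lemma frob_ge0 m n (X : 'M[C]_(m, n)) : 0 <= \tr (X *m X^t*).
Proof.
rewrite /mxtrace sumr_ge0 // => i _; rewrite mxE sumr_ge0 // => j _.
by rewrite !mxE mul_conjC_ge0.
Qed.

Lemma frob_eq0 m n (X : 'M[C]_(m, n)) : \tr (X *m X^t*) = 0 -> X = 0.
Proof.
move=> e; apply/matrixP => i j; rewrite mxE; apply/eqP.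
have pos k : 0 <= (X *m X^t*) k k.
  by rewrite mxE sumr_ge0 // => l _; rewrite !mxE mul_conjC_ge0.
have /eqP := psumr_eq0P (fun k _ => pos k) e (i := i) isT.
rewrite mxE psumr_eq0 => [/allP/(_ j)|l _]; last by rewrite !mxE mul_conjC_ge0.
by rewrite mem_index_enum !mxE mul_conjC_eq0; apply.
Qed.

Lemma char_poly_conj n (P A : 'M[C]_n) : P \in unitmx ->
  char_poly (invmx P *m A *m P) = char_poly A.
Proof.
move=> Pu; rewrite /char_poly.
have -> : char_poly_mx (invmx P *m A *m P) =
    map_mx polyC (invmx P) *m char_poly_mx A *m map_mx polyC P.
  rewrite /char_poly_mx mulmxBr mulmxBl -!map_mxM /=; congr (_ - _).
  by rewrite mul_mx_scalar -scalemxAl -map_mxM mulVmx // map_mx1 scalemx1.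
rewrite !det_mulmx mulrAC -det_mulmx -map_mxM mulVmx // map_mx1 det1 mul1r //.
Qed.

Lemma char_poly_diag n (d : 'rV[C]_n) : char_poly (diag_mx d) = \prod_i ('X - (d 0 i)%:P).
Proof.
rewrite char_poly_trig; last by apply: diag_mx_is_trig.
by apply: eq_bigr => i _; rewrite mxE eqxx mulr1n.
Qed.

Lemma char_poly_block m n (A : 'M[C]_m) (B : 'M[C]_n) :
  char_poly (block_mx A 0 0 B) = char_poly A * char_poly B.
Proof.
rewrite /char_poly -(det_ublock _ 0); congr (\det _).
rewrite /char_poly_mx map_block_mx /= !raddf0 scalar_mx_block opp_block_mx.
by rewrite add_block_mx !oppr0 !addr0.
Qed.

End Adjoint.

Section Herm3.
Variable R : realType.
Local Notation C := R[i].
Local Open Scope sesquilinear_scope.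
Local Open Scope complex_scope.

Definition diagr n (f : nat -> R) : 'M[C]_n := diag_mx (\row_j (f j)%:C).

Lemma diagr_adj n f : (diagr n f)^t* = diagr n f.
Proof.
apply/matrixP => i j; rewrite !mxE eq_sym; case: eqP => [->|_].
  by rewrite !mulr1n; apply: conjc_real.
by rewrite !mulr0n; apply: conjc0.
Qed.

Definition herm3 n (l : 'I_3 -> seq R) := exists A : 'I_3 -> 'M[C]_n,
  [/\ forall s, A s \is hermsymmx, \sum_s A s = 0 &
      forall s, char_poly (A s) = \prod_(x <- l s) ('X - (x%:C)%:P)].

(** The spectral theorem gives the eigenvalues in an uncontrolled order; comparing factorizations of
    the characteristic polynomial yields a permutation matrix that restores the order of [l]. *)
Lemma herm_diagonalize n (A : 'M[C]_n) (l : seq R) : A \is hermsymmx ->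
  char_poly A = \prod_(x <- l) ('X - (x%:C)%:P) ->
  exists2 U : 'M[C]_n, U \is unitarymx & A = U^t* *m diagr n (nth 0 l) *m U.
Proof.
move=> hA cA; have nA := hermitian_normalmx hA.
have AE := nA; move/orthomx_spectralP: AE => AE.
set P := spectralmx A in AE; set d := spectral_diag A in AE.
have Pu : P \is unitarymx := spectral_unitarymx A.
have cd : char_poly A = \prod_i ('X - (d 0 i)%:P).
  by rewrite AE char_poly_conj ?char_poly_diag // spectral_unit.
have sz : size l = n.
  by have := size_char_poly A; rewrite cA size_prod_XsubC => -[].
have pe : perm_eq [seq x%:C | x <- l] [seq d 0 i | i <- enum 'I_n].
  by apply: prod_XsubC_eq; rewrite [LHS]big_map -cA cd [RHS]big_map big_enum.
have [sg sgE] : exists sg : 'S_n, forall i : 'I_n, (nth 0 l i)%:C = d 0 (sg i).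
  have /tuple_permP[sg sgE] : perm_eq [seq x%:C | x <- l] [tuple d 0 i | i < n].
    exact: pe.
  exists sg => i; rewrite -(nth_map 0 0) ?sz // sgE nth_mktuple tnth_mktuple //.
pose S : 'M[C]_n := perm_mx sg; exists (S *m P).
  rewrite mul_unitarymx //; apply/unitarymxP.
  by rewrite /S tr_perm_mx map_perm_mx -perm_mxM mulgV perm_mx1.
have comm : diagr n (nth 0 l) *m S = S *m diag_mx d.
  rewrite /diagr mul_diag_mx mul_mx_diag; apply/matrixP=> i j; rewrite !mxE.
  by case: eqP => [<-|_]; [rewrite sgE mulrC | rewrite mulr0 mul0r].
have SS : S^t* *m S = 1%:M.
  by rewrite /S tr_perm_mx map_perm_mx -perm_mxM mulVg perm_mx1.
rewrite [LHS]AE invmx_unitary // adjmxM -!mulmxA (mulmxA (diagr _ _)) comm -!mulmxA.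
by rewrite (mulmxA (S^t*)) SS mul1mx.
Qed.

Lemma herm_of_diag n (U : 'M[C]_n) (l : seq R) : U \is unitarymx -> size l = n ->
  let A := U^t* *m diagr n (nth 0 l) *m U in
  A \is hermsymmx /\ char_poly A = \prod_(x <- l) ('X - (x%:C)%:P).
Proof.
move=> Uu sz A; split.
  by apply/hermP; rewrite /A !adjmxM trmxCK diagr_adj mulmxA.
rewrite /A -invmx_unitary // char_poly_conj ?unitarymx_unit // char_poly_diag.
rewrite (big_nth 0) sz big_mkord; apply: eq_bigr => i _.
by rewrite mxE.
Qed.

Lemma herm3_ext n l l' : (forall s, perm_eq (l s) (l' s)) -> herm3 n l -> herm3 n l'.
Proof.
move=> e [A [h0 h1 h2]]; exists A; split=> // s; rewrite h2.
exact: perm_big.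
Qed.

Lemma herm3_scalar n (a : 'I_3 -> R) : \sum_s a s = 0 -> herm3 n (fun s => nseq n (a s)).
Proof.
move=> a0; exists (fun s => ((a s)%:C)%:M); split=> [s||s].
- by apply/hermP; rewrite tr_scalar_mx map_scalar_mx /=; congr (_%:M); apply: conjc_real.
- by rewrite -raddf_sum -rmorph_sum a0 /= raddf0.
rewrite /char_poly /char_poly_mx map_scalar_mx -raddfB det_scalar.
by rewrite big_nseq iter_mulr_1.
Qed.

Lemma herm3_sum n1 n2 l1 l2 l : herm3 n1 l1 -> herm3 n2 l2 ->
  (forall s, perm_eq (l s) (l1 s ++ l2 s)) -> herm3 (n1 + n2) l.
Proof.
move=> [A [h0 h1 h2]] [B [k0 k1 k2]] pl.
exists (fun s => block_mx (A s) 0 0 (B s)); split=> [s||s].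
- apply/hermP; rewrite tr_block_mx map_block_mx !trmx0 !map_mx0.
  by rewrite (hermP _ (h0 s)) (hermP _ (k0 s)).
- rewrite -[RHS](@block_mx0 _ n1 n2 n1 n2).
  have := h1; have := k1; rewrite !big_ord_recl !big_ord0 !addr0 => e1 e2.
  by rewrite !add_block_mx !addr0 e1 e2.
by rewrite char_poly_block h2 k2 (perm_big _ (pl s)) big_cat.
Qed.

(* The complete flags spanned by the first rows of the matrices U s. *)
Definition flag n (U : 'I_3 -> 'M[C]_n) s i : 'M[C]_n := pid_mx i *m U s.

Lemma flag_chain n (U : 'I_3 -> 'M[C]_n) : (forall s, U s \in unitmx) -> chain n (flag U).
Proof.
move=> Uu s; split.
- by rewrite /flag pid_mx_0 mul0mx.
- move=> i; rewrite /flag submxMr //.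
  have -> : (pid_mx i : 'M[C]_n) = pid_mx i *m (pid_mx i.+1 : 'M[C]_n).
    by rewrite mul_pid_mx (minn_idPl (leqnSn i)) pid_mx_minv.
  exact: submxMl.
- by rewrite /flag pid_mx_1 mul1mx row_full_unit.
Qed.

Lemma rank_flag n (U : 'I_3 -> 'M[C]_n) s i : U s \in unitmx -> (i <= n)%N ->
  \rank (flag U s i) = i.
Proof. by move=> Us im; rewrite /flag mxrankMfree ?row_free_unit // rank_pid_mx. Qed.

Lemma flag_spectrum n (U : 'I_3 -> 'M[C]_n) (l : 'I_3 -> seq R) s : U s \in unitmx ->
  size (l s) = n -> spectrum n (fun s => nth 0 (l s)) (flag U) s = l s.
Proof.
move=> Us sz; rewrite /spectrum /jumps.
have -> : [seq nseq (\rank (flag U s i.+1) - \rank (flag U s i)) i | i <- iota 0 n] =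
   [seq [:: i] | i <- iota 0 n].
  apply/eq_in_map => i; rewrite mem_iota => /andP[_ im].
  by rewrite !rank_flag // ?subSnn //; lia.
by rewrite flatten_seq1 -/(mkseq _ _) -sz mkseq_nth.
Qed.

(** Abel summation writes the difference of the two sides as drops of [l] times defects of the
    partial sums, both nonnegative; the last defect vanishes. *)
Lemma abel_le n (l t r : nat -> R) :
  (forall i j, (i <= j < n)%N -> l j <= l i) ->
  (forall k, (k <= n)%N -> r k <= \sum_(j < k) t j) -> r 0%N = 0 ->
  r n = \sum_(j < n) t j ->
  \sum_(j < n) l j * (r j.+1 - r j) <= \sum_(j < n) l j * t j.
Proof.
move=> lm rt r0 rn.
pose de k := \sum_(j < k) t j - r k.
have -> : \sum_(j < n) l j * t j = \sum_(j < n) l j * (r j.+1 - r j) +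
    \sum_(j < n) l j * (de j.+1 - de j).
  rewrite -big_split; apply: eq_bigr => j _; rewrite /de big_ord_recr /=; ring.
rewrite lerDl; have -> : \sum_(j < n) l j * (de j.+1 - de j) =
   l n.-1 * de n + \sum_(j < n.-1) (l j - l j.+1) * de j.+1.
  case: n {rt rn} lm => [|n] lm.
    by rewrite !big_ord0 /de big_ord0 r0 subrr mulr0 addr0.
  rewrite /=; elim: n {lm} => [|n IH].
    rewrite big_ord0 big_ord_recr big_ord0 /=; have -> : de 0%N = 0; last by ring.
    by rewrite /de big_ord0 r0 subrr.
  rewrite big_ord_recr /= IH big_ord_recr /=; ring.
rewrite {1}/de rn subrr mulr0 add0r sumr_ge0 // => j _.
rewrite mulr_ge0 ?subr_ge0 //; last by apply: rt; case: j => j /=; lia.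
by apply: lm; case: j => j /=; lia.
Qed.

Lemma orthonormal_base m n (V : 'M[C]_(m, n)) :
  exists2 Q : 'M[C]_(\rank V, n), Q *m Q^t* = 1%:M & (Q :=: V)%MS.
Proof.
exists (schmidt (row_base V)).
  by apply/unitarymxP/schmidt_unitarymx; rewrite rank_leq_col.
apply: (eqmx_trans (eqmx_schmidt_free (row_base_free V))).
exact: eq_row_base.
Qed.

(* For orthogonal projections onto V and W, tr (P_V P_W) >= dim (V :&: W). *)
Lemma trace_proj_ge m1 m2 n (Q : 'M[C]_(m1, n)) (W : 'M[C]_(m2, n)) :
  Q *m Q^t* = 1%:M -> W *m W^t* = 1%:M ->
  ((\rank (Q :&: W)%MS)%:R : C) <= \tr (W *m (Q^t* *m Q) *m W^t*).
Proof.
move=> QQ WW; have [B BB eB] := orthonormal_base (Q :&: W)%MS.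
have BQ : B *m (Q^t* *m Q) = B.
  have /submxP[D ->] : (B <= Q)%MS by rewrite eB capmxSl.
  by rewrite -mulmxA (mulmxA Q) QQ mul1mx.
have BW : B *m (W^t* *m W) = B.
  have /submxP[D ->] : (B <= W)%MS by rewrite eB capmxSr.
  by rewrite -mulmxA (mulmxA W) WW mul1mx.
have QB : Q^t* *m Q *m B^t* = B^t*.
  by rewrite -[in RHS]BQ !adjmxM trmxCK.
(* [G] projects onto the part of the row space of [Q] orthogonal to the intersection; it adds a
   nonnegative term to the trace. *)
pose G := Q^t* *m Q - B^t* *m B.
have GA : G^t* = G by rewrite /G adjmxD adjmxN !adjmxM !trmxCK.
have GG : G *m G = G.
  rewrite /G mulmxBl !mulmxBr !mulmxA -(mulmxA _ Q (Q^t*)) QQ mulmx1.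
  rewrite QB -(mulmxA _ B (B^t*)) BB mulmx1 -(mulmxA _ B (Q^t*)) -(mulmxA _ _ Q).
  rewrite -(mulmxA B) BQ subrr subr0 //.
have -> : W *m (Q^t* *m Q) *m W^t* = (W *m B^t*) *m (W *m B^t*)^t* + (W *m G) *m (W *m G)^t*.
  rewrite !adjmxM trmxCK GA !mulmxA -(mulmxA _ G G) GG -!(mulmxA W).
  by rewrite -mulmxDr -mulmxDl /G addrC subrK.
rewrite mxtraceD mxtrace_mulC adjmxM trmxCK mulmxA -(mulmxA B).
rewrite BW BB mxtrace1 lerDl; exact: frob_ge0.
Qed.

Lemma ReD (x y : C) : complex.Re (x + y) = complex.Re x + complex.Re y.
Proof. by case: x; case: y. Qed.

Lemma Re_sum (I : Type) (r : seq I) (P : pred I) (f : I -> C) :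
  complex.Re (\sum_(i <- r | P i) f i) = \sum_(i <- r | P i) complex.Re (f i).
Proof. by elim/big_rec2: _ => // i x y _ <-; rewrite ReD. Qed.

Lemma Re_realM (x : R) (z : C) : complex.Re (x%:C * z) = x * complex.Re z.
Proof. by case: z => a b /=; rewrite mul0r subr0. Qed.

Lemma Re_nat n : complex.Re (n%:R : C) = n%:R.
Proof. by elim: n => // n IH; rewrite -!natr1 ReD IH. Qed.

Lemma le_Re (x y : C) : x <= y -> complex.Re x <= complex.Re y.
Proof. by rewrite lecE => /andP[]. Qed.

(** For an orthonormal basis [Q] of [V], the contribution of each filtration to the degree is at
    most the trace of the compression of [A s] to [V]; these traces sum to zero because the matrices
    do. *)
Lemma herm3_semistable n (l : 'I_3 -> seq R) : (forall s, sorted >=%O (l s)) ->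
  herm3 n l -> exists U : 'I_3 -> 'M[C]_n,
    [/\ forall s, U s \is unitarymx, forall s, size (l s) = n &
      semistable n (fun s => nth 0 (l s)) (flag U)].
Proof.
move=> sl [A [h0 h1 h2]].
have /choice[U UP] : forall s, exists U : 'M[C]_n, U \is unitarymx /\
    A s = U^t* *m diagr n (nth 0 (l s)) *m U.
  by move=> s; have [U U1 U2] := herm_diagonalize (h0 s) (h2 s); exists U.
have Uu s : U s \in unitmx by apply: unitarymx_unit; case: (UP s).
have sz s : size (l s) = n.
  by have := size_char_poly (A s); rewrite h2 size_prod_XsubC => -[].
exists U; split=> // [s|]; first by case: (UP s).
have cE := flag_chain Uu.
have key m (Q : 'M[C]_(m, n)) : Q *m Q^t* = 1%:M -> forall s,
    \sum_(i < n) nth 0 (l s) i * (rk R (flag U) Q s i.+1 - rk R (flag U) Q s i) <=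
    complex.Re (\tr (Q *m A s *m Q^t*)).
  move=> QQ s; have [Us As] := UP s.
  (* The diagonal of [M] measures how much of each eigenvector lies in [V]; [trace_proj_ge] bounds
     its partial sums below by the ranks of intersections with the flag. *)
  have [M ME] : exists M, M = U s *m (Q^t* *m Q) *m (U s)^t* by eexists.
  pose t j := complex.Re (if insub j is Some i then M i i else 0).
  have tE (i : 'I_n) : t i = complex.Re (M i i) by rewrite /t valK.
  have -> : \tr (Q *m A s *m Q^t*) = \sum_(i < n) ((nth 0 (l s) i)%:C * M i i).
    have -> : \tr (Q *m A s *m Q^t*) = \tr (diagr n (nth 0 (l s)) *m M).
      by rewrite As ME !mulmxA -[in RHS](mulmxA _ Q) [RHS]mxtrace_mulC !mulmxA.
    rewrite /mxtrace; apply: eq_bigr => i _.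
    rewrite mxE (bigD1 i) //= big1 ?addr0 => [|k ki].
      by rewrite !mxE eqxx mulr1n.
    by rewrite !mxE eq_sym (negPf ki) mulr0n mul0r.
  rewrite Re_sum [X in _ <= X](eq_bigr (fun i : 'I_n => nth 0 (l s) i * t i)); last first.
    by move=> i _; rewrite Re_realM tE.
  have tsum k : (k <= n)%N -> \sum_(j < k) t j =
      complex.Re (\tr (pid_mx k *m M)).
    move=> kn; have pidE (i j : 'I_n) : (pid_mx k : 'M[C]_n) i j = ((i == j) && (i < k)%N)%:R.
      by rewrite mxE.
    rewrite /mxtrace Re_sum (big_ord_widen n t kn) big_mkcond /=.
    apply: eq_bigr => i _; rewrite tE mxE (bigD1 i) //= big1 ?addr0.
      by rewrite pidE eqxx /=; case: ifP; rewrite ?mul1r ?mul0r.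
    by move=> j ji; rewrite pidE eq_sym (negPf ji) mul0r.
  apply: abel_le.
  - move=> i j /andP[ij jn]; apply: (sorted_leq_nth _ _ 0 (sl s)) => //.
      by move=> x y z yx zy; apply: le_trans zy yx.
    + by move=> x; apply: lexx.
    + by rewrite ?inE sz (leq_ltn_trans ij).
    + by rewrite ?inE sz.
  - move=> k kn; rewrite tsum // /rk -Re_nat; apply: le_Re.
    pose W : 'M[C]_(k, n) := pid_mx k *m U s.
    have WW : W *m W^t* = 1%:M.
      rewrite /W adjmxM tr_pid_mx map_pid_mx -mulmxA (mulmxA (U s)) (unitarymxP Us) mul1mx.
      by rewrite mul_pid_mx minnn (minn_idPr kn) pid_mx_1.
    have eW : (W :=: flag U s k)%MS.
      apply/eqmxP/andP; split.
        have -> : W = pid_mx k *m flag U s k; last exact: submxMl.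
        by rewrite /W /flag mulmxA mul_pid_mx minnn (minn_idPr kn).
      have -> : flag U s k = pid_mx k *m W; last exact: submxMl.
      by rewrite /W /flag mulmxA mul_pid_mx !minnn.
    have := trace_proj_ge QQ WW; rewrite (cap_eqmx (eqmx_refl _) eW).
    congr (_ <= _); rewrite /W !adjmxM tr_pid_mx map_pid_mx !mulmxA mxtrace_mulC.
    by rewrite !mulmxA mul_pid_mx !minnn ME !mulmxA.
  - exact: rk0.
  - rewrite rkm // tsum // pid_mx_1 mul1mx ME mxtrace_mulC mulmxA.
    have -> : (U s)^t* *m U s = 1%:M by rewrite -invmx_unitary // mulVmx.
    rewrite mul1mx mxtrace_mulC QQ mxtrace1 Re_nat; congr (_%:R).
    have : row_free Q by apply/row_freeP; exists (Q^t*).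
    by rewrite /row_free => /eqP ->.
have tr0 m (Q : 'M[C]_(m, n)) : \sum_s complex.Re (\tr (Q *m A s *m Q^t*)) = 0.
  have e : \sum_s \tr (Q *m A s *m Q^t*) = \tr (Q *m (\sum_s A s) *m Q^t*).
    by rewrite mulmx_sumr mulmx_suml raddf_sum.
  by rewrite -Re_sum e h1 mulmx0 mul0mx mxtrace0.
split.
  move=> V; have [Q QQ eQ] := orthonormal_base V.
  rewrite -(wdeg_eqmx _ _ _ eQ).
  apply: (@le_trans _ _ (\sum_s complex.Re (\tr (Q *m A s *m Q^t*)))).
    by apply: ler_sum => s _; exact: key.
  by rewrite tr0.
rewrite wdeg1 //.
under eq_bigr do rewrite flag_spectrum //.
have n0 := leq0n n; case: (posnP n) => [n0'|npos].
  by rewrite big1 // => s _; rewrite (size0nil (s := l s)) ?big_nil // sz.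
rewrite -[RHS](tr0 n 1%:M); apply: eq_bigr => s _.
rewrite mul1mx adjmx1 mulmx1; have [Us ->] := UP s.
rewrite mxtrace_mulC mulmxA -invmx_unitary // mulmxV // mul1mx.
rewrite /mxtrace Re_sum (big_nth 0) sz big_mkord; apply: eq_bigr => i _.
by rewrite !mxE eqxx mulr1n.
Qed.

End Herm3.

From mathcomp Require Import all_field.
From mathcomp Require Import all_classical all_reals all_analysis complex.
From mathcomp Require Import measurable_realfun.
Import Order.TTheory GRing.Theory Num.Theory.
Import numFieldNormedType.Exports.

(** * Limits along an ultrafilter *)

Section UltraLimits.
Variables (R : realType) (F : set_system nat).
Hypothesis FU : UltraFilter F.
Hypothesis Foo : (\oo `<=` F)%classic.
Local Notation C := R[i].
Local Open Scope sesquilinear_scope.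
Local Open Scope classical_set_scope.

(** Compactness through an ultrafilter: all bounded sequences converge along the same [F], so no
    subsequence has to be extracted. *)
Lemma ucvg_bounded (f : nat -> R) (a b : R) : (forall k, a <= f k <= b) ->
  exists l, a <= l <= b /\ (f k @[k --> F] --> l).
Proof.
move=> fab; have cc := @segment_compact R a b.
rewrite compact_ultra in cc.
have UI : UltraFilter (f @ F).
  split=> [|G GF sub]; first exact: fmap_proper_filter.
  rewrite predeqE => A; split; last exact: sub.
  move=> GA; have [//|nA] := in_ultra_setVsetC (f @^-1` A) FU.
  have GnA : G (~` A) by apply: sub.
  by have /filter_ex[? []] : G (A `&` ~` A) by apply: filterI.
have [|l [lab fl]] := cc _ UI.
  have : F (f @^-1` `[a, b]) by apply: filterE => k /=; rewrite in_itv /= fab.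
  by [].
by exists l; split=> //; move: lab; rewrite /= in_itv.
Qed.

Lemma ucvg_unique (f : nat -> R) (a b : R) : (f k @[k --> F] --> a) -> (f k @[k --> F] --> b) ->
  a = b.
Proof.
by move=> fa fb; rewrite -(cvg_lim (@norm_hausdorff _ _) fa) (cvg_lim (@norm_hausdorff _ _) fb).
Qed.

Definition ccvg (z : nat -> C) (l : C) :=
  (complex.Re (z k) @[k --> F] --> complex.Re l) /\
  (complex.Im (z k) @[k --> F] --> complex.Im l).

Lemma ccvg_unique z a b : ccvg z a -> ccvg z b -> a = b.
Proof.
case=> a1 a2 [b1 b2]; apply/eqP; rewrite eq_complex.
by rewrite (ucvg_unique a1 b1) (ucvg_unique a2 b2) !eqxx.
Qed.

Lemma ccvg_cst (a : C) : ccvg (fun=> a) a.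
Proof. by split; apply: cvg_cst. Qed.

Lemma ccvgD z1 z2 a b : ccvg z1 a -> ccvg z2 b -> ccvg (fun k => z1 k + z2 k) (a + b).
Proof.
case=> a1 a2 [b1 b2]; split.
  rewrite (_ : (fun k => complex.Re _) = (fun k => complex.Re (z1 k) + complex.Re (z2 k))).
    by rewrite ReD; apply: cvgD.
  by apply/funext => k; rewrite ReD.
rewrite (_ : (fun k => complex.Im _) = (fun k => complex.Im (z1 k) + complex.Im (z2 k))).
  by rewrite (_ : complex.Im (a + b) = complex.Im a + complex.Im b);
    [apply: cvgD|case: (a); case: (b)].
by apply/funext => k; case: (z1 k); case: (z2 k).
Qed.

Lemma ccvgM z1 z2 a b : ccvg z1 a -> ccvg z2 b -> ccvg (fun k => z1 k * z2 k) (a * b).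
Proof.
case=> a1 a2 [b1 b2].
have ReM (x y : C) : complex.Re (x * y) =
  complex.Re x * complex.Re y - complex.Im x * complex.Im y by case: x; case: y.
have ImM (x y : C) : complex.Im (x * y) =
  complex.Re x * complex.Im y + complex.Im x * complex.Re y by case: x; case: y.
split.
  rewrite (_ : (fun k => complex.Re _) = (fun k => complex.Re (z1 k) * complex.Re (z2 k)
     - complex.Im (z1 k) * complex.Im (z2 k))); last by apply/funext => k; rewrite ReM.
  by rewrite ReM; apply: cvgB; apply: cvgM.
rewrite (_ : (fun k => complex.Im _) = (fun k => complex.Re (z1 k) * complex.Im (z2 k)
   + complex.Im (z1 k) * complex.Re (z2 k))); last by apply/funext => k; rewrite ImM.
by rewrite ImM; apply: cvgD; apply: cvgM.
Qed.

Lemma ccvg_conj z a : ccvg z a -> ccvg (fun k => (z k)^*) (a^*).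
Proof.
have ReC (x : C) : complex.Re (x^*) = complex.Re x by case: x.
have ImC (x : C) : complex.Im (x^*) = - complex.Im x by case: x.
case=> a1 a2; split.
  by rewrite ReC (_ : (fun k => _) = (fun k => complex.Re (z k))) //; apply/funext => k.
rewrite ImC (_ : (fun k => _) = (fun k => - complex.Im (z k))); first exact: cvgN.
by apply/funext => k.
Qed.

Lemma ccvg_sum (I : Type) (r : seq I) (P : pred I) (z : I -> nat -> C) (a : I -> C) :
  (forall i, P i -> ccvg (z i) (a i)) ->
  ccvg (fun k => \sum_(i <- r | P i) z i k) (\sum_(i <- r | P i) a i).
Proof.
move=> h; elim: r => [|i r IH].
  rewrite big_nil (_ : (fun k => _) = (fun=> 0)); first exact: ccvg_cst.
  by apply/funext => k; rewrite big_nil.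
rewrite big_cons (_ : (fun k => _) = (fun k => if P i then z i k + \sum_(i <- r | P i) z i k
   else \sum_(i <- r | P i) z i k)); last by apply/funext => k; rewrite big_cons.
by case: ifP => // /h hi; apply: ccvgD.
Qed.

Lemma ccvg_prod (I : Type) (r : seq I) (P : pred I) (z : I -> nat -> C) (a : I -> C) :
  (forall i, P i -> ccvg (z i) (a i)) ->
  ccvg (fun k => \prod_(i <- r | P i) z i k) (\prod_(i <- r | P i) a i).
Proof.
move=> h; elim: r => [|i r IH].
  rewrite big_nil (_ : (fun k => _) = (fun=> 1)); first exact: ccvg_cst.
  by apply/funext => k; rewrite big_nil.
rewrite big_cons (_ : (fun k => _) = (fun k => if P i then z i k * \prod_(i <- r | P i) z i k
   else \prod_(i <- r | P i) z i k)); last by apply/funext => k; rewrite big_cons.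
by case: ifP => // /h hi; apply: ccvgM.
Qed.

Lemma ccvg_real (f : nat -> R) (l : R) : (f k @[k --> F] --> l) ->
  ccvg (fun k => real_complex R (f k)) (real_complex R l).
Proof. by move=> h; split=> //=; apply: cvg_cst. Qed.

Definition mcvg m n (X : nat -> 'M[C]_(m, n)) (L : 'M[C]_(m, n)) :=
  forall i j, ccvg (fun k => X k i j) (L i j).

Lemma mcvg_unique m n (X : nat -> 'M[C]_(m, n)) L L' : mcvg X L -> mcvg X L' -> L = L'.
Proof. by move=> h h'; apply/matrixP => i j; apply: ccvg_unique (h i j) (h' i j). Qed.

Lemma mcvg_cst m n (L : 'M[C]_(m, n)) : mcvg (fun=> L) L.
Proof. by move=> i j; apply: ccvg_cst. Qed.

Lemma mcvgM m n p (X : nat -> 'M[C]_(m, n)) (Y : nat -> 'M[C]_(n, p)) L L' :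
  mcvg X L -> mcvg Y L' -> mcvg (fun k => X k *m Y k) (L *m L').
Proof.
move=> h h' i j; rewrite mxE (_ : (fun k => _) = (fun k => \sum_l X k i l * Y k l j)).
  by apply: ccvg_sum => l _; apply: ccvgM.
by apply/funext => k; rewrite mxE.
Qed.

Lemma mcvg_adj m n (X : nat -> 'M[C]_(m, n)) L : mcvg X L ->
  mcvg (fun k => (X k)^t*) (L^t*).
Proof.
move=> h i j; rewrite !mxE (_ : (fun k => _) = (fun k => (X k j i)^*)).
  exact: ccvg_conj.
by apply/funext => k; rewrite !mxE.
Qed.

Lemma ccvg_det n (X : nat -> 'M[C]_n) L : mcvg X L -> ccvg (fun k => \det (X k)) (\det L).
Proof.
move=> h; apply: ccvg_sum => s _; apply: ccvgM; first exact: ccvg_cst.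
by apply: ccvg_prod => i _; apply: h.
Qed.

Lemma mcvg_diagr n (f : nat -> nat -> R) (l : nat -> R) :
  (forall i, (i < n)%N -> f k i @[k --> F] --> l i) ->
  mcvg (fun k => diagr n (f k)) (diagr n l).
Proof.
move=> h i j; rewrite !mxE.
rewrite (_ : (fun k => _) = (fun k => real_complex R (f k i) *+ (i == j))); last first.
  by apply/funext => k; rewrite !mxE.
case: eqP => _; last by rewrite mulr0n; apply: ccvg_cst.
by rewrite mulr1n; apply: ccvg_real; apply: h.
Qed.

Lemma unitary_entry n (U : 'M[C]_n) i j : U \is unitarymx ->
  -1 <= complex.Re (U i j) <= 1 /\ -1 <= complex.Im (U i j) <= 1.
Proof.
move=> /unitarymxP/matrixP/(_ i i); rewrite !mxE eqxx => /(congr1 (@complex.Re R)).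
rewrite Re_sum (bigD1 j) //= !mxE => e.
have sq (z : C) : complex.Re (z * z^*) = complex.Re z ^+ 2 + complex.Im z ^+ 2.
  by case: z => a b /=; ring.
have : 0 <= \sum_(k < n | k != j) complex.Re (U i k * (U ^t*) k i).
  by apply: sumr_ge0 => k _; rewrite !mxE sq addr_ge0 ?sqr_ge0.
move: e; rewrite sq; set a := complex.Re _; set b := complex.Im _; set S := \sum_(_ < _ | _) _.
move=> e S0; have h : a ^+ 2 + b ^+ 2 <= 1 by lra.
have := sqr_ge0 a; have := sqr_ge0 b => b2 a2.
split; rewrite -ler_norml -(ler_pXn2r (_ : 0 < 2)%N) ?nnegrE ?normr_ge0 ?ler01 // expr1n
  real_normK ?num_real //; lra.
Qed.

Lemma unitary_limit n (U : nat -> 'M[C]_n) : (forall k, U k \is unitarymx) ->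
  exists2 L, L \is unitarymx & mcvg U L.
Proof.
move=> Uu.
have hR (x : 'I_n * 'I_n) : exists l : R, complex.Re (U k x.1 x.2) @[k --> F] --> l.
  have [|l [_ h]] := @ucvg_bounded (fun k => complex.Re (U k x.1 x.2)) (-1) 1.
    by move=> k; case: (unitary_entry x.1 x.2 (Uu k)).
  by exists l.
have hI (x : 'I_n * 'I_n) : exists l : R, complex.Im (U k x.1 x.2) @[k --> F] --> l.
  have [|l [_ h]] := @ucvg_bounded (fun k => complex.Im (U k x.1 x.2)) (-1) 1.
    by move=> k; case: (unitary_entry x.1 x.2 (Uu k)).
  by exists l.
have [f fP] := choice hR; have [g gP] := choice hI.
pose L : 'M[C]_n := \matrix_(i, j) Complex (f (i, j)) (g (i, j)).
have UL : mcvg U L.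
  by move=> i j; rewrite mxE; split; [exact: (fP (i, j)) | exact: (gP (i, j))].
exists L => //; apply/unitarymxP.
apply: (mcvg_unique (mcvgM UL (mcvg_adj UL))).
rewrite (_ : (fun k => _) = (fun=> 1%:M)); first exact: mcvg_cst.
by apply/funext => k; apply/unitarymxP.
Qed.

Lemma ucvg_gt (f : nat -> R) (l a : R) : (f k @[k --> F] --> l) -> a < l ->
  F [set k | a < f k].
Proof. by move=> fl al; apply: (cvgr_gt _ fl). Qed.

Lemma ultra_large k : F [set j | (k <= j)%N].
Proof. by apply: Foo; exists k. Qed.

End UltraLimits.

Lemma ultra_nat : exists F : set_system nat, UltraFilter F /\ (\oo `<=` F)%classic.
Proof. exact: ultraFilterLemma. Qed.

Section Pivots.
Variable K : fieldType.

(* Columns of G at which the rank of the leading block increases. *)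
Lemma pivot_columns d n (G : 'M[K]_(d, n)) : row_free G ->
  exists f : 'I_d -> 'I_n, [/\ injective f, colsub f G \in unitmx &
    forall a, (a <= n)%N -> \rank (G *m (pid_mx a : 'M[K]_n)) = #|[pred i | (f i < a)%N]|].
Proof.
move=> Gf; pose H := G^T.
pose S a : 'M[K]_d := (\sum_(k < n | (k < a)%N) <<row k H>>)%MS.
have rS a : \rank (G *m (pid_mx a : 'M[K]_n)) = \rank (S a).
  rewrite -mxrank_tr trmx_mul tr_pid_mx -/H; apply: eqmx_rank.
  apply/andP; split.
    apply/row_subP => k; rewrite row_mul.
    have [ka|ka] := ltnP k a.
      have -> : row k (pid_mx a : 'M[K]_n) = row k 1%:M.
        by apply/rowP => j; rewrite !mxE ka andbT.
      by rewrite -row_mul mul1mx (sumsmx_sup k) // genmxE.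
    have -> : row k (pid_mx a : 'M[K]_n) = 0.
      by apply/rowP => j; rewrite !mxE ltnNge ka andbF.
    by rewrite mul0mx sub0mx.
  apply/sumsmx_subP => k ka; rewrite genmxE.
  have -> : row k H = row k (pid_mx a *m H).
    rewrite row_mul; have -> : row k (pid_mx a : 'M[K]_n) = row k 1%:M.
      by apply/rowP => j; rewrite !mxE ka andbT.
    by rewrite -row_mul mul1mx.
  exact: row_sub.
have SS (k : 'I_n) : (S k.+1 :=: S k + <<row k H>>)%MS.
  apply/eqmxP/andP; split.
    apply/sumsmx_subP => j; rewrite ltnS leq_eqVlt => /predU1P[/val_inj ->|jk].
      exact: addsmxSr.
    by apply: submx_trans (addsmxSl _ _); apply: sumsmx_sup jk _.
  rewrite addsmx_sub; apply/andP; split.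
    by apply/sumsmx_subP => j jk; apply: sumsmx_sup (ltnW jk) _.
  exact: (sumsmx_sup k).
(* [I] collects the columns independent of the preceding ones; each raises the rank of the leading
   block by one. *)
pose I := [set k : 'I_n | ~~ (row k H <= S k)%MS].
have rI a : (a <= n)%N -> \rank (S a) = #|[set k in I | (k < a)%N]|.
  elim: a => [|a IH] an.
    rewrite /S big_pred0 // mxrank0; apply/esym/eqP; rewrite cards_eq0.
    by apply/eqP/setP => k; rewrite !inE andbF.
  pose k := Ordinal an; have rk : \rank (S a.+1) = \rank (S a + <<row k H>>)%MS.
    by apply: eqmx_rank; apply/eqmxP; exact: (SS k).
  rewrite (cardsD1 k) inE /= ltnSn andbT.
  have -> : [set x in I | (x < a.+1)%N] :\ k = [set x in I | (x < a)%N].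
    apply/setP => x; rewrite !inE -(inj_eq val_inj) /= ltnS leq_eqVlt.
    by have [->|] := eqVneq (val x) a; rewrite ?ltnn ?andbF.
  rewrite -IH ?(ltnW an) // rk addnC.
  have [kI|kI] := boolP (k \in I); rewrite ?addn1 ?addn0.
    apply/eqP; rewrite eqn_leq; apply/andP; split.
      apply: leq_trans (mxrank_adds_leqif _ _) _.
      by rewrite -[X in (_ <= X)%N]addn1 leq_add2l mxrank_gen rank_leq_row.
    have lf := mxrank_leqif_sup (addsmxSl (S a) <<row k H>>%MS).
    rewrite (ltn_leqif lf); apply/negP => h; move: kI; rewrite /I inE => /negP; apply.
    by rewrite (submx_trans _ h) // (submx_trans _ (addsmxSr _ _)) ?genmxE.
  apply: eqmx_rank; rewrite addsmxSl andbT addsmx_sub submx_refl genmxE.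
  by rewrite /=; move: kI; rewrite /I inE negbK.
have Sn : \rank (S n) = d.
  by rewrite -rS pid_mx_1 mulmx1; apply/eqP.
have cI : #|I| = d.
  rewrite -Sn rI //; congr #|pred_of_set _|; apply/setP => k.
  by rewrite [in RHS]inE ltn_ord andbT.
pose f (i : 'I_d) : 'I_n := enum_val (cast_ord (esym cI) i).
have fI i : f i \in I by apply: enum_valP.
have fJ : injective f by move=> i j /enum_val_inj/cast_ord_inj.
have fS k : k \in I -> exists i, f i = k.
  move=> kI; exists (cast_ord cI (enum_rank_in kI k)).
  by rewrite /f cast_ordK enum_rankK_in.
exists f; split=> // [|a an].
  have sub a : (a <= n)%N -> (S a <= rowsub f H)%MS.
    elim: a => [|a IH] an; first by rewrite /S big_pred0 ?sub0mx.
    have Sa := IH (ltnW an); pose k := Ordinal an.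
    rewrite (SS k) addsmx_sub Sa genmxE /=.
    have [kI|] := boolP (k \in I); last by rewrite /I inE negbK => h; apply: submx_trans h Sa.
    have [i <-] := fS k kI; have -> : row (f i) H = row i (rowsub f H).
      by apply/rowP => j; rewrite !mxE.
    exact: row_sub.
  have -> : colsub f G = (rowsub f H)^T by apply/matrixP => i j; rewrite !mxE.
  rewrite unitmx_tr -row_full_unit /row_full eqn_leq rank_leq_col /=.
  by rewrite -{1}Sn mxrankS // sub.
rewrite rS rI // -[RHS]cardsE -(card_imset _ fJ); congr #|pred_of_set _|; apply/setP => k.
rewrite inE; apply/andP/imsetP => [[kI ka]|[i ia ->]]; last by rewrite fI; move: ia; rewrite inE.
by have [i fi] := fS k kI; exists i; rewrite ?inE ?fi.
Qed.
End Pivots.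

(** * Gram determinants *)

Section GramDet.
Variable R : realType.
Local Notation C := R[i].
Local Open Scope sesquilinear_scope.
Local Open Scope complex_scope.

Lemma herm_spec n (A : 'M[C]_n) : A \is hermsymmx -> exists l : seq R,
  [/\ size l = n, sorted >=%O l &
    exists2 U : 'M[C]_n, U \is unitarymx & A = U^t* *m diagr n (nth 0 l) *m U].
Proof.
move=> hA; have AE := hermitian_normalmx hA; move/orthomx_spectralP: AE => AE.
set P := spectralmx A in AE; set d := spectral_diag A in AE.
have dr : d \is a mxOver Num.real := hermitian_spectral_diag_real hA.
pose l := sort >=%O [seq complex.Re (d 0 i) | i <- enum 'I_n].
have cA : char_poly A = \prod_(x <- l) ('X - (x%:C)%:P).
  rewrite (perm_big _ (permEl (perm_sort _ _))) /= big_map big_enum /=.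
  rewrite AE char_poly_conj ?char_poly_diag ?spectral_unit //.
  by apply: eq_bigr => i _; rewrite RRe_real //; apply: (mxOverP dr).
have [U Uu AU] := herm_diagonalize hA cA.
exists l; split; last by exists U.
  by rewrite size_sort size_map size_enum_ord.
by apply: sort_sorted => x y; apply: le_total.
Qed.

Lemma det_unitary_conj n (U A : 'M[C]_n) : U \is unitarymx ->
  \det (U^t* *m A *m U) = \det A.
Proof.
move=> Uu; rewrite !det_mulmx mulrAC -det_mulmx -invmx_unitary // mulVmx ?det1 ?mul1r //.
exact: unitarymx_unit.
Qed.

Lemma det_diagr n (f : nat -> R) : \det (diagr n f) = (\prod_(i < n) f i)%:C.
Proof.
by rewrite det_diag rmorph_prod; apply: eq_bigr => i _; rewrite mxE.
Qed.

Lemma tr_diagr n (f : nat -> R) : \tr (diagr n f) = (\sum_(i < n) f i)%:C.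
Proof.
rewrite mxtrace_diag rmorph_sum; apply: eq_bigr => i _; by rewrite mxE.
Qed.

Lemma mxtrace_unitary_conj n (U A : 'M[C]_n) : U \is unitarymx ->
  \tr (U^t* *m A *m U) = \tr A.
Proof.
move=> Uu; rewrite -mulmxA mxtrace_mulC -mulmxA.
by rewrite (unitarymxP Uu) mulmx1.
Qed.

Lemma psd_spec d n (X : 'M[C]_(d, n)) : exists l : seq R,
  [/\ size l = d, (forall i, (i < d)%N -> 0 <= nth 0 l i),
     (row_free X -> forall i, (i < d)%N -> 0 < nth 0 l i), sorted >=%O l &
    exists2 U : 'M[C]_d, U \is unitarymx & X *m X^t* = U^t* *m diagr d (nth 0 l) *m U].
Proof.
have hX : X *m X^t* \is hermsymmx by apply/hermP; rewrite adjmxM trmxCK.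
have [l [sz sl [U Uu XE]]] := herm_spec hX.
have UU := unitarymxP Uu.
have YY : (U *m X) *m (U *m X)^t* = diagr d (nth 0 l).
  rewrite adjmxM mulmxA -(mulmxA U) XE !mulmxA UU mul1mx -mulmxA UU mulmx1 //.
have rowE (i : 'I_d) : \tr (row i (U *m X) *m (row i (U *m X))^t*) = (nth 0 l i)%:C.
  have <- : (diagr d (nth 0 l)) i i = (nth 0 l i)%:C by rewrite !mxE eqxx mulr1n.
  rewrite -YY /mxtrace big_ord1 !mxE; apply: eq_bigr => j _.
  by rewrite !mxE.
have l0 i : (i < d)%N -> 0 <= nth 0 l i.
  move=> id; have := frob_ge0 (row (Ordinal id) (U *m X)); rewrite rowE.
  by rewrite ler0c.
exists l; split=> //; last by exists U.
move=> Xf i id; rewrite lt_neqAle l0 // andbT; apply/eqP => li.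
have /frob_eq0 r0 : \tr (row (Ordinal id) (U *m X) *m (row (Ordinal id) (U *m X))^t*) = 0.
  by rewrite rowE /= -li.
have UXf : row_free (U *m X).
  by rewrite /row_free mxrankMfree // mxrank_unitary.
have : row (Ordinal id) (1%:M : 'M[C]_d) = 0.
  apply: (row_free_inj UXf); by rewrite mul0mx -row_mul mul1mx r0.
by move/rowP/(_ (Ordinal id)); rewrite !mxE eqxx => /eqP; rewrite oner_eq0.
Qed.

Definition gm d n (X : 'M[C]_(d, n)) : R := complex.Re (\det (X *m X^t*)).

Lemma gm_gram d n n' (X : 'M[C]_(d, n)) (Y : 'M[C]_(d, n')) :
  X *m X^t* = Y *m Y^t* -> gm X = gm Y.
Proof. by rewrite /gm => ->. Qed.

Lemma gm_prod d n (X : 'M[C]_(d, n)) l U : U \is unitarymx ->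
  X *m X^t* = U^t* *m diagr d (nth 0 l) *m U -> gm X = \prod_(i < d) nth 0 l i.
Proof. by move=> Uu XE; rewrite /gm XE det_unitary_conj // det_diagr. Qed.

Lemma gmC d n (X : 'M[C]_(d, n)) : (gm X)%:C = \det (X *m X^t*).
Proof.
have [l [_ _ _ _ [U Uu XE]]] := psd_spec X.
by rewrite (gm_prod Uu XE) XE det_unitary_conj // det_diagr.
Qed.

Lemma gm_ge0 d n (X : 'M[C]_(d, n)) : 0 <= gm X.
Proof.
have [l [_ l0 _ _ [U Uu XE]]] := psd_spec X.
by rewrite (gm_prod Uu XE) prodr_ge0 // => i _; apply: l0.
Qed.

Lemma gm_gt0 d n (X : 'M[C]_(d, n)) : row_free X -> 0 < gm X.
Proof.
move=> Xf; have [l [_ _ l0 _ [U Uu XE]]] := psd_spec X.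
by rewrite (gm_prod Uu XE) prodr_gt0 // => i _; apply: l0.
Qed.

(** The inequality [x <= exp (x - 1)] for each eigenvalue of the Gram matrix. It is tangent at Gram
    matrix 1, where [min_balanced] uses it. *)
Lemma gm_le_exp d n (X : 'M[C]_(d, n)) :
  gm X <= expR (complex.Re (\tr (X *m X^t*)) - d%:R).
Proof.
have [l [_ l0 _ _ [U Uu XE]]] := psd_spec X.
rewrite (gm_prod Uu XE) XE mxtrace_unitary_conj // tr_diagr /=.
have -> : (d%:R : R) = \sum_(i < d) 1 by rewrite sumr_const card_ord.
rewrite -sumrB expR_sum; apply: ler_prod => i _; rewrite l0 //=.
by apply: le_trans (expR_ge1Dx _); rewrite addrC subrK.
Qed.

Lemma gmM d n (L : 'M[C]_d) (X : 'M[C]_(d, n)) : gm (L *m X) = gm L * gm X.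
Proof.
apply: (@complexI R); rewrite rmorphM /= !gmC adjmxM !mulmxA -(mulmxA L X).
by rewrite !det_mulmx mulrAC.
Qed.

Lemma gm_diagr n (f : nat -> R) : gm (diagr n f) = \prod_(i < n) f i ^+ 2.
Proof.
rewrite /gm diagr_adj det_mulmx det_diagr -rmorphM /= -big_split /=.
by apply: eq_bigr => i _; rewrite expr2.
Qed.

(** An invertible [S] factors out, and the Gram matrix of [row_mx 1%:M Z] has eigenvalues [1 + l]
    with [l] nonnegative. *)
Lemma gm_row d n (S : 'M[C]_d) (X : 'M[C]_(d, n)) : gm S <= gm (row_mx S X).
Proof.
have [Su|Sn] := boolP (S \in unitmx); last first.
  rewrite {1}/gm det_mulmx; move: Sn; rewrite unitmxE unitfE negbK => /eqP ->.
  by rewrite mul0r gm_ge0.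
have -> : row_mx S X = S *m row_mx 1%:M (invmx S *m X).
  by rewrite mul_mx_row mulmx1 mulKVmx.
rewrite gmM ler_peMr ?gm_ge0 //; set Z := invmx S *m X.
have [l [_ l0 _ _ [U Uu ZE]]] := psd_spec Z.
have E : row_mx 1%:M Z *m (row_mx 1%:M Z)^t* =
    U^t* *m diagr d (nth 0 [seq 1 + nth 0 l i | i <- iota 0 d]) *m U.
  rewrite tr_row_mx map_col_mx mul_row_col adjmx1 mulmx1 ZE.
  have -> : diagr d (nth 0 [seq 1 + nth 0 l i | i <- iota 0 d]) =
      1%:M + diagr d (nth 0 l).
    apply/matrixP => i j; rewrite !mxE (nth_map 0%N) ?size_iota // nth_iota // add0n.
    by case: eqP => _; rewrite ?mulr1n ?mulr0n ?addr0 // rmorphD rmorph1.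
  rewrite mulmxDr mulmxDl mulmx1; congr (_ + _).
  by rewrite -invmx_unitary // mulVmx // unitarymx_unit.
rewrite (gm_prod Uu E); elim/big_ind: _ => // [x y x1 y1|i _].
  by rewrite -[1]mulr1 ler_pM.
by rewrite (nth_map 0%N) ?size_iota // nth_iota // add0n lerDl l0.
Qed.

(** One term of the Cauchy-Binet expansion is kept: the columns outside [codom f] form the second
    block in [gm_row]. *)
Lemma gram_lower d n (G : 'M[C]_(d, n)) (f : 'I_d -> 'I_n) (x : nat -> R) :
  injective f -> (forall i, 0 <= x i) ->
  gm (colsub f G) * \prod_(i < d) x (f i) ^+ 2 <= gm (G *m diagr n x).
Proof.
move=> fJ x0; pose xf := nth 0 [seq x (f i) | i <- enum 'I_d].
have xfE (i : 'I_d) : xf i = x (f i).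
  by rewrite /xf (nth_map i) ?size_enum_ord // nth_ord_enum.
pose y (j : nat) := if insub j is Some k then x j *+ (k \notin codom f) else 0.
have yE (j : 'I_n) : y j = x j *+ (j \notin codom f) by rewrite /y valK.
have -> : gm (colsub f G) * \prod_(i < d) x (f i) ^+ 2 = gm (colsub f G *m diagr d xf).
  by rewrite gmM gm_diagr; congr (_ * _); apply: eq_bigr => i _; rewrite xfE.
apply: le_trans (gm_row _ (G *m diagr n y)) _.
rewrite (@gm_gram _ _ _ _ (G *m diagr n x)) //.
rewrite tr_row_mx map_col_mx mul_row_col /diagr !mul_mx_diag.
apply/matrixP => a b; rewrite !mxE.
pose t (j : 'I_n) := G a j * (x j)%:C * (G b j * (x j)%:C)^*.
rewrite [RHS](eq_bigr t) => [|j _]; last by rewrite /t !mxE.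
rewrite [RHS](bigID (mem (codom f))) /=; congr (_ + _).
  transitivity (\sum_(i < d) t (f i)).
    by apply: eq_bigr => i _; rewrite !mxE xfE.
  rewrite -(big_imset t) /=; last by move=> i j _ _; apply: fJ.
  by apply: eq_bigl => j; apply/imsetP/codomP => [[i _ ->]|[i ->]]; exists i.
rewrite [RHS]big_mkcond /=; apply: eq_bigr => j _; rewrite !mxE yE.
case: (j \in codom f) => /=; last by rewrite mulr1n.
by rewrite mulr0n mulr0 mul0r.
Qed.

End GramDet.

(** * Balanced configurations of subspaces *)

Lemma telescope_from (R : pzRingType) (g : nat -> R) v N : (v <= N)%N ->
  \sum_(a < N) (v <= a)%N%:R * (g a - g a.+1) = g v - g N.
Proof.
elim: N => [|N IH]; first by rewrite leqn0 => /eqP ->; rewrite big_ord0 subrr.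
rewrite leq_eqVlt => /predU1P[->|]; last first.
  by rewrite ltnS => vN; rewrite big_ord_recr /= IH // vN mul1r addrA subrK.
by rewrite subrr big1 // => i _; rewrite leqNgt ltn_ord mul0r.
Qed.

Lemma ln_prod (R : realType) (I : Type) (r : seq I) (P : pred I) (f : I -> R) :
  (forall i, P i -> 0 < f i) -> ln (\prod_(i <- r | P i) f i) = \sum_(i <- r | P i) ln (f i).
Proof.
move=> f0; suff : 0 < \prod_(i <- r | P i) f i /\
  ln (\prod_(i <- r | P i) f i) = \sum_(i <- r | P i) ln (f i) by case.
elim/big_rec2: _ => [|i y x Pi [x0 <-]]; first by rewrite ln1.
by split; [rewrite mulr_gt0 ?f0 | rewrite lnM ?posrE ?f0].
Qed.

Section Balanced.
Variables (R : realType) (J : finType) (n' : nat).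
Local Notation n := n'.+1.
Local Notation C := R[i].
Variables (F : J -> 'M[C]_n) (c : J -> R) (W : R).
Local Open Scope sesquilinear_scope.
Local Open Scope classical_set_scope.
Local Open Scope complex_scope.

(** The weighted degree after Abel summation: [c] will be the drops of the weights and [W] the sum
    of the last weights. *)
Definition capdeg (V : 'M[C]_n) : R :=
  \sum_j c j * (\rank (V :&: F j)%MS)%:R + W * (\rank V)%:R.

Hypothesis c_ge0 : forall j, 0 <= c j.
Hypothesis stable : forall V : 'M[C]_n, (0 < \rank V < n)%N -> capdeg V < 0.
Hypothesis total : \sum_j c j * (\rank (F j))%:R + W * n%:R = 0.

(* A Kempf-Ness function: strict stability makes it proper modulo scaling, and
   its critical points are the balanced positions of the subspaces F j. *)
Definition energy (T : 'M[C]_n) : R :=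
  \sum_j c j * ln (gm (row_base (F j) *m T)) + W * ln (gm T).

Lemma gm_unitary (U : 'M[C]_n) : U \is unitarymx -> gm U = 1.
Proof. by move=> Uu; rewrite /gm (unitarymxP Uu) det1. Qed.

(** Normalized singular values in decreasing order: positive multiples do not change the energy, so
    the last one is set to 1. *)
Definition scaling (p : nat -> R) := [/\ forall i, 1 <= p i, forall i, p i.+1 <= p i &
  p n' = 1].

(** Half the guaranteed growth rate of the energy in [ln (p a) - ln (p a.+1)]; stability, applied to
    the span of the last rows of [u], makes it positive. *)
Definition drift (u : 'M[C]_n) a : R := - capdeg (copid_mx a.+1 *m u).

Lemma rank_copid_unit (u : 'M[C]_n) a : u \in unitmx -> (a <= n)%N ->
  \rank (copid_mx a *m u) = (n - a)%N.
Proof. by move=> uu an; rewrite mxrankMfree ?row_free_unit // rank_copid_mx. Qed.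

Lemma drift_gt0 u a : u \is unitarymx -> (a < n')%N -> 0 < drift u a.
Proof.
move=> uu an; rewrite oppr_gt0; apply: stable.
by rewrite rank_copid_unit ?unitarymx_unit //; lia.
Qed.

Lemma rank_leading d (B : 'M[C]_(d, n)) (u : 'M[C]_n) a : row_free B -> u \is unitarymx ->
  (\rank (B *m u^t* *m (pid_mx a : 'M[C]_n)) + \rank (copid_mx a *m u :&: B)%MS)%N = d.
Proof.
move=> Bf uu; have uK : u^t* *m u = 1%:M.
  by rewrite -invmx_unitary // mulVmx // unitarymx_unit.
have K : (kermx (u^t* *m (pid_mx a : 'M[C]_n)) :=: copid_mx a *m u)%MS.
  apply/eqmxP/andP; split; last first.
    rewrite sub_kermx mulmxA -(mulmxA _ u) (unitarymxP uu) mulmx1.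
    by rewrite /copid_mx mulmxBl mul1mx mul_pid_mx !minnn pid_mx_minv subrr.
  set Z := kermx _; have Z0 : Z *m u^t* *m (pid_mx a : 'M[C]_n) = 0.
    by rewrite -mulmxA mulmx_ker.
  have -> : Z = Z *m u^t* *m (copid_mx a *m u).
    rewrite /copid_mx mulmxBl mul1mx mulmxBr -(mulmxA Z) uK mulmx1.
    by rewrite mulmxA Z0 mul0mx subr0.
  exact: submxMl.
rewrite -mulmxA -[RHS](eqP Bf) -[RHS](mxrank_mul_ker B (u^t* *m (pid_mx a : 'M[C]_n))).
congr (_ + _)%N; rewrite capmxC; apply: eqmx_rank; apply/eqmxP.
exact: cap_eqmx (eqmx_refl _) (eqmx_sym K).
Qed.

(** In each Gram determinant only the minor at the pivots of [F j] relative to [u0] is kept. The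
    powers of [p] in it count pivots, hence ranks of intersections with the last rows of [u0], which
    assemble to [drift u0]. The pivots stay fixed as [u] varies, so the slopes are the same wherever
    these minors do not vanish. *)
Lemma energy_lower u0 : u0 \is unitarymx -> exists f : forall j, 'I_(\rank (F j)) -> 'I_n,
  (forall j, colsub (f j) (row_base (F j) *m u0^t*) \in unitmx) /\
  forall p u, scaling p -> u \is unitarymx ->
    (forall j, 0 < gm (colsub (f j) (row_base (F j) *m u^t*))) ->
    \sum_j c j * ln (gm (colsub (f j) (row_base (F j) *m u^t*))) +
      2 * \sum_(a < n') (ln (p a) - ln (p a.+1)) * drift u0 a <=
    energy (u^t* *m diagr n p).
Proof.
move=> u0u; pose G j := row_base (F j) *m u0^t*.
have Gf j : row_free (G j).
  have uf : row_free (u0^t*).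
    by rewrite row_free_unit; apply: unitarymx_unit; rewrite trmxC_unitary.
  by rewrite /row_free (mxrankMfree _ uf); apply: row_base_free.
have fex : forall j, exists f : 'I_(\rank (F j)) -> 'I_n,
  [/\ injective f, colsub f (G j) \in unitmx &
    forall a, (a <= n)%N -> \rank (G j *m (pid_mx a : 'M[C]_n)) = #|[pred i | (f i < a)%N]|].
  by move=> j; apply: pivot_columns.
pose f j := projT1 (cid (fex j)).
have fP j : [/\ injective (f j), colsub (f j) (G j) \in unitmx &
    forall a, (a <= n)%N -> \rank (G j *m (pid_mx a : 'M[C]_n)) =
      #|[pred i | (f j i < a)%N]|] := projT2 (cid (fex j)).
exists f; split=> [j|p u [p1 pS pn] uu ga0]; first by case: (fP j).
have p0 i : 0 < p i := lt_le_trans ltr01 (p1 i).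
have lnp v : (v <= n')%N ->
    ln (p v) = \sum_(a < n') (v <= a)%N%:R * (ln (p a) - ln (p a.+1)).
  by move=> vn; rewrite (telescope_from (fun a => ln (p a))) // pn ln1 subr0.
have term j : ln (gm (colsub (f j) (row_base (F j) *m u^t*))) +
    2 * \sum_(a < n') (ln (p a) - ln (p a.+1)) *
       ((\rank (F j))%:R - (\rank (copid_mx a.+1 *m u0 :&: F j)%MS)%:R) <=
    ln (gm (row_base (F j) *m (u^t* *m diagr n p))).
  have [fJ _ fr] := fP j; rewrite mulmxA.
  have pp : 0 < \prod_(i < \rank (F j)) p (f j i) ^+ 2.
    by rewrite prodr_gt0 // => i _; rewrite exprn_gt0.
  apply: le_trans (_ : ln (gm (colsub (f j) (row_base (F j) *m u^t*)) *
     \prod_(i < \rank (F j)) p (f j i) ^+ 2) <= _); last first.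
    have gl := gram_lower (row_base (F j) *m u^t*) fJ (fun i => ltW (p0 i)).
    by rewrite ler_ln ?posrE ?mulr_gt0 // (lt_le_trans _ gl) ?mulr_gt0.
  rewrite lnM ?posrE // lerD2l ln_prod => [|i _]; last by rewrite exprn_gt0.
  under [X in _ <= X]eq_bigr do rewrite lnXn // -mulr_natl lnp -1?ltnS //.
  rewrite -mulr_sumr ler_pM2l ?ltr0n // exchange_big /=.
  rewrite le_eqVlt; apply/predU1l; apply: eq_bigr => a _; rewrite -mulr_suml mulrC; congr (_ * _).
  have rl := rank_leading a.+1 (row_base_free (F j)) u0u.
  rewrite -/(G j) fr ?ltnS ?(ltnW (ltn_ord a)) // in rl.
  have -> : (\rank (F j))%:R = (#|[pred i | (f j i < a.+1)%N]| +
     \rank (copid_mx a.+1 *m u0 :&: row_base (F j))%MS)%:R :> R by rewrite rl.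
  have e : (copid_mx a.+1 *m u0 :&: row_base (F j) :=: copid_mx a.+1 *m u0 :&: F j)%MS.
    exact: cap_eqmx (eqmx_refl _) (eq_row_base _).
  rewrite e natrD addrK -sum1_card natr_sum big_mkcond /=.
  by apply: eq_bigr => i _; rewrite inE ltnS; case: ifP.
have gmT : gm (u^t* *m diagr n p) = \prod_(i < n) p i ^+ 2.
  have uu' : u^t* \is unitarymx by rewrite trmxC_unitary.
  by rewrite gmM (gm_unitary uu') mul1r gm_diagr.
have lnT : ln (gm (u^t* *m diagr n p)) =
    2 * \sum_(a < n') (ln (p a) - ln (p a.+1)) * a.+1%:R.
  rewrite gmT ln_prod => [|i _]; last by rewrite exprn_gt0.
  under eq_bigr do rewrite lnXn // -mulr_natl lnp -1?ltnS //.
  rewrite -mulr_sumr exchange_big /=; congr (_ * _); apply: eq_bigr => a _.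
  rewrite -mulr_suml mulrC; congr (_ * _).
  rewrite (eq_bigr (fun i : 'I_n => if (i < a.+1)%N then 1 else 0)); last first.
    by move=> i _; rewrite ltnS; case: (i <= a)%N.
  rewrite -big_mkcond /= -(big_ord_widen n (fun=> 1)) ?ltnS ?(ltnW (ltn_ord a)) //.
  by rewrite sumr_const card_ord.
rewrite /energy lnT; apply: le_trans (_ : \sum_j c j * (ln (gm (colsub (f j) (row_base (F j) *m u^t*))) +
    2 * \sum_(a < n') (ln (p a) - ln (p a.+1)) *
       ((\rank (F j))%:R - (\rank (copid_mx a.+1 *m u0 :&: F j)%MS)%:R)) +
    W * (2 * \sum_(a < n') (ln (p a) - ln (p a.+1)) * a.+1%:R) <= _); last first.
  by rewrite lerD2r; apply: ler_sum => j _; apply: ler_wpM2l.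
under [X in _ <= X + _]eq_bigr do rewrite mulrDr.
rewrite big_split /= -!addrA lerD2l.
have -> : \sum_j c j * (2 * \sum_(a < n') (ln (p a) - ln (p a.+1)) *
       ((\rank (F j))%:R - (\rank (copid_mx a.+1 *m u0 :&: F j)%MS)%:R)) =
    2 * \sum_(a < n') (ln (p a) - ln (p a.+1)) * \sum_j c j *
       ((\rank (F j))%:R - (\rank (copid_mx a.+1 *m u0 :&: F j)%MS)%:R).
  rewrite mulr_sumr; under [RHS]eq_bigr do rewrite !mulr_sumr.
  rewrite exchange_big; apply: eq_bigr => j _; rewrite !mulr_sumr.
  by apply: eq_bigr => a _; ring.
rewrite mulrCA -mulrDr ler_pM2l ?ltr0n // mulr_sumr -big_split /=.
apply: ler_sum => a _; rewrite mulrCA -mulrDr.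
suff -> : drift u0 a = \sum_j c j * ((\rank (F j))%:R -
   (\rank (copid_mx a.+1 *m u0 :&: F j)%MS)%:R) + W * a.+1%:R by [].
under eq_bigr do rewrite mulrBr.
rewrite sumrB /drift /capdeg rank_copid_unit ?unitarymx_unit //; last exact: ltnW (ltn_ord a).
have -> : (n - a.+1)%:R = n%:R - a.+1%:R :> R.
  by rewrite natrB //; exact: ltnW (ltn_ord a).
by move: total; set X := \sum_j _; set Y := \sum_j _ => E; move: E; lra.
Qed.

(** By contradiction: the unitary parts of a sequence of counterexamples tend to some [u0], near
    which the chosen minors stay above half their limits; [energy_lower] at [u0] then gives one
    positive slope for all these terms. *)
Lemma energy_coercive : exists2 K : R, 0 < K & forall p u, scaling p -> u \is unitarymx ->
  K^-1 * ln (p 0%N) - K <= energy (u^t* *m diagr n p).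
Proof.
apply: contrapT => nK.
have ex (k : nat) : exists pu : (nat -> R) * 'M[C]_n, [/\ scaling pu.1, pu.2 \is unitarymx &
    energy (pu.2^t* *m diagr n pu.1) < k.+1%:R^-1 * ln (pu.1 0%N) - k.+1%:R].
  apply: contrapT => nx; apply: nK; exists k.+1%:R => // p u sp uu.
  by rewrite leNgt; apply/negP => lt; apply: nx; exists (p, u).
have [s sP] := choice ex.
have [U [UU Uoo]] := ultra_nat.
have [|u0 u0u u0c] := @unitary_limit R U UU n (fun k => (s k).2).
  by move=> k; case: (sP k).
have [f [fu fE]] := energy_lower u0u.
pose g j (u : 'M[C]_n) := gm (colsub (f j) (row_base (F j) *m u^t*)).
have gc j : g j (s k).2 @[k --> U] --> g j u0.
  have h : mcvg U (fun k => colsub (f j) (row_base (F j) *m (s k).2^t*))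
      (colsub (f j) (row_base (F j) *m u0^t*)).
    move=> a b; rewrite mxE (_ : (fun k => _) = (fun k => (row_base (F j) *m (s k).2^t*) a (f j b))).
      exact: (mcvgM UU (mcvg_cst UU (row_base (F j))) (mcvg_adj UU u0c) a (f j b)).
    by apply/funext => k; rewrite mxE.
  by case: (ccvg_det UU (mcvgM UU h (mcvg_adj UU h))).
have g0 j : 0 < g j u0 by apply: gm_gt0; rewrite row_free_unit fu.
pose C0 := \sum_j c j * ln (g j u0 / 2).
have near_g : U [set k | forall j, g j u0 / 2 < g j (s k).2].
  apply: filter_forall => j; apply: (ucvg_gt UU (gc j)); have := g0 j; lra.
have [de de0 deP] : exists2 de : R, 0 < de & forall a, (a < n')%N -> de <= 2 * drift u0 a.
  case: (pickP (fun a : 'I_n' => true)) => [a0 _|h].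
    have := @arg_minP _ _ _ a0 xpredT (fun a : 'I_n' => drift u0 a) isT.
    case=> a _ amin; exists (2 * drift u0 a).
      by rewrite mulr_gt0 ?ltr0n // drift_gt0.
    by move=> b bn; rewrite ler_pM2l ?ltr0n //; apply: (amin (Ordinal bn)).
  by exists 1 => // a an; have := h (Ordinal an).
(* Beyond [N], the slope [k.+1%:R^-1] is below [de] and the constant [- k.+1%:R] is below [C0],
   against the choice of the sequence. *)
pose N := Num.bound (Num.max de^-1 (- C0)).
have /filter_ex[k [kg kN]] : U ([set k | forall j, g j u0 / 2 < g j (s k).2] `&`
    [set k | (N <= k)%N]).
  by apply: filterI => //; apply: ultra_large.
have [sp uu lt] := sP k.
have gk j : 0 < g j (s k).2 by apply: lt_trans (kg j); rewrite divr_gt0.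
have := fE _ _ sp uu gk; apply/negP; rewrite -ltNge; apply: lt_le_trans lt _.
have [p1 pS pn] := sp; set p := (s k).1 in p1 pS pn *.
have p0 i : 0 < p i := lt_le_trans ltr01 (p1 i).
have l1 : C0 <= \sum_j c j * ln (g j (s k).2).
  apply: ler_sum => j _; apply: ler_wpM2l => //.
  by rewrite ler_ln ?posrE ?divr_gt0 // ltW.
have l2 : de * ln (p 0%N) <= 2 * \sum_(a < n') (ln (p a) - ln (p a.+1)) * drift u0 a.
  have -> : ln (p 0%N) = \sum_(a < n') (0 <= a)%N%:R * (ln (p a) - ln (p a.+1)).
    by rewrite (telescope_from (fun a => ln (p a))) // pn ln1 subr0.
  rewrite !mulr_sumr; apply: ler_sum => a _; rewrite mul1r mulrC mulrCA.
  apply: ler_wpM2l; last by apply: deP.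
  by rewrite subr_ge0 ler_ln ?posrE.
have Nk : Num.max de^-1 (- C0) < k.+1%:R.
  apply: lt_le_trans (_ : N%:R <= _); last by rewrite ler_nat; apply: leqW.
  by apply: archi_boundP; rewrite le_max invr_ge0 (ltW de0).
have [N1 N2] : de^-1 < k.+1%:R /\ - C0 < k.+1%:R.
  by move: Nk; rewrite gt_max => /andP.
have l3 : k.+1%:R^-1 * ln (p 0%N) <= de * ln (p 0%N).
  apply: ler_wpM2r; first by apply: ln_ge0.
  by rewrite invf_ple ?posrE // ltW.
apply: (le_trans _ (lerD l1 l2)); move: l3 N2; set z := ln _; set y := _^-1 * z; lra.
Qed.

Lemma gm_mul_gram d (B : 'M[C]_(d, n)) (T T' : 'M[C]_n) :
  T *m T^t* = T' *m T'^t* -> gm (B *m T) = gm (B *m T').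
Proof.
move=> e; apply: gm_gram; rewrite (adjmxM B T) (adjmxM B T').
by rewrite -(mulmxA B) (mulmxA T) e -(mulmxA B) (mulmxA T').
Qed.

Lemma energy_gram (T T' : 'M[C]_n) : T *m T^t* = T' *m T'^t* -> energy T = energy T'.
Proof.
move=> e; apply: congr2; last by apply: congr1; apply: congr1; apply: gm_gram.
by apply: eq_bigr => j _; apply: congr1; apply: congr1; apply: gm_mul_gram.
Qed.

Lemma gm_scale d (a : R) (X : 'M[C]_(d, n)) : gm (a%:C *: X) = a ^+ (2 * d) * gm X.
Proof.
have -> : a%:C *: X = diagr d (fun=> a) *m X.
  rewrite /diagr mul_diag_mx; apply/matrixP => i j; by rewrite !mxE.
by rewrite gmM gm_diagr prodr_const card_ord -exprM.
Qed.

Lemma row_free_baseM j (T : 'M[C]_n) : T \in unitmx -> row_free (row_base (F j) *m T).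
Proof.
move=> Tu; have uf : row_free T by rewrite row_free_unit.
by rewrite /row_free (mxrankMfree _ uf); apply: row_base_free.
Qed.

Lemma energy_scale (a : R) (T : 'M[C]_n) : 0 < a -> T \in unitmx ->
  energy (a%:C *: T) = energy T.
Proof.
move=> a0 Tu; have lnE d (X : 'M[C]_(d, n)) : row_free X ->
    ln (gm (a%:C *: X)) = 2 * ln a * d%:R + ln (gm X).
  move=> Xf; rewrite gm_scale lnM ?posrE ?exprn_gt0 ?gm_gt0 // lnXn //.
  by rewrite -[X in X + _]mulr_natl natrM; congr (_ + _); ring.
have Tf : row_free T := etrans (row_free_unit T) Tu.
have hj j : c j * ln (gm (row_base (F j) *m (a%:C *: T))) =
    c j * (2 * ln a * (\rank (F j))%:R) + c j * ln (gm (row_base (F j) *m T)).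
  by rewrite -scalemxAr (lnE _ _ (row_free_baseM j Tu)) mulrDr.
transitivity (\sum_j (c j * (2 * ln a * (\rank (F j))%:R) + c j * ln (gm (row_base (F j) *m T)))
    + W * (2 * ln a * n%:R + ln (gm T))).
  apply: congr2; first by apply: eq_bigr => j _; apply: hj.
  by apply: congr1; apply: lnE.
rewrite /energy big_split /= mulrDr addrACA -[RHS]add0r; congr (_ + _).
transitivity (2 * ln a * (\sum_j c j * (\rank (F j))%:R + W * n%:R)).
  by rewrite mulrDr mulr_sumr; congr (_ + _); [apply: eq_bigr => j _|]; ring.
by rewrite total mulr0.
Qed.

(** The energy depends on [T] only through [T *m T^t*], whose spectral decomposition supplies [u]
    and the squared singular values. *)
Lemma energy_normal_form (T : 'M[C]_n) : T \in unitmx -> exists p u,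
  [/\ scaling p, u \is unitarymx & energy T = energy (u^t* *m diagr n p)].
Proof.
move=> Tu; have [l [sz _ l0 sl [u uu TE]]] := psd_spec T.
have lp i : (i < n)%N -> 0 < nth 0 l i by apply: l0; rewrite row_free_unit.
pose x i := nth 0 l (minn i n').
have xp i : 0 < x i by apply: lp; rewrite ltnS geq_minr.
pose a := Num.sqrt (x n'); have a0 : 0 < a by rewrite sqrtr_gt0.
pose p i := Num.sqrt (x i) / a.
have xS i : x i.+1 <= x i.
  apply: (sorted_leq_nth _ _ 0 sl).
  - by move=> y1 y2 y3 h1 h2; apply: le_trans h2 h1.
  - by move=> y; apply: lexx.
  - by rewrite inE sz ltnS geq_minr.
  - by rewrite inE sz ltnS geq_minr.
  - lia.
have xn i : x n' <= x i.
  rewrite /x minnn; apply: (sorted_leq_nth _ _ 0 sl).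
  - by move=> y1 y2 y3 h1 h2; apply: le_trans h2 h1.
  - by move=> y; apply: lexx.
  - by rewrite inE sz ltnS geq_minr.
  - by rewrite inE sz.
  - exact: geq_minr.
exists p, u; split; [|exact: uu|].
  split=> [i|i|]; rewrite /p.
  - by rewrite ler_pdivlMr // mul1r ler_wsqrtr.
  - by rewrite ler_pM2r ?invr_gt0 // ler_wsqrtr.
  - by rewrite divff // gt_eqF.
have aTu : u^t* *m diagr n p \in unitmx.
  have uu' : u^t* \in unitmx by apply: unitarymx_unit; rewrite trmxC_unitary.
  rewrite unitmx_mul uu' /= unitmxE det_diagr unitfE.
  rewrite (inj_eq (@complexI R) _ 0); apply/prodf_neq0 => i _.
  by rewrite gt_eqF // divr_gt0 // sqrtr_gt0.
rewrite -(energy_scale a0 aTu); apply: energy_gram; rewrite TE.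
have -> : a%:C *: (u^t* *m diagr n p) = u^t* *m diagr n (fun i => Num.sqrt (x i)).
  rewrite scalemxAr; congr (_ *m _); apply/matrixP => i j; rewrite !mxE.
  rewrite mulrnAr -rmorphM /= /p mulrC divfK //; last by rewrite gt_eqF.
pose D : 'M[C]_n := diagr n (fun i => Num.sqrt (x i)); rewrite -/D.
have DD : D *m D = diagr n (nth 0 l).
  rewrite /D /diagr mul_diag_mx; apply/matrixP => i j; rewrite !mxE.
  rewrite mulrnAr -rmorphM /= -expr2 sqr_sqrtr; last exact: ltW.
  by rewrite /x (minn_idPl _) // -ltnS.
have E0 : (u^t* *m D)^t* = D *m u by rewrite adjmxM trmxCK diagr_adj.
by rewrite E0 (mulmxA _ D u) -(mulmxA (u^t*) D D) DD.
Qed.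

Lemma cvg_sum_seq (G : set_system nat) (FG : Filter G) (r : seq J) (f : J -> nat -> R)
  (l : J -> R) : (forall j, f j k @[k --> G] --> l j) ->
  \sum_(j <- r) f j k @[k --> G] --> \sum_(j <- r) l j.
Proof.
move=> fl; elim: r => [|j r IH].
  have e : (fun k => \sum_(j <- [::]) f j k) = cst 0.
    by apply/funext => k; rewrite big_nil.
  by rewrite e big_nil; apply: cvg_cst.
have e : (fun k => \sum_(j <- j :: r) f j k) = f j \+ (fun k => \sum_(j <- r) f j k).
  by apply/funext => k; rewrite big_cons.
by rewrite e big_cons; apply: cvgD.
Qed.

(** Coercivity bounds [p] along a minimizing sequence in normal form. The limit is invertible
    because every [p i] is at least 1, and the energy is continuous there. *)
Lemma energy_min : exists2 T0 : 'M[C]_n, T0 \in unitmx &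
  forall T, T \in unitmx -> energy T0 <= energy T.
Proof.
have [K K0 KP] := energy_coercive.
pose E : set R := [set e | exists p u, [/\ scaling p, u \is unitarymx &
  e = energy (u^t* *m diagr n p)]].
have p1s : scaling (fun=> 1) by split.
have E0 : E !=set0.
  exists (energy (1%:M^t* *m diagr n (fun=> 1))); exists (fun=> 1), 1%:M; split=> //.
  by apply/unitarymxP; rewrite adjmx1 mulmx1.
have Elb : has_lbound E.
  exists (- K) => _ [p [u [sp uu ->]]]; apply: le_trans (KP p u sp uu).
  by rewrite lerDr mulr_ge0 ?invr_ge0 ?(ltW K0) // ln_ge0 //; case: sp.
have ex (k : nat) : exists pu : (nat -> R) * 'M[C]_n, [/\ scaling pu.1, pu.2 \is unitarymx &
    energy (pu.2^t* *m diagr n pu.1) < inf E + k.+1%:R^-1].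
  have [||_ [p [u [sp uu ->]]] lt] := @inf_adherent R E k.+1%:R^-1.
  - by rewrite invr_gt0.
  - by split.
  by exists (p, u).
have [s sP] := choice ex.
have [U [UU Uoo]] := ultra_nat.
have [|u0 u0u u0c] := @unitary_limit R U UU n (fun k => (s k).2).
  by move=> k; case: (sP k).
(* The coercive bound solved for [p 0], with energies at most [inf E + 1]. *)
pose M := expR (K * (inf E + 1 + K)).
have pM k i : 1 <= (s k).1 i <= M.
  have [sp uu lt] := sP k; have [p1 pS pn] := sp; rewrite p1 /=.
  have p0 : 0 < (s k).1 0%N := lt_le_trans ltr01 (p1 _).
  apply: le_trans (_ : (s k).1 0%N <= _).
    by elim: i => // i IH; apply: le_trans (pS i) IH.
  rewrite -[X in X <= _](lnK p0) ler_expR.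
  have := KP _ _ sp uu; rewrite lerBlDr => h.
  rewrite -ler_pdivrMl //; apply: le_trans h _; rewrite lerD2r.
  apply: ltW; apply: lt_le_trans lt _.
  by rewrite lerD2l invf_le1 ?ler1n.
have pex i : exists l : R, 1 <= l <= M /\ ((s k).1 i @[k --> U] --> l).
  by apply: ucvg_bounded => k; apply: pM.
have [p pP] := choice pex.
have sp : scaling p.
  split=> [i|i|].
  - by case: (pP i) => /andP[].
  - have [_ h1] := pP i; have [_ h2] := pP i.+1.
    apply: ler_cvg_to h2 h1 _; apply: filterE => k.
    by case: (sP k) => [[_ h3 _] _ _]; apply: h3.
  - have [_ h] := pP n'; apply: (ucvg_unique UU h).
    rewrite (_ : (fun k => _) = (fun=> 1)); first exact: cvg_cst.
    by apply/funext => k; case: (sP k) => [[]].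
have pp i : 0 < p i by apply: lt_le_trans ltr01 _; case: sp.
pose T0 := u0^t* *m diagr n p.
have T0u : T0 \in unitmx.
  have uu' : u0^t* \in unitmx by apply: unitarymx_unit; rewrite trmxC_unitary.
  rewrite unitmx_mul uu' /= unitmxE det_diagr unitfE.
  by rewrite (inj_eq (@complexI R) _ 0); apply/prodf_neq0 => i _; rewrite gt_eqF.
have Tc : mcvg U (fun k => (s k).2^t* *m diagr n (s k).1) T0.
  apply: mcvgM; first exact: mcvg_adj.
  by apply: mcvg_diagr => i _; case: (pP i).
have lnc d (B : 'M[C]_(d, n)) : row_free (B *m T0) ->
    ln (gm (B *m ((s k).2^t* *m diagr n (s k).1))) @[k --> U] --> ln (gm (B *m T0)).
  move=> Bf; apply: continuous_cvg; first by apply: continuous_ln; apply: gm_gt0.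
  have h := mcvgM UU (mcvg_cst UU B) Tc.
  by case: (ccvg_det UU (mcvgM UU h (mcvg_adj UU h))).
have ec : energy ((s k).2^t* *m diagr n (s k).1) @[k --> U] --> energy T0.
  apply: cvgD.
    apply: (@cvg_sum_seq U) => j; apply: cvgM; first exact: cvg_cst.
    by apply: lnc; apply: row_free_baseM.
  apply: cvgM; first exact: cvg_cst.
  rewrite -[T0]mul1mx (_ : (fun k => _) =
    (fun k => ln (gm (1%:M *m ((s k).2^t* *m diagr n (s k).1))))).
    by apply: lnc; rewrite mul1mx row_free_unit.
  by apply/funext => k; rewrite mul1mx.
have e_inf : energy T0 <= inf E.
  apply/ler_addgt0Pr => e e0.
  have cc : (fun _ : nat => inf E + e) @ U --> inf E + e by apply: cvg_cst.
  apply: ler_cvg_to ec cc _.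
  have [N Ne] : exists N : nat, e^-1 < N%:R.
    by exists (Num.bound e^-1); apply: archi_boundP; rewrite invr_ge0 ltW.
  apply: filterS (ultra_large Uoo N) => k /= Nk; have [_ _ lt] := sP k.
  apply: ltW; apply: lt_le_trans lt _; rewrite lerD2l.
  rewrite invf_ple ?posrE // ltW // (lt_le_trans Ne) // ler_nat; exact: leqW.
exists T0; first exact: T0u.
move=> T Tu; apply: le_trans e_inf _.
have [q [u [sq uu ->]]] := energy_normal_form Tu.
by apply: ge_inf => //; exists q, u.
Qed.

Lemma ln1D_ge (x : R) : `|x| <= 1 / 2 -> x - 2 * x ^+ 2 <= ln (1 + x).
Proof.
move=> hx; have [h1 h2] : -(1/2) <= x /\ x <= 1/2 by move: hx; rewrite ler_norml => /andP.
have x1 : 0 < 1 + x by lra.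
have iv : (1 + x) * (1 + x)^-1 = 1 by rewrite divff // gt_eqF.
have y0 : 0 < (1 + x)^-1 by rewrite invr_gt0.
have := @le_ln1Dx R ((1 + x)^-1 - 1); rewrite subrKC lnV ?posrE // => h.
have {}h : 1 - (1 + x)^-1 <= ln (1 + x) by have := h ltac:(lra); lra.
apply: le_trans h; move: ((1 + x)^-1) iv y0 => y iv y0.
have y2 : y <= 2 by nra.
have -> : 1 - y = x - x ^+ 2 * y by nra.
by have := sqr_ge0 x; nra.
Qed.

Definition projF (T : 'M[C]_n) j : 'M[C]_n :=
  (schmidt (row_base (F j) *m T))^t* *m schmidt (row_base (F j) *m T).

Lemma adjmx_realZ d d' (a : R) (X : 'M[C]_(d, d')) : (a%:C *: X)^t* = a%:C *: X^t*.
Proof. by apply/matrixP => i k; rewrite !mxE rmorphM; congr (_ * _); exact: conjc_real. Qed.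

Lemma adjmx_sum d d' (X : J -> 'M[C]_(d, d')) : (\sum_j X j)^t* = \sum_j (X j)^t*.
Proof.
apply: (big_morph (fun Z : 'M[C]_(d, d') => Z^t*)); first exact: adjmxD.
by rewrite trmx0 map_mx0.
Qed.

Lemma W_le0 : W <= 0.
Proof.
have : 0 <= \sum_j c j * (\rank (F j))%:R by apply: sumr_ge0 => j _; rewrite mulr_ge0.
move: total; set X := \sum_j _ => e X0.
have : W * n%:R <= 0 by lra.
by rewrite pmulr_lle0 ?ltr0n.
Qed.

Lemma Re_scale_tr (a : R) d (X : 'M[C]_d) :
  complex.Re (\tr (a%:C *: X)) = a * complex.Re (\tr X).
Proof. by rewrite mxtraceZ Re_realM. Qed.

(** [A] plays the role of the gradient. Replacing [T] by [T *m Y] with [Y *m Y^t* = 1 - e A] lowers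
    the terms of the [F j] by at least [e tr (A^2)], with no second-order loss by [gm_le_exp]. In
    the term of [W] the first order vanishes since [tr A = 0], and the loss is at most
    [2 |W| e^2 tr (A^2)]. *)
Lemma min_balanced (T : 'M[C]_n) : T \in unitmx ->
  (forall T', T' \in unitmx -> energy T <= energy T') ->
  \sum_j (c j)%:C *: projF T j + (W%:C)%:M = 0.
Proof.
move=> Tu Tmin; pose Q j := schmidt (row_base (F j) *m T).
have QQ j : Q j *m (Q j)^t* = 1%:M.
  by apply/unitarymxP/schmidt_unitarymx; rewrite rank_leq_col.
have eQ j : (Q j :=: row_base (F j) *m T)%MS.
  by apply: eqmx_schmidt_free; apply: row_free_baseM.
have Lex j : exists L, row_base (F j) *m T = L *m Q j.
  by apply/submxP; rewrite eQ.
pose L j := projT1 (cid (Lex j)).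
have LE j : row_base (F j) *m T = L j *m Q j := projT2 (cid (Lex j)).
set A := _ + _; apply/eqP/negP => /negP An0.
have hA : A \is hermsymmx.
  apply/hermP; rewrite /A adjmxD adjmx_sum; congr (_ + _).
    by apply: eq_bigr => j _; rewrite adjmx_realZ adjmxM trmxCK.
  by rewrite -[X in X^t*]scalemx1 adjmx_realZ adjmx1 scalemx1.
have [l [sz _ [U Uu AE]]] := herm_spec hA.
pose S2 := \sum_(i < n) nth 0 l i ^+ 2.
have S2_gt0 : 0 < S2.
  rewrite lt0r sumr_ge0 ?andbT => [|i _]; last exact: sqr_ge0.
  apply: contraNN An0 => /eqP S0; rewrite AE (_ : diagr n _ = 0) ?mulmx0 ?mul0mx //.
  have l0 (i : 'I_n) : nth 0 l i = 0.
    have := psumr_eq0P (fun (i : 'I_n) _ => sqr_ge0 (nth 0 l i)) S0 (i := i) isT.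
    by move=> /eqP; rewrite sqrf_eq0 => /eqP.
  by apply/matrixP => i k; rewrite !mxE l0 mul0rn.
have tA : \tr A = 0.
  rewrite /A linearD /= raddf_sum /= mxtrace_scalar.
  under eq_bigr do rewrite mxtraceZ mxtrace_mulC -/(Q _) QQ mxtrace1 -(rmorph_nat (real_complex R)) -rmorphM.
  by rewrite -raddfMn -rmorph_sum -rmorphD /= -mulr_natr total.
have tl : \sum_(i < n) nth 0 l i = 0.
  by apply: (@complexI R); rewrite -tr_diagr -(mxtrace_unitary_conj _ Uu) -AE.
have QAQ : \sum_j c j * complex.Re (\tr (Q j *m A *m (Q j)^t*)) = S2.
  transitivity (complex.Re (\tr (A *m A))).
    rewrite {3}/A mulmxDr mulmx_sumr linearD /= mul_mx_scalar mxtraceZ tA mulr0 addr0.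
    rewrite [\tr _](raddf_sum (@mxtrace C n)) Re_sum; apply: eq_bigr => j _.
    rewrite -scalemxAr Re_scale_tr /projF -/(Q j); congr (_ * complex.Re _).
    by rewrite -mulmxA mxtrace_mulC mulmxA.
  suff -> : A *m A = U^t* *m diagr n (fun i => nth 0 l i ^+ 2) *m U.
    by rewrite mxtrace_unitary_conj // tr_diagr.
  rewrite AE !mulmxA -(mulmxA _ U) (unitarymxP Uu) mulmx1 -!mulmxA; congr (_ *m _).
  rewrite mulmxA; congr (_ *m _); rewrite /diagr mul_diag_mx; apply/matrixP => i k.
  by rewrite !mxE mulrnAr -rmorphM /= -expr2.
(* With [e = 1 / (2 m)], every [e * l i] is within the range of [ln1D_ge], and [2 |W| e < 1]. *)
pose m := \sum_(i < n) `|nth 0 l i| + 2 * `|W| + 1.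
have m0 : 0 < m by rewrite ltr_wpDl // addr_ge0 ?mulr_ge0 // sumr_ge0.
pose e : R := (2 * m)^-1; have e0 : 0 < e by rewrite invr_gt0 mulr_gt0.
have em : e * m = 1 / 2.
  by rewrite /e invfM -mulrA mulVf ?mulr1 ?div1r // gt_eqF.
have el (i : 'I_n) : `|- (e * nth 0 l i)| <= 1 / 2.
  rewrite normrN normrM gtr0_norm // -em ler_pM2l // /m (bigD1 i) //= -!addrA lerDl.
  by rewrite !addr_ge0 ?mulr_ge0 // sumr_ge0.
have p0 i : 0 < 1 - e * nth 0 l i.
  have [ni|ni] := ltnP i n; last by rewrite nth_default ?sz // mulr0 subr0.
  by have := el (Ordinal ni); rewrite ler_norml /= => /andP[]; lra.
pose Y := U^t* *m diagr n (fun i => Num.sqrt (1 - e * nth 0 l i)).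
have YY : Y *m Y^t* = 1%:M - e%:C *: A.
  have dd : diagr n (fun i => Num.sqrt (1 - e * nth 0 l i)) *m
      diagr n (fun i => Num.sqrt (1 - e * nth 0 l i)) = 1%:M - e%:C *: diagr n (nth 0 l).
    rewrite /diagr mul_diag_mx; apply/matrixP => i k; rewrite !mxE.
    rewrite mulrnAr -rmorphM /= -expr2 sqr_sqrtr ?ltW //.
    rewrite rmorphB rmorph1 rmorphM /=; case: (i == k); rewrite ?mulr1n ?mulr0n //.
    by rewrite mulr0 subr0.
  rewrite adjmxM trmxCK diagr_adj mulmxA -(mulmxA (U^t*)) dd.
  rewrite mulmxBr mulmxBl mulmx1 -scalemxAr -scalemxAl -AE; congr (_ - _).
  by rewrite -invmx_unitary // mulVmx // unitarymx_unit.
have Yg : gm Y = \prod_(i < n) (1 - e * nth 0 l i).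
  rewrite gmM gm_unitary ?mul1r ?trmxC_unitary // gm_diagr.
  by apply: eq_bigr => i _; rewrite sqr_sqrtr // ltW.
have Yg0 : 0 < gm Y by rewrite Yg prodr_gt0.
have Yu : Y \in unitmx.
  rewrite unitmxE unitfE; apply: contraL Yg0 => /eqP dY.
  by rewrite /gm det_mulmx dY mul0r /= ltxx.
have TYu : T *m Y \in unitmx by rewrite unitmx_mul Tu.
have := Tmin _ TYu; apply/negP; rewrite -ltNge.
have gT : 0 < gm T by apply: gm_gt0; rewrite row_free_unit.
have lnj j : ln (gm (row_base (F j) *m (T *m Y))) <=
   ln (gm (row_base (F j) *m T)) - e * complex.Re (\tr (Q j *m A *m (Q j)^t*)).
  have Qf : row_free (Q j) by rewrite /row_free eQ; apply: row_free_baseM.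
  have QYf : row_free (Q j *m Y).
    have uf : row_free Y := etrans (row_free_unit Y) Yu.
    by rewrite /row_free (mxrankMfree _ uf).
  have gK : gm (row_base (F j) *m T) = gm (L j).
    by rewrite LE gmM [X in _ * X]/gm QQ det1 mulr1.
  have gL : 0 < gm (L j) by rewrite -gK; apply: gm_gt0; apply: row_free_baseM.
  rewrite gK mulmxA LE -(mulmxA (L j)) gmM (@lnM R (gm (L j)) (gm (Q j *m Y))) ?posrE ?(gm_gt0 QYf) //; rewrite lerD2l.
  have h := gm_le_exp (Q j *m Y); rewrite -[X in _ <= X]expRK ler_ln ?posrE ?expR_gt0 ?gm_gt0 //.
  apply: le_trans h _; rewrite ler_expR adjmxM mulmxA -(mulmxA (Q j) Y) YY.
  rewrite mulmxBr mulmx1 mulmxBl QQ -scalemxAr -scalemxAl linearB /= mxtrace1.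
  have ReB (x y : C) : complex.Re (x - y) = complex.Re x - complex.Re y by case: x; case: y.
  by rewrite ReB Re_nat Re_scale_tr; move: (_ * complex.Re _) => y; lra.
have lnW : W * ln (gm (T *m Y)) <= W * ln (gm T) - 2 * W * e ^+ 2 * S2.
  rewrite gmM lnM ?posrE // mulrDr lerD2l.
  have : - 2 * e ^+ 2 * S2 <= ln (gm Y).
    rewrite Yg ln_prod // /S2.
    have -> : - 2 * e ^+ 2 * (\sum_(i < n) nth 0 l i ^+ 2) =
       \sum_(i < n) (- (e * nth 0 l i) - 2 * (- (e * nth 0 l i)) ^+ 2).
      rewrite big_split /= sumrN -mulr_sumr tl mulr0 oppr0 add0r mulr_sumr.
      by apply: eq_bigr => i _; ring.
    by apply: ler_sum => i _; apply: ln1D_ge.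
  move=> h; have := W_le0; move: (ln _) h => y h W0.
  apply: le_trans (ler_wnM2l W0 h) _; rewrite le_eqVlt; apply/predU1l; ring.
have eW : 2 * `|W| * e < 1.
  apply: le_lt_trans (_ : e * m < 1); last by rewrite em; lra.
  have S0 : 0 <= \sum_(i < n) `|nth 0 l i| by apply: sumr_ge0.
  by rewrite mulrC ler_pM2l // /m; lra.
rewrite ler0_norm ?W_le0 // in eW.
apply: le_lt_trans (_ : energy T - e * S2 - 2 * W * e ^+ 2 * S2 < _); last first.
  have : 0 < e * S2 by rewrite mulr_gt0.
  by move=> h; have := eW; rewrite -(ltr_pM2r h); lra.
have sumj : \sum_j c j * ln (gm (row_base (F j) *m (T *m Y))) <=
    \sum_j c j * ln (gm (row_base (F j) *m T)) - e * S2.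
  rewrite -QAQ mulr_sumr -sumrB; apply: ler_sum => j _; rewrite mulrCA -mulrBr.
  by apply: ler_wpM2l.
apply: le_trans (lerD sumj lnW) _; rewrite /energy le_eqVlt; apply/predU1l; ring.
Qed.

Lemma stable_balanced : exists2 T : 'M[C]_n, T \in unitmx &
  \sum_j (c j)%:C *: projF T j + (W%:C)%:M = 0.
Proof. by have [T Tu Tm] := energy_min; exists T => //; apply: min_balanced. Qed.

End Balanced.

(** * Characteristic polynomials of combinations of orthogonal idempotents *)

Lemma abel_sum (R : pzRingType) (f g : nat -> R) m : g 0 = 0 ->
  \sum_(i < m.+1) f i * (g i.+1 - g i) =
  \sum_(i < m) (f i - f i.+1) * g i.+1 + f m * g m.+1.
Proof.
move=> g0; elim: m => [|m IH]; first by rewrite big_ord1 big_ord0 g0 subr0 add0r.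
by rewrite big_ord_recr /= IH big_ord_recr /= mulrBl mulrBr -!addrA; congr (_ + (_ + _)); rewrite addrC.
Qed.

(** The two sides are the determinants of the products of the same two block matrices in opposite
    orders. *)
Lemma det_sylvester (K : comPzRingType) n r (L : 'M[K]_(n, r)) (M : 'M[K]_(r, n)) :
  \det (1%:M + L *m M) = \det (1%:M + M *m L).
Proof.
have e1 : block_mx 1%:M (- L) M 1%:M *m block_mx 1%:M L 0 1%:M =
    block_mx 1%:M 0 M (1%:M + M *m L).
  rewrite mulmx_block !mulmx1 !mulmx0 !mul1mx !addr0.
  by congr block_mx; [rewrite subrr | rewrite addrC].
have e2 : block_mx 1%:M L 0 1%:M *m block_mx 1%:M (- L) M 1%:M =
    block_mx (1%:M + L *m M) 0 M 1%:M.
  rewrite mulmx_block !mulmx1 !mul0mx !mul1mx !add0r.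
  by congr block_mx; rewrite addrC subrr.
have := congr1 determinant e1; have := congr1 determinant e2.
by rewrite !det_mulmx !det_lblock !det_ublock !det1 !mulr1 !mul1r => -> ->.
Qed.

Lemma idempotent_factor (K : fieldType) n (E : 'M[K]_n) : E *m E = E ->
  exists L : 'M[K]_(n, \rank E), exists2 M, E = L *m M & M *m L = 1%:M.
Proof.
move=> EE; exists (col_base E), (row_base E); first by rewrite mulmx_base.
move: (row_base_free E) (col_base_full E) (mulmx_base E).
move: (row_base E) (col_base E) => B A Bf Af AB.
have h : A *m B *m A *m B = E by rewrite AB -mulmxA AB.
by apply: (row_free_inj Bf); apply: (row_full_inj Af); rewrite mul1mx !mulmxA h.
Qed.

Lemma mxtrace_idempotent (K : fieldType) n (E : 'M[K]_n) : E *m E = E ->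
  \tr E = (\rank E)%:R.
Proof.
by move=> /idempotent_factor[L [M EL ML]]; rewrite {1}EL mxtrace_mulC ML mxtrace1.
Qed.

Lemma det_idempotent (K : fieldType) n (E : 'M[K]_n) (a : {poly K}) : E *m E = E ->
  \det (1%:M + (a - 1) *: map_mx polyC E) = a ^+ \rank E.
Proof.
move=> /idempotent_factor[L [M EL ML]].
rewrite {1}EL map_mxM scalemxAl det_sylvester -scalemxAr -map_mxM ML map_mx1.
rewrite scalemx1 -raddfD /= subrKC.
by rewrite det_scalar.
Qed.

(** As the idempotents annihilate each other, the characteristic matrix is the product of the
    factors [1 + (a i - 1) D i], each of determinant [a i] to the power of its rank. *)
Lemma char_poly_idempotents (K : fieldType) n m (E : nat -> 'M[K]_n) (w : nat -> K) :
  (forall i j, (i < m)%N -> (j < m)%N -> E i *m E j = if i == j then E i else 0) ->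
  \sum_(i < m) E i = 1%:M ->
  char_poly (\sum_(i < m) w i *: E i) = \prod_(i < m) ('X - (w i)%:P) ^+ \rank (E i).
Proof.
move=> EE E1; pose D i := map_mx polyC (E i).
have DD i j : (i < m)%N -> (j < m)%N -> D i *m D j = if i == j then D i else 0.
  by move=> im jm; rewrite -map_mxM EE //; case: ifP => // _; rewrite map_mx0.
pose a i : {poly K} := 'X - (w i)%:P.
have pr k : (k <= m)%N -> \prod_(i < k) \det (1%:M + (a i - 1) *: D i) =
    \det (1%:M + \sum_(i < k) (a i - 1) *: D i).
  elim: k => [|k IH] km; first by rewrite !big_ord0 addr0 det1.
  rewrite !big_ord_recr /= IH 1?ltnW // -det_mulmx; congr (\det _).
  rewrite mulmxDl mul1mx mulmxDr mulmx1 -scalemxAr.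
  suff -> : (\sum_(i < k) (a i - 1) *: D i) *m D k = 0.
    by rewrite scaler0 addr0 -addrA; congr (_ + _); rewrite addrC.
  rewrite mulmx_suml big1 // => i _.
  have ik := ltn_ord i; rewrite -scalemxAl DD ?(ltn_trans ik) // ?(ltn_eqF ik).
  by rewrite scaler0.
transitivity (\det (1%:M + \sum_(i < m) (a i - 1) *: D i)).
  rewrite /char_poly; congr (\det _); rewrite /char_poly_mx.
  have D1 : \sum_(i < m) D i = 1%:M by rewrite -map_mx_sum E1 map_mx1.
  rewrite -{1}D1 -big_split /=.
  rewrite -[X in X - _]scalemx1 -D1 map_mx_sum scaler_sumr -sumrB.
  apply: eq_bigr => i _; rewrite map_mxZ -/(D i) -scalerBl -/(a i).
  by rewrite [in RHS]scalerBl scale1r subrKC.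
rewrite -pr //; apply: eq_bigr => i _; apply: det_idempotent.
by rewrite EE // eqxx.
Qed.

(** * Hermitian matrices from semistable filtrations *)

Section SemiHerm.
Variable R : realType.
Local Notation C := R[i].
Local Open Scope sesquilinear_scope.
Local Open Scope complex_scope.

Lemma prod_spectrum m n w (E : 'I_3 -> nat -> 'M[C]_n) s :
  \prod_(x <- spectrum m w E s) ('X - (x%:C)%:P) =
  \prod_(i < m) ('X - ((w s i)%:C)%:P) ^+ (\rank (E s i.+1) - \rank (E s i))%N :> {poly C}.
Proof.
rewrite /spectrum big_map big_flatten big_map /= -[in LHS](subn0 m) big_mkord.
by apply: eq_bigr => i _; rewrite big_nseq iter_mulr_1.
Qed.

Lemma projF_herm (J : finType) n (F : J -> 'M[C]_n.+1) T j :
  (projF F T j)^t* = projF F T j.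
Proof. by rewrite /projF adjmxM trmxCK. Qed.

Lemma schmidt_row_base (J : finType) n (F : J -> 'M[C]_n.+1) T j : T \in unitmx ->
  let Q := schmidt (row_base (F j) *m T) in Q *m Q^t* = 1%:M /\ (Q :=: F j *m T)%MS.
Proof.
move=> Tu Q; split; first by apply/unitarymxP/schmidt_unitarymx; rewrite rank_leq_col.
have h : row_free (row_base (F j) *m T).
  have uf : row_free T by rewrite row_free_unit.
  by rewrite /row_free (mxrankMfree _ uf); apply: row_base_free.
apply: eqmx_trans (eqmx_schmidt_free h) _; exact: eqmxMr (eq_row_base _).
Qed.

Lemma mxtrace_projF (J : finType) n (F : J -> 'M[C]_n.+1) T j : T \in unitmx ->
  \tr (projF F T j) = (\rank (F j))%:R.
Proof.
by move=> /(schmidt_row_base F j)[QQ _]; rewrite mxtrace_mulC QQ mxtrace1.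
Qed.

Lemma projF_nested (J : finType) n (F : J -> 'M[C]_n.+1) T j k : T \in unitmx ->
  (F j <= F k)%MS -> projF F T j *m projF F T k = projF F T j.
Proof.
move=> Tu jk; have [_ ej] := schmidt_row_base F j Tu.
have [QQ ek] := schmidt_row_base F k Tu.
have /submxP[M ME] : (schmidt (row_base (F j) *m T) <= schmidt (row_base (F k) *m T))%MS.
  by rewrite ej ek submxMr.
rewrite /projF -mulmxA; congr (_ *m _).
by rewrite {1}ME mulmxA -(mulmxA M) QQ mulmx1 -ME.
Qed.

(** After the balancing change of basis, [A s] combines the orthogonal projections onto the steps of
    filtration [s], with the drops of weight as coefficients. Balance says that the three sum to
    zero; Abel summation exhibits the weights as eigenvalues. *)
Lemma stable_herm3 n m (w : 'I_3 -> nat -> R) (E : 'I_3 -> nat -> 'M[C]_n) : (0 < n)%N ->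
  chain m E -> (forall s i j, (i <= j < m)%N -> w s j <= w s i) -> semistable m w E ->
  (forall V : 'M[C]_n, (0 < \rank V < n)%N -> wdeg m w E V < 0) ->
  herm3 n (spectrum m w E).
Proof.
case: n E => // n E _ cE wD [_ ss1] st.
case: m => [|m] in cE wD ss1 st *.
  have [e0 _] := cE 0; rewrite e0 /row_full mxrank0 => /eqP h; by move: h.
pose F (j : 'I_3 * 'I_m) := E j.1 j.2.+1.
pose c (j : 'I_3 * 'I_m) := w j.1 j.2 - w j.1 j.2.+1.
pose W := \sum_s w s m.
have capE (V : 'M[C]_n.+1) : capdeg F c W V = wdeg m.+1 w E V.
  rewrite /capdeg /wdeg /W mulr_suml -(pair_bigA _ (fun (s : 'I_3) (i : 'I_m) => (w s i - w s i.+1) *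
     (\rank (V :&: E s i.+1)%MS)%:R)) /= -big_split /=.
  apply: eq_bigr => s _; rewrite (@abel_sum _ (w s) (rk R E V s) m (@rk0 C R m.+1 _ _ E V s cE)).
  by rewrite (@rkm C R m.+1 _ _ E V s cE).
have [|||T Tu bal] := @stable_balanced R _ n F c W.
- by case=> s i; rewrite /c subr_ge0; apply: wD; have := ltn_ord i; rewrite /=; lia.
- by move=> V Vr; rewrite capE; apply: st.
- have := capE 1%:M; rewrite ss1 /capdeg mxrank1 => {2}<-; congr (_ + _).
  by apply: eq_bigr => j _; rewrite cap1mx.
(* The last step, whose index falls outside ['I_m], is the whole space: hence the default [1%:M]. *)
pose P s k := if k is k'.+1 then
  (if insub k' is Some i then projF F T (s, i) else 1%:M) else 0.
pose A s := \sum_(i < m) (c (s, i))%:C *: projF F T (s, i) + ((w s m)%:C)%:M.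
have AE s : A s = \sum_(k < m.+1) (w s k)%:C *: (P s k.+1 - P s k).
  have := @abel_sum _ (fun k => ((w s k)%:C)%:M) (P s) m erefl.
  under eq_bigr do rewrite -[_ * _]/(_ *m _) mul_scalar_mx.
  move->; congr (_ + _); last by rewrite /P insubF ?ltnn // mulr1.
  apply: eq_bigr => i _; rewrite /P valK -[RHS]/(_ *m _) -raddfB mul_scalar_mx.
  by rewrite /c rmorphB.
have PP s i j : (i <= j <= m.+1)%N -> P s i *m P s j = P s i.
  case: i j => [|i] [|j] //=; rewrite ?mul0mx // ltnS => /andP[ij jm].
  case: insubP => [i' _ iE|iN]; case: insubP => [j' _ jE|jn]; rewrite ?mulmx1 //; last first.
    by move: (ltn_ord j') iN; rewrite jE; lia.
  by apply: projF_nested => //; apply: (chain_le s cE); rewrite jE iE.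
have Ph s i : (P s i)^t* = P s i.
  case: i => [|i] /=; first by rewrite trmx0 map_mx0.
  by case: insubP => [i' _ _|_]; [apply: projF_herm | apply: adjmx1].
have PP' s i j : (i <= j <= m.+1)%N -> P s j *m P s i = P s i.
  by move=> ij; rewrite -[LHS]trmxCK adjmxM !Ph PP // Ph.
have trP s i : (i <= m.+1)%N -> \tr (P s i) = (\rank (E s i))%:R.
  case: i => [|i] im /=; first by have [-> _ _] := cE s; rewrite mxtrace0 mxrank0.
  case: insubP => [i' _ iE|im']; first by rewrite mxtrace_projF // /F /= iE.
  rewrite (_ : i = m); last by rewrite -leqNgt in im'; lia.
  by rewrite mxtrace1; have [_ _ /eqP ->] := cE s.
have EE s i j : (i < m.+1)%N -> (j < m.+1)%N ->
    (P s i.+1 - P s i) *m (P s j.+1 - P s j) = if i == j then P s i.+1 - P s i else 0.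
  move=> im jm; rewrite mulmxBl !mulmxBr; case: ltngtP => [ij|ji|<-].
  - by rewrite !PP ?subrr //; lia.
  - by rewrite !PP' ?subrr //; lia.
  - rewrite (PP s i i.+1) ?(PP' s i i.+1) ?(PP s i i) ?(PP s i.+1 i.+1) ?subrr ?subr0 //; lia.
exists A; split.
- move=> s; apply/hermP; rewrite /A adjmxD adjmx_sum; congr (_ + _).
    by apply: eq_bigr => j _; rewrite adjmx_realZ projF_herm.
  by rewrite -[X in X^t*]scalemx1 adjmx_realZ adjmx1 scalemx1.
- rewrite /A big_split /= -raddf_sum -rmorph_sum /= -[RHS]bal; congr (_ + _).
  by rewrite pair_bigA; apply: eq_bigr => -[].
- move=> s; have E1 : \sum_(k < m.+1) (P s k.+1 - P s k) = 1%:M.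
    rewrite -(big_mkord xpredT (fun k => P s k.+1 - P s k)) telescope_sumr //.
    by rewrite subr0 /P insubF ?ltnn.
  rewrite AE.
  rewrite (@char_poly_idempotents _ _ m.+1 (fun k => P s k.+1 - P s k)
    (fun k => (w s k)%:C) (EE s) E1).
  rewrite prod_spectrum; apply: eq_bigr => i _; congr (_ ^+ _).
  have im := ltn_ord i.
  have /eqP := mxtrace_idempotent (etrans (EE s i i im im) (ifT _ _ (eqxx _))).
  have trB (X Y : 'M[C]_n.+1) : \tr (X - Y) = \tr X - \tr Y by exact: raddfB.
  rewrite trB (trP s i.+1 im) (trP s i (ltnW im)).
  rewrite -natrB ?(rank_chain s cE) //.
  by rewrite eqr_nat => /eqP.
Qed.

(** Only the spectra have to be realized, so at a tight subspace the triple may be replaced by the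
    direct sum of sub and quotient. *)
Lemma semistable_herm3 n m (w : 'I_3 -> nat -> R) (E : 'I_3 -> nat -> 'M[C]_n) :
  chain m E -> (forall s i j, (i <= j < m)%N -> w s j <= w s i) -> semistable m w E ->
  herm3 n (spectrum m w E).
Proof.
elim/ltn_ind: n => n IH in E *; move=> cE wD ss.
have [n0|n0] := posnP n.
  subst n; exists (fun=> 0); split=> [s||s]; last 2 first.
  - by rewrite big1.
  - rewrite /spectrum (_ : jumps m E s = [::]) ?big_nil; first by rewrite /char_poly det_mx00.
    by apply/eqP; rewrite -size_eq0 (@size_jumps C R m 0 E s cE).
  - by apply/hermP; rewrite trmx0 map_mx0.
have [[V Vr V0]|nV] := pselect (exists2 V : 'M[C]_n, (0 < \rank V < n)%N & wdeg m w E V = 0).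
  have [a [b [E1 [E2 [[ab a0 b0] [c1 c2] s1 s2 pe]]]]] := chain_split cE ss Vr V0.
  have h1 := IH a ltac:(lia) E1 c1 wD s1; have h2 := IH b ltac:(lia) E2 c2 wD s2.
  by move: (spectrum m w E) pe => l pe; rewrite -ab; apply: herm3_sum h1 h2 pe.
apply: stable_herm3 => // V Vr; rewrite lt_neqAle; case: ss => -> _; rewrite andbT.
by apply/eqP => V0; apply: nV; exists V.
Qed.
End SemiHerm.

(** * Convexity of spectra *)

Section Tame.
Variable F : closedFieldType.

(* By quantifier elimination every first-order definable set of parameters is
   finite or cofinite. *)
Definition tame (P : F -> Prop) :=
  exists (s : seq F) (b : bool), forall t, t \notin s -> (P t <-> b).

Lemma tame_iff (P Q : F -> Prop) : (forall t, P t <-> Q t) -> tame P -> tame Q.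
Proof. by move=> PQ [s [b h]]; exists s, b => t /h; rewrite PQ. Qed.

Lemma tame_bool (P Q : F -> bool) (op : bool -> bool -> bool) :
  tame P -> tame Q -> tame (fun t => op (P t) (Q t)).
Proof.
move=> [s [b h]] [s' [b' h']]; exists (s ++ s'), (op b b') => t.
rewrite mem_cat negb_or => /andP[/h e /h' e'].
by have -> : P t = b by [apply/idP/idP; case: e]; have -> : Q t = b' by [apply/idP/idP; case: e'].
Qed.

Lemma tame_root (p : {poly F}) : tame (fun t => p.[t] == 0).
Proof.
have [->|p0] := eqVneq p 0; first by exists [::], true => t _; rewrite horner0 eqxx.
have [r pr] := closed_field_poly_normal p; exists r, false => t tr.
split=> // /eqP pt; suff : t \in r by rewrite (negPf tr).
have : root p t by apply/eqP.
by rewrite pr rootZ ?lead_coef_eq0 // root_prod_XsubC.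
Qed.

Variables (e : F -> seq F) (q : nat -> {poly F}).
Hypothesis eq_ : forall t j, (e t)`_j = (q j).[t].

Lemma eval_poly (u : GRing.term F) : GRing.rterm u ->
  exists p : {poly F}, forall t, GRing.eval (e t) u = p.[t].
Proof.
elim: u => //=.
- by move=> j _; exists (q j) => t; rewrite eq_.
- by move=> c _; exists c%:P => t; rewrite hornerC.
- by move=> k _; exists k%:R => t; rewrite -polyC_natr hornerC.
- by move=> u IHu v IHv /andP[/IHu[p pE] /IHv[p' p'E]]; exists (p + p') => t; rewrite hornerD pE p'E.
- by move=> u IHu /IHu[p pE]; exists (- p) => t; rewrite hornerN pE.
- by move=> u IHu k /IHu[p pE]; exists (p *+ k) => t; rewrite hornerMn pE.
- by move=> u IHu v IHv /andP[/IHu[p pE] /IHv[p' p'E]]; exists (p * p') => t; rewrite hornerM pE p'E.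
- by move=> u IHu k /IHu[p pE]; exists (p ^+ k) => t; rewrite horner_exp pE.
Qed.

Lemma tame_qf (g : GRing.formula F) : GRing.qf_form g -> GRing.rformula g ->
  tame (fun t => GRing.qf_eval (e t) g).
Proof.
elim: g => //=.
- by move=> b _ _; exists [::], b.
- move=> u v _ /andP[/eval_poly[p pE] /eval_poly[p' p'E]].
  apply: tame_iff (tame_root (p - p')) => t.
  by rewrite hornerD hornerN subr_eq0 pE p'E.
- by move=> g IHg h IHh /andP[/IHg{}IHg /IHh{}IHh] /andP[/IHg ? /IHh ?]; apply: (tame_bool andb).
- by move=> g IHg h IHh /andP[/IHg{}IHg /IHh{}IHh] /andP[/IHg ? /IHh ?]; apply: (tame_bool orb).
- by move=> g IHg h IHh /andP[/IHg{}IHg /IHh{}IHh] /andP[/IHg ? /IHh ?]; apply: (tame_bool implb).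
- move=> g IHg qg rg; have h := IHg qg rg.
  exact: (tame_bool (fun a _ => ~~ a) h h).
Qed.
End Tame.

Section TameExists.
Variable F : closedFieldType.
Import MatrixFormula.

(** The parameter is stored as a constant row of the same length as the unknown [v]; once [v] is
    eliminated, every variable is evaluated at a polynomial in [t] and [tame_qf] applies. *)
Lemma tame_exists d (f : GRing.formula F) : (0 < d)%N ->
  tame (fun t : F => exists v : 'rV[F]_d, GRing.holds (row_env [:: const_mx t; v]) f).
Proof.
move=> d0; pose g := GRing.to_rform (Exists_row_form d 1 f).
have gr : GRing.rformula g by apply: GRing.to_rform_rformula.
pose wf := @ClosedFieldQE.wf_ex_elim F.
pose ok := ClosedFieldQE.holds_ex_elim (@GRing.solve_monicpoly F).
pose h := GRing.quantifier_elim (@ClosedFieldQE.ex_elim F) g.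
have /andP[h1 h2] : GRing.qf_form h && GRing.rformula h by apply: GRing.quantifier_elim_wf.
pose q (j : nat) : {poly F} := if (j < d)%N then 'X else 0.
have eq_ (t : F) j : (row_env [:: const_mx t : 'rV_d])`_j = (q j).[t].
  rewrite /row_env /= cats0 /q; have [jd|dj] := ltnP j d.
    by rewrite (nth_seq_of_rV 0 _ (Ordinal jd)) mxE hornerX.
  by rewrite nth_default ?size_seq_of_rV // horner0.
apply: tame_iff (tame_qf eq_ h1 h2) => t.
rewrite (_ : (exists v, _) <-> exists v : 'rV[F]_d,
  GRing.holds (row_env (set_nth 0 [:: const_mx t] 1 v)) f) //.
rewrite Exists_rowP // -/g; split.
  by move/(GRing.quantifier_elim_rformP wf ok _ gr); apply GRing.to_rformP.
by move/GRing.to_rformP => ?; apply/(GRing.quantifier_elim_rformP wf ok _ gr).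
Qed.
End TameExists.

Section Convex.
Variable R : realType.
Local Notation C := R[i].
Local Open Scope sesquilinear_scope.
Local Open Scope complex_scope.

Definition pencil n (U0 U1 : 'I_3 -> 'M[C]_n) (t : C) s := (1 - t) *: U0 s + t *: U1 s.

(** Ranks of matrices of terms are quantifier-free formulas in the entries, and the entries of [V]
    form a single quantified row. *)
Lemma tame_rank_pencil n (U0 U1 : 'I_3 -> 'M[C]_n) a (rho : 'I_3 -> 'I_n.+1 -> nat) :
  (0 < n)%N ->
  tame (fun t => exists V : 'M[C]_n, \rank V = a /\ forall s (i : 'I_n.+1),
    \rank (col_mx V (flag (pencil U0 U1 t) s i)) = rho s i).
Proof.
move=> n0; have nn0 : (0 < n * n)%N by rewrite muln_gt0 n0.
pose V : 'M[GRing.term C]_n := vec_mx (MatrixFormula.row_var C (n * n) 1).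
pose G s : 'M[GRing.term C]_n := \matrix_(i, j)
  ((1 - 'X_0) * GRing.Const (U0 s i j) + 'X_0 * GRing.Const (U1 s i j))%T.
pose f : GRing.formula C := (MatrixFormula.mxrank_form a V /\
  \big[GRing.And/GRing.Bool true]_(s : 'I_3) \big[GRing.And/GRing.Bool true]_(i < n.+1)
   MatrixFormula.mxrank_form (rho s i) (col_mx V
     (MatrixFormula.mulmx_term (MatrixFormula.mx_term (pid_mx i : 'M[C]_n)) (G s))))%T.
have qff : GRing.qf_form f.
  rewrite /= MatrixFormula.mxrank_form_qf /= (big_morph (@GRing.qf_form C) (id1 := true) (op1 := andb)) //.
  rewrite big1 // => s _; rewrite (big_morph (@GRing.qf_form C) (id1 := true) (op1 := andb)) //.
  by rewrite big1 // => i _; apply: MatrixFormula.mxrank_form_qf.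
apply: tame_iff (tame_exists f nn0) => t.
have fE (v : 'rV[C]_(n * n)) : GRing.holds (MatrixFormula.row_env [:: const_mx t; v]) f <->
    \rank (vec_mx v) = a /\ forall s (i : 'I_n.+1),
    \rank (col_mx (vec_mx v) (flag (pencil U0 U1 t) s i)) = rho s i.
  set e := MatrixFormula.row_env _.
  have VE : MatrixFormula.eval_mx e V = vec_mx v.
    by rewrite MatrixFormula.eval_vec_mx MatrixFormula.eval_row_var.
  have e0 : e`_0 = t.
    have := @MatrixFormula.nth_row_env C (n * n) [:: const_mx t; v] 0 (Ordinal nn0).
    by rewrite /= mxE.
  have GE s : MatrixFormula.eval_mx e (G s) = pencil U0 U1 t s.
    by apply/matrixP => i j; rewrite !mxE /= e0.
  have FE s (i : 'I_n.+1) : MatrixFormula.eval_mx e (col_mx V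
     (MatrixFormula.mulmx_term (MatrixFormula.mx_term (pid_mx i : 'M[C]_n)) (G s))) =
     col_mx (vec_mx v) (flag (pencil U0 U1 t) s i).
    by rewrite MatrixFormula.eval_col_mx VE MatrixFormula.eval_mulmx MatrixFormula.eval_mx_term GE.
  have -> : GRing.holds e f <-> GRing.qf_eval e f by split=> /(GRing.qf_evalP _ qff).
  rewrite /= MatrixFormula.eval_mxrank VE.
  rewrite (big_morph (GRing.qf_eval e) (id1 := true) (op1 := andb)) //.
  rewrite big_andE; split.
    case/andP => /eqP -> /forallP h; split=> // s i; have := h s; rewrite /=.
    rewrite (big_morph (GRing.qf_eval e) (id1 := true) (op1 := andb)) //.
    by rewrite big_andE => /forallP /(_ i) /=; rewrite MatrixFormula.eval_mxrank FE => /eqP.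
  case=> -> h; rewrite eqxx; apply/forallP => s /=.
  rewrite (big_morph (GRing.qf_eval e) (id1 := true) (op1 := andb)) //.
  by rewrite big_andE; apply/forallP => i /=; rewrite MatrixFormula.eval_mxrank FE h.
split=> [[v /fE]|[V' h]]; first by exists (vec_mx v).
by exists (mxvec V'); apply/fE; rewrite mxvecK.
Qed.

Lemma pencil_unit n (U0 U1 : 'I_3 -> 'M[C]_n) (t0 : C) s : pencil U0 U1 t0 s \in unitmx ->
  exists b : seq C, forall t, t \notin b -> pencil U0 U1 t s \in unitmx.
Proof.
pose M : 'M[{poly C}]_n := \matrix_(i, j) ((1 - 'X) * (U0 s i j)%:P + 'X * (U1 s i j)%:P).
have ME t : (pencil U0 U1 t s \in unitmx) = ~~ root (\det M) t.
  rewrite unitmxE unitfE rootE -horner_evalE -det_map_mx; congr (\det _ != 0).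
  by apply/matrixP => i j; rewrite !mxE /= horner_evalE !hornerE.
have [r pr] := closed_field_poly_normal (\det M); rewrite ME => ut0.
have l0 : lead_coef (\det M) != 0.
  by rewrite lead_coef_eq0; apply: contraNneq ut0 => ->; rewrite root0.
exists r => t tr; rewrite ME; apply: contraNN tr.
by rewrite pr (rootZ _ _ l0) root_prod_XsubC.
Qed.

(** Semicontinuity of the rank: some product [A *m L *m B] is the identity of size [\rank L], and
    its determinant 1 cannot be a limit of zeros. *)
Lemma mxrank_limit (F : set_system nat) (FU : UltraFilter F) m n (M : nat -> 'M[C]_(m, n)) L r :
  mcvg F M L -> (forall k, \rank (M k) <= r)%N -> (\rank L <= r)%N.
Proof.
move=> ML Mr; rewrite leqNgt; apply/negP => rL.
have [A [B AB]] : exists A : 'M[C]_(\rank L, m), exists B : 'M[C]_(n, \rank L),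
    A *m L *m B = 1%:M.
  have /row_fullP[A Af] := col_base_full L; have /row_freeP[B Bf] := row_base_free L.
  exists A, B; have key p (E : 'M[C]_(m, n)) (A' : 'M[C]_(p, m)) (L2 : 'M[C]_(m, p)) L1 (B' : 'M[C]_(n, p)) :
      L2 *m L1 = E -> A' *m L2 = 1%:M -> L1 *m B' = 1%:M -> A' *m E *m B' = 1%:M.
    by move=> <- h1 h2; rewrite mulmxA h1 mul1mx h2.
  exact: key (mulmx_base L) Af Bf.
have c1 := ccvg_det FU (mcvgM FU (mcvgM FU (mcvg_cst FU A) ML) (mcvg_cst FU B)).
have c0 : ccvg F (fun k => \det (A *m M k *m B)) 0.
  rewrite (_ : (fun k => \det (A *m M k *m B)) = (fun=> 0)); first exact: ccvg_cst.
  apply/funext => k; apply/eqP; rewrite -[_ == _]negbK -unitfE -unitmxE.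
  apply/negP => /mxrank_unit rk; have := leq_trans (mxrankM_maxl _ _) (mxrankM_maxr A (M k)).
  move=> /(_ _ B); rewrite rk => h; have := leq_trans h (Mr k); lia.
by have := ccvg_unique FU c1 c0; rewrite AB det1 => /eqP; rewrite oner_eq0.
Qed.

Lemma mcvg_col_mx (F : set_system nat) p q n (X : nat -> 'M[C]_(p, n))
  (Y : nat -> 'M[C]_(q, n)) L L' : mcvg F X L -> mcvg F Y L' ->
  mcvg F (fun k => col_mx (X k) (Y k)) (col_mx L L').
Proof.
move=> XL YL a b; case: (split_ordP a) => a' ->.
  rewrite col_mxEu [X in ccvg _ X _](_ : _ = fun k => X k a' b) //.
  by apply/funext => k; rewrite col_mxEu.
rewrite col_mxEd [X in ccvg _ X _](_ : _ = fun k => Y k a' b) //.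
by apply/funext => k; rewrite col_mxEd.
Qed.

Lemma notin_near (s : seq C) (t0 : C) k : exists2 x : R, 0 < x <= k.+1%:R^-1 & t0 + x%:C \notin s.
Proof.
pose f j : C := t0 + (((k + j).+1)%:R^-1 : R)%:C.
have fu : uniq [seq f j | j <- iota 0 (size s).+1].
  rewrite map_inj_uniq ?iota_uniq // => i j /addrI/complexI/invr_inj/eqP.
  by rewrite eqr_nat eqSS eqn_add2l => /eqP.
have [/allP h|] := boolP (all (mem s) [seq f j | j <- iota 0 (size s).+1]).
  by have := uniq_leq_size fu h; rewrite size_map size_iota ltnn.
rewrite -has_predC => /hasP[_ /mapP[j _ ->] /= fs]; exists ((k + j).+1%:R^-1) => //.
by rewrite invr_gt0 ltr0n /= lef_pV2 ?posrE ?ltr0n // ler_nat ltnS leq_addr.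
Qed.

Lemma inv_cvg (F : set_system nat) (FU : UltraFilter F) (Foo : (\oo `<=` F)%classic) (x : nat -> R) :
  (forall k, 0 < x k <= k.+1%:R^-1) -> ccvg F (fun k => (x k)%:C) 0.
Proof.
move=> xb; have [|l [lb xl]] := @ucvg_bounded R F FU x 0 1.
  move=> k; have /andP[h1 h2] := xb k; rewrite ltW //= (le_trans h2) //.
  by rewrite invf_le1 ?ler1n.
suff l0 : l = 0.
  by have := ccvg_real FU xl; rewrite l0.
apply/eqP/negP => /negP ln0; have l0 : 0 < l by rewrite lt0r ln0; case/andP: lb.
have g := ucvg_gt FU xl (_ : l / 2 < l).
have {}g := g ltac:(lra).
pose N := Num.bound (l / 2)^-1.
have /filter_ex[k [/= kg kN]] : F ([set k | l / 2 < x k] `&` [set j | (N <= j)%N])%classic.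
  by apply: filterI => //; apply: ultra_large.
have /andP[_ h] := xb k; have := lt_le_trans kg h; rewrite ltNge => /negP; apply.
rewrite invf_ple ?posrE ?divr_gt0 //; apply: ltW.
apply: lt_le_trans (archi_boundP _) _; first by rewrite invr_ge0 divr_ge0 // ltW.
by rewrite ler_nat (leq_trans kN).
Qed.

Lemma row_pid n (M : 'M[C]_n) r k :
  row k ((pid_mx r : 'M[C]_n) *m M) = (k < r)%N%:R *: row k M.
Proof.
rewrite row_mul (_ : row k _ = (k < r)%N%:R *: delta_mx 0 k) -?scalemxAl -?rowE //.
by apply/rowP => j; rewrite !mxE eqxx /= [j == k]eq_sym -val_eqE /= -natrM mulnb andbC.
Qed.

Lemma unitary_rows n (V : 'M[C]_n) : exists X : 'M[C]_n,
  X \is unitarymx /\ ((pid_mx (\rank V) : 'M[C]_n) *m X :=: V)%MS.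
Proof.
pose A := row_ebase V; pose X := schmidt A; exists X.
have Xu : X \is unitarymx by apply: schmidt_unitarymx.
split=> //; apply/eqmx_sym/eqmxP; rewrite -mxrank_leqif_eq; last first.
  have h : (V <= (pid_mx (\rank V) : 'M[C]_n) *m A)%MS.
    by rewrite -{1}(mulmx_ebase V) -mulmxA submxMl.
  apply: submx_trans h _; apply/row_subP => i; rewrite row_pid.
  have [ir|_] := ltnP i (\rank V); last by rewrite scale0r sub0mx.
  rewrite scale1r; apply: submx_trans (row_schmidt_sub A i) _.
  apply/sumsmx_subP => k ki; rewrite genmxE -/X.
  have <- : row k ((pid_mx (\rank V) : 'M[C]_n) *m X) = row k X.
    by rewrite row_pid (leq_ltn_trans ki ir) scale1r.
  exact: row_sub.
rewrite mxrankMfree ?row_free_unit ?unitarymx_unit // rank_pid_mx ?rank_leq_row //.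
Qed.

Lemma cap_rank_col n p q (V : 'M[C]_(p, n)) (E : 'M[C]_(q, n)) :
  (\rank (V :&: E)%MS + \rank (col_mx V E) = \rank V + \rank E)%N.
Proof. by rewrite addnC -addsmxE mxrank_sum_cap. Qed.

(** Smaller sums with the flag mean larger intersections, and with decreasing weights [abel_le]
    turns these into a larger degree. *)
Lemma wdeg_flag_le n (w : 'I_3 -> nat -> R) (G G' : 'I_3 -> 'M[C]_n) (V V' : 'M[C]_n) :
  (forall s i j, (i <= j < n)%N -> w s j <= w s i) ->
  (forall s, G s \in unitmx) -> (forall s, G' s \in unitmx) ->
  \rank V = \rank V' ->
  (forall s i, (i <= n)%N -> \rank (col_mx V' (flag G' s i)) <= \rank (col_mx V (flag G s i)))%N ->
  wdeg n w (flag G) V <= wdeg n w (flag G') V'.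
Proof.
move=> wD Gu G'u rV h; apply: ler_sum => s _.
have c1 := flag_chain Gu; have c2 := flag_chain G'u.
pose g := rk R (flag G') V' s.
have tel k : \sum_(j < k) (g j.+1 - g j) = g k.
  rewrite -(big_mkord xpredT (fun j => g j.+1 - g j)) telescope_sumr //.
  by rewrite /g (@rk0 C R n _ _ _ V' s c2) subr0.
apply: (@abel_le R n (w s) (fun j => g j.+1 - g j) (rk R (flag G) V s)) => [i j|k kn||];
  [exact: wD| |exact: rk0|].
- rewrite tel ler_nat; have := cap_rank_col V (flag G s k); have := cap_rank_col V' (flag G' s k).
  have := h s k kn; rewrite !rank_flag // rV; lia.
- by rewrite tel /g (@rkm C R n _ _ _ V s c1) (@rkm C R n _ _ _ V' s c2) rV.
Qed.

(* The parameters admitting a destabilizing subspace of a given type form a set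
   that is finite or cofinite; if cofinite, a limit of such subspaces would
   destabilize the semistable triple at t0. *)
Lemma bad_finite n (w : 'I_3 -> nat -> R) (U0 U1 : 'I_3 -> 'M[C]_n) (t0 : C) : (0 < n)%N ->
  (forall s i j, (i <= j < n)%N -> w s j <= w s i) ->
  (forall s, pencil U0 U1 t0 s \in unitmx) ->
  (forall V : 'M[C]_n, wdeg n w (flag (pencil U0 U1 t0)) V <= 0) ->
  exists b : seq C, forall t, t \notin b -> (forall s, pencil U0 U1 t s \in unitmx) ->
    forall V : 'M[C]_n, wdeg n w (flag (pencil U0 U1 t)) V <= 0.
Proof.
move=> n0 wD u0 ss.
(* A type records the rank of [V] and of its sums with the steps of the flags; there are finitely
   many types, each with a tame set of parameters. *)
pose T := ('I_n.+1 * {ffun 'I_3 * 'I_n.+1 -> 'I_n.+1})%type.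
pose B (tau : T) (t : C) := exists V : 'M[C]_n, \rank V = tau.1 /\ forall s (i : 'I_n.+1),
    \rank (col_mx V (flag (pencil U0 U1 t) s i)) = tau.2 (s, i).
have Bt tau : exists sb : seq C * bool, forall t, t \notin sb.1 -> (B tau t <-> sb.2).
  have [s [b h]] := @tame_rank_pencil n U0 U1 tau.1 (fun s i => tau.2 (s, i)) n0.
  by exists (s, b).
have [sb sbP] := choice Bt.
exists (flatten [seq (sb tau).1 | tau <- enum {: T}]) => t tn tu V.
have rc s (i : 'I_n.+1) : (\rank (col_mx V (flag (pencil U0 U1 t) s i)) < n.+1)%N.
  by rewrite ltnS rank_leq_col.
have rV : (\rank V < n.+1)%N by rewrite ltnS rank_leq_col.
pose tau : T := (Ordinal rV, [ffun x => Ordinal (rc x.1 x.2)]).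
have BV : B tau t by exists V; split=> // s i; rewrite ffunE.
have tsb : t \notin (sb tau).1.
  apply: contra tn => ts; apply/flattenP; exists (sb tau).1 => //.
  by apply: map_f; rewrite mem_enum.
have bt : (sb tau).2 by apply/(sbP tau t tsb).
have Bs s' : s' \notin (sb tau).1 -> B tau s' by move=> /(sbP tau); case=> _; apply.
(* The type of [V] occurs at [t], outside the exceptional list, hence at every parameter outside it,
   in particular along a sequence tending to [t0]. *)
have /choice[x xP] : forall k, exists x : R, (0 < x <= k.+1%:R^-1) /\ t0 + x%:C \notin (sb tau).1.
  by move=> k; have [x h1 h2] := notin_near (sb tau).1 t0 k; exists x.
have /choice[Vk VkP] : forall k, exists V : 'M[C]_n, \rank V = tau.1 /\ forall s (i : 'I_n.+1),
    \rank (col_mx V (flag (pencil U0 U1 (t0 + (x k)%:C)) s i)) = tau.2 (s, i).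
  by move=> k; apply: Bs; case: (xP k).
have [F [FU Foo]] := ultra_nat.
have /choice[X XP] : forall k, exists X : 'M[C]_n, X \is unitarymx /\
    ((pid_mx tau.1 : 'M[C]_n) *m X :=: Vk k)%MS.
  move=> k; have [rk _] := VkP k; rewrite -rk; apply: unitary_rows.
have [L Lu XL] : exists2 L, L \is unitarymx & mcvg F X L.
  by apply: (@unitary_limit R F FU n X) => k; case: (XP k).
(* Unitary frames preserve the dimension in the limit, while the ranks of the sums can only drop. *)
pose V' : 'M[C]_n := pid_mx tau.1 *m L.
apply: le_trans (ss V'); apply: wdeg_flag_le => //.
  rewrite /V' mxrankMfree ?row_free_unit ?unitarymx_unit // rank_pid_mx //=.
move=> s i im; have im' : (i < n.+1)%N by [].
apply: (@mxrank_limit F FU _ _ (fun k => col_mx ((pid_mx tau.1 : 'M[C]_n) *m X k)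
   (flag (pencil U0 U1 (t0 + (x k)%:C)) s i))); last first.
  move=> k; have [_ h] := VkP k; have := h s (Ordinal im'); rewrite ffunE /= => <-.
  rewrite -!addsmxE; apply: mxrankS; apply: addsmxS => //.
  by have [_ ->] := XP k.
have c1 := mcvgM FU (mcvg_cst FU (pid_mx tau.1 : 'M[C]_n)) XL.
have ct : ccvg F (fun k => t0 + (x k)%:C) t0.
  rewrite -[X in ccvg _ _ X]addr0; apply: ccvgD; first exact: ccvg_cst.
  by apply: inv_cvg => // k; case: (xP k).
have c2 : mcvg F (fun k => pencil U0 U1 (t0 + (x k)%:C) s) (pencil U0 U1 t0 s).
  move=> a b; rewrite !mxE (_ : (fun k => _) = (fun k => (1 + (-1) * (t0 + (x k)%:C)) * U0 s a b +
     (t0 + (x k)%:C) * U1 s a b)); last by apply/funext => k; rewrite !mxE mulN1r.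
  rewrite -[X in 1 - X]mul1r -mulNr; apply: ccvgD => //; apply: ccvgM => //; try exact: ccvg_cst.
  apply: ccvgD => //; first exact: ccvg_cst.
  apply: ccvgM => //; exact: ccvg_cst.
have c3 := mcvgM FU (mcvg_cst FU (pid_mx i : 'M[C]_n)) c2.
exact: mcvg_col_mx.
Qed.

(** The flags at parameter 0 are semistable for [l0], those at 1 for [l1]; a common parameter avoids
    both exceptional lists. For fixed flags the degree is linear in the weights. *)
Lemma herm3_conv n (l0 l1 : 'I_3 -> seq R) (th : R) : (forall s, sorted >=%O (l0 s)) ->
  (forall s, sorted >=%O (l1 s)) -> 0 <= th <= 1 -> herm3 n l0 -> herm3 n l1 ->
  herm3 n (fun s => mkseq (fun i => (1 - th) * nth 0 (l0 s) i + th * nth 0 (l1 s) i) n).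
Proof.
move=> s0 s1 /andP[th0 th1] h0 h1.
have [n0|n0] := posnP n.
  subst n; apply: herm3_ext (h0) => s.
  have [U [_ sz _]] := herm3_semistable s0 h0.
  by have /size0nil -> := sz s.
have [U0 [u0 z0 [ss0 t0]]] := herm3_semistable s0 h0.
have [U1 [u1 z1 [ss1 t1]]] := herm3_semistable s1 h1.
have wD (l : 'I_3 -> seq R) : (forall s, sorted >=%O (l s)) -> (forall s, size (l s) = n) ->
    forall s i j, (i <= j < n)%N -> nth 0 (l s) j <= nth 0 (l s) i.
  move=> sl sz s i j /andP[ij jn]; have im := leq_ltn_trans ij jn.
  have tr : transitive (>=%O : rel R) by move=> y1 y2 y3 h2 h3; apply: le_trans h3 h2.
  by apply: (sorted_leq_nth tr (fun y => lexx y) 0 (sl s)); rewrite ?inE ?sz.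
have P0 : pencil U0 U1 0 = U0.
  by apply/funext => s; rewrite /pencil subr0 scale1r scale0r addr0.
have P1 : pencil U0 U1 1 = U1.
  by apply/funext => s; rewrite /pencil subrr scale1r scale0r add0r.
have U0u s : U0 s \in unitmx by apply: unitarymx_unit.
have U1u s : U1 s \in unitmx by apply: unitarymx_unit.
have [b0 b0P] := @bad_finite n (fun s => nth 0 (l0 s)) U0 U1 0 n0 (wD _ s0 z0)
  ltac:(by rewrite P0) ltac:(by rewrite P0).
have [b1 b1P] := @bad_finite n (fun s => nth 0 (l1 s)) U0 U1 1 n0 (wD _ s1 z1)
  ltac:(by rewrite P1) ltac:(by rewrite P1).
have /choice[b2 b2P] : forall s, exists b : seq C, forall t, t \notin b -> pencil U0 U1 t s \in unitmx.
  by move=> s; apply: (@pencil_unit n U0 U1 0); rewrite P0.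
have [x _] := notin_near (b0 ++ b1 ++ flatten [seq b2 s | s <- enum 'I_3]) 0 0.
rewrite add0r !mem_cat !negb_or => /and3P[tb0 tb1 tb2]; set t := x%:C in tb0 tb1 tb2.
have tu s : pencil U0 U1 t s \in unitmx.
  apply: b2P; apply: contra tb2 => ts; apply/flattenP; exists (b2 s) => //.
  by apply: map_f; rewrite mem_enum.
have cE := flag_chain tu.
pose l s := mkseq (fun i => (1 - th) * nth 0 (l0 s) i + th * nth 0 (l1 s) i) n.
have lw s i : (i < n)%N -> nth 0 (l s) i = (1 - th) * nth 0 (l0 s) i + th * nth 0 (l1 s) i.
  by move=> im; rewrite nth_mkseq.
have wl (V : 'M[C]_n) : wdeg n (fun s => nth 0 (l s)) (flag (pencil U0 U1 t)) V =
   (1 - th) * wdeg n (fun s => nth 0 (l0 s)) (flag (pencil U0 U1 t)) V +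
   th * wdeg n (fun s => nth 0 (l1 s)) (flag (pencil U0 U1 t)) V.
  rewrite /wdeg !mulr_sumr -big_split; apply: eq_bigr => s _.
  rewrite !mulr_sumr -big_split; apply: eq_bigr => i _ /=.
  by rewrite lw // mulrDl !mulrA.
(* The total degree of a complete flag is the sum of the weights, whatever the flag. *)
have tot (l' : 'I_3 -> seq R) (U : 'I_3 -> 'M[C]_n) : (forall s, U s \in unitmx) ->
    (forall s, size (l' s) = n) ->
    wdeg n (fun s => nth 0 (l' s)) (flag U) 1%:M = \sum_s \sum_(x <- l' s) x.
  move=> uu sz; rewrite wdeg1; last exact: flag_chain.
  by apply: eq_bigr => s _; rewrite flag_spectrum.
apply: herm3_ext (_ : herm3 n (spectrum n (fun s => nth 0 (l s)) (flag (pencil U0 U1 t)))).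
  by move=> s; rewrite flag_spectrum ?size_mkseq.
apply: semistable_herm3 => //.
  move=> s i j /andP[ij jn]; rewrite !lw //; last exact: leq_ltn_trans jn.
  apply: lerD; apply: ler_wpM2l => //; first by rewrite subr_ge0.
    by apply: (wD l0) => //; rewrite ij.
  by apply: (wD l1) => //; rewrite ij.
split.
  move=> V; rewrite wl; have h2 := b0P t tb0 tu V; have h3 := b1P t tb1 tu V.
  have h4 : (1 - th) * wdeg n (fun s => nth 0 (l0 s)) (flag (pencil U0 U1 t)) V <= 0.
    by rewrite mulr_ge0_le0 ?subr_ge0.
  have h5 : th * wdeg n (fun s => nth 0 (l1 s)) (flag (pencil U0 U1 t)) V <= 0.
    by rewrite mulr_ge0_le0.
  by apply: le_trans (lerD h4 h5) _; rewrite addr0.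
rewrite wl !(tot _ _ tu) // -(tot _ _ U0u) // -(tot _ _ U1u) // t0 t1.
by rewrite !mulr0 addr0.
Qed.
End Convex.

Lemma prod_XsubC_perm (F : idomainType) (l l' : seq F) :
  \prod_(x <- l) ('X - x%:P) = \prod_(x <- l') ('X - x%:P) -> perm_eq l l'.
Proof.
elim: l l' => [|x l IH] l' e.
  have := congr1 (fun p : {poly F} => size p) e; rewrite big_nil size_poly1 size_prod_XsubC.
  by case: l' {e} => [|y l'] //= [].
have xl' : x \in l' by rewrite -root_prod_XsubC -e root_prod_XsubC mem_head.
have p := perm_to_rem xl'; rewrite perm_sym (perm_trans p) // perm_cons perm_sym; apply: IH.
have nx : 'X - x%:P != 0 by rewrite polyXsubC_eq0.
by apply: (mulfI nx); rewrite -(big_cons _ _ x l xpredT) e (perm_big _ p) /= big_cons.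
Qed.

Lemma web_herm3 (R : realType) (U W : finType) (A : {set U}) (B : {set W}) phi q
    (b : 'I_3 -> seq R) : web A B phi q ->
  (forall s, \prod_(x <- b s) ('X - x%:P) = web_poly A B phi q s) -> herm3 (#|A| - #|B|) b.
Proof.
(* The lists are existentially quantified, since polynomials determine them only up to order. *)
pose Q n (c : 'I_3 -> {poly R}) := exists2 l : 'I_3 -> seq R, herm3 n l &
  forall s, c s = \prod_(x <- l s) ('X - x%:P).
move=> wb bE; suff [l hl lE] : Q (#|A| - #|B|)%N (web_poly A B phi q).
  apply: herm3_ext hl => s; apply: prod_XsubC_perm; by rewrite -lE bE.
apply: (@web_ind R U W Q) wb => {A B phi q b bE}.
- by move=> n c c' e [l hl lE]; exists l => // s; rewrite -e.
- move=> n a a0; exists (fun s => nseq n (a s)); first exact: herm3_scalar.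
  by move=> s; rewrite big_nseq iter_mulr_1.
- move=> n1 n2 c1 c2 [l1 h1 e1] [l2 h2 e2]; exists (fun s => l1 s ++ l2 s).
    by apply: herm3_sum h1 h2 _.
  by move=> s; rewrite big_cat e1 e2.
move=> n b0 b1 th d0 d1 [l0 h0 e0] [l1 h1 e1] th01.
pose m (b : 'I_3 -> 'I_n -> R) s := [seq b s i | i <- enum 'I_n].
have sm b : (forall s (i j : 'I_n), (i <= j)%N -> b s j <= b s i) -> forall s, sorted >=%O (m b s).
  move=> db s; rewrite /m sorted_map; apply: (@sub_sorted _ (fun i j : 'I_n => (i <= j)%N)).
    by move=> i j; apply: db.
  have := iota_sorted 0 n; rewrite -val_enum_ord sorted_map; apply: sub_sorted => i j //.
have pm b s : \prod_i ('X - (b s i)%:P) = \prod_(x <- m b s) ('X - x%:P).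
  by rewrite /m big_map big_enum.
have p0 s : perm_eq (l0 s) (m b0 s).
  by apply: prod_XsubC_perm; rewrite -e0 pm.
have p1 s : perm_eq (l1 s) (m b1 s).
  by apply: prod_XsubC_perm; rewrite -e1 pm.
have k0 := herm3_ext p0 h0; have k1 := herm3_ext p1 h1.
exists (fun s => mkseq (fun i => (1 - th) * nth 0 (m b0 s) i + th * nth 0 (m b1 s) i) n).
  by apply: herm3_conv => //; apply: sm.
move=> s; rewrite /mkseq -val_enum_ord -map_comp big_map big_enum /=.
apply: eq_bigr => i _; congr ('X - (_ * _ + _ * _)%:P).
  by rewrite (nth_map i) ?size_enum_ord // nth_ord_enum.
by rewrite (nth_map i) ?size_enum_ord // nth_ord_enum.
Qed.

(** * Germs of diagrams *)

Section Lebesgue.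
Variable R : realType.
Local Notation mu := (@lebesgue_measure R).
Local Notation RM := (measurableTypeR R).
Local Open Scope classical_set_scope.

Lemma lebesgue_measure_shift (a : R) (X : set RM) : measurable X ->
  mu [set t : RM | X (a + t)] = mu X.
Proof.
move=> mX; have mf : measurable_fun [set: RM] (fun t : RM => (a + t : RM)).
  by apply: measurable_funD; [exact: measurable_cst | exact: measurable_id].
rewrite -[LHS]/(pushforward mu (fun t : RM => (a + t : RM)) X).
apply/esym/lebesgue_measure_unique => //= _ [[x y]] _ <-.
have k (u z b t : R) : (u < b + t <= z) = (u - b < t <= z - b).
  by rewrite ltrBlDl lerBrDl.
transitivity (mu [set t : RM | (x - a : RM) < t <= (y - a : RM)]); last first.
  rewrite /pushforward; congr (mu _); apply/seteqP.
  by split=> t /=; rewrite in_itv /= => h; [rewrite [X in is_true X]k | rewrite -[X in is_true X]k].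
have m2 (u z : RM) : mu [set t : RM | u < t <= z] = if u < z then (z - u)%:E else 0%E.
  by rewrite -set_itvoc lebesgue_measure_itv /= lte_fin -EFinB.
have e1 : (x - a < y - a) = (x < y) := ltrD2r _ _ _.
have e2 : y - a - (x - a) = y - x by lra.
rewrite set_itvoc !m2.
exact: (congr2 (fun (b : bool) r => if b then r%:E else 0%E) (esym e1) (esym e2)).
Qed.

Lemma measurable_oo (a b : RM) : measurable [set t : RM | a < t < b].
Proof. by rewrite -set_itvoo; apply: measurable_itv. Qed.

Lemma measurable_cc (a b : RM) : measurable [set t : RM | a <= t <= b].
Proof. by rewrite -set_itvcc; apply: measurable_itv. Qed.

Lemma lebesgue_measure_oo (a b : RM) : a <= b -> mu [set t : RM | a < t < b] = (b - a)%:E.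
Proof.
rewrite le_eqVlt => /predU1P[->|ab]; rewrite -set_itvoo lebesgue_measure_itv /= lte_fin.
  by rewrite ltxx subrr.
by rewrite ab -EFinB.
Qed.

Lemma lebesgue_measure_opp (X : set RM) : measurable X ->
  mu [set t : RM | X (- t)] = mu X.
Proof. exact: lebesgue_measureN. Qed.

Lemma lebesgue_measure_split (X : set RM) : measurable X ->
  mu X = (mu ([set t : RM | (0 <= t)%R] `&` X) + mu ([set t : RM | (t <= 0)%R] `&` X))%E.
Proof.
move=> mX.
have m1 : measurable ([set t : RM | 0 <= t] : set RM).
  by rewrite -set_itvcy; apply: measurable_itv.
have m2 : measurable ([set t : RM | t < 0] : set RM).
  by rewrite -set_itvNyo; apply: measurable_itv.
have e1 : X = ([set t : RM | 0 <= t] `&` X) `|` ([set t : RM | t < 0] `&` X).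
  apply/seteqP; split=> t /=; last by case=> -[].
  by move=> Xt; have [?|?] := leP 0 t; [left|right].
have e2 : [set t : RM | t <= 0] `&` X = ([set t : RM | t < 0] `&` X) `|` ([set 0] `&` X).
  apply/seteqP; split=> t /=.
    by rewrite le_eqVlt => -[/predU1P[->|t0] Xt]; [right|left].
  by case=> -[h Xt]; split=> //; [exact: ltW | rewrite h].
have z : mu ([set 0] `&` X) = 0%E.
  apply/eqP; rewrite eq_le measure_ge0 andbT -(lebesgue_measure_set1 0).
  by apply: le_measure; rewrite ?inE //; apply: measurableI.
rewrite {1}e1 measureU; [|exact: measurableI|exact: measurableI|]; last first.
  by apply/seteqP; split=> // t /= [[h _] [h' _]]; move: h'; rewrite ltNge h.
congr (_ + _)%E; rewrite e2 measureU0 //; apply: measurableI => //.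
Qed.

Lemma measurable_ray (v w : R * R * R) :
  measurable_fun [set: RM] (fun t : RM => (v + t *: w : @R3 R)).
Proof.
have m (a b : R) : measurable_fun [set: RM] (fun t : RM => (a + t * b : RM)).
  apply: measurable_funD; first exact: measurable_cst.
  by apply: measurable_funM; [exact: measurable_id | exact: measurable_cst].
apply/measurable_fun_pairP; split; last exact: (m v.2 w.2).
apply/measurable_fun_pairP; split; first exact: (m v.1.1 w.1.1).
exact: (m v.1.2 w.1.2).
Qed.
End Lebesgue.

Section Germ.
Variable R : realType.
Local Notation P3 := (R * R * R)%type.
Local Notation RM := (measurableTypeR R).
Local Notation mu := (@lebesgue_measure R).
Local Notation vec := (@cardinal_vec R).
Local Open Scope classical_set_scope.
Implicit Types (d : cardinal) (s : segment R) (D : seq (segment R)) (v o p : P3).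

Definition opposite d := match d with
  | Northwest => Southeast | Southeast => Northwest | North => South
  | South => North | Northeast => Southwest | Southwest => Northeast end.

(* The coordinate that increases at unit speed in direction d. *)
Definition along d v : R := match d with
  | Northwest | North => v.1.2 | Northeast | Southeast => v.2
  | South | Southwest => v.1.1 end.

Lemma along_ray d o t : along d (o + t *: vec d) = along d o + t.
Proof. by case: d; rewrite /= /GRing.scale /= ?mulr1. Qed.

Lemma constant_coord_ray d o t : constant_coord d (o + t *: vec d) = constant_coord d o.
Proof. by case: d; rewrite /= /GRing.scale /= mulr0 addr0. Qed.

Lemma on_line d o v : plane o -> plane v -> constant_coord d v = constant_coord d o ->
  v = o + (along d v - along d o) *: vec d.
Proof.
case: o v => [ [a1 a2] a3] [ [v1 v2] v3]; rewrite /plane /= => ho hv.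
by case: d => /= e; congr (_, _, _); rewrite /= /GRing.scale /=; lra.
Qed.

Lemma ray_inj d o t t' : o + t *: vec d = o + t' *: vec d -> t = t'.
Proof. by move/(congr1 (along d)); rewrite !along_ray => /addrI. Qed.

Lemma ray_coords o w (t : R) :
  o + t *: w = (o.1.1 + t * w.1.1, o.1.2 + t * w.1.2, o.2 + t * w.2).
Proof. by []. Qed.

Lemma rayD o d t t' : o + t *: vec d + t' *: vec d = o + (t + t') *: vec d.
Proof. by rewrite !ray_coords; congr (_, _, _); rewrite /=; ring. Qed.

Lemma rayN o d t : o + t *: vec (opposite d) = o + (- t) *: vec d.
Proof. by rewrite !ray_coords; case: d => /=; congr (_, _, _); ring. Qed.

Definition ray_measure v d (A : set (@R3 R)) : \bar R :=
  segment_measure (Segment v d +oo%E 1) A.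

(* Whether s continues from v in its direction, resp. against its direction. *)
Definition leaves s v : bool :=
  `[< exists t, [/\ 0 <= t, (t%:E < len s)%E & v = origin s + t *: vec (dir s)] >].
Definition enters s v : bool :=
  `[< exists t, [/\ 0 < t, (t%:E <= len s)%E & v = origin s + t *: vec (dir s)] >].

(* Multiplicity in direction d of the rays to which D is equivalent near v. *)
Definition germ D v d : nat := \sum_(s <- D) multiplicity s *
  ((dir s == d) * leaves s v + (opposite (dir s) == d) * enters s v).

Lemma leavesE s t : leaves s (origin s + t *: vec (dir s)) = (0 <= t) && (t%:E < len s)%E.
Proof.
apply/asboolP/andP => [[t' [h1 h2 /ray_inj ->]]|[h1 h2]]; first by [].
by exists t.
Qed.

Lemma entersE s t : enters s (origin s + t *: vec (dir s)) = (0 < t) && (t%:E <= len s)%E.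
Proof.
apply/asboolP/andP => [[t' [h1 h2 /ray_inj ->]]|[h1 h2]]; first by [].
by exists t.
Qed.

Lemma ball_along d v p e : ball v e p -> `|along d p - along d v| < e.
Proof. by rewrite distrC; case=> -[h1 h2] h3; case: d. Qed.

Lemma ball_constant d v p e : ball v e p -> `|constant_coord d p - constant_coord d v| < e.
Proof. by rewrite distrC; case=> -[h1 h2] h3; case: d. Qed.

Definition trace v w (A : set (@R3 R)) : set RM := [set t | A (v + t *: w)].
Definition nonneg : set RM := [set t | 0 <= t].
Definition nonpos : set RM := [set t | t <= 0].

Lemma measurable_trace v w (A : set (@R3 R)) : measurable A -> measurable (trace v w A).
Proof. by move=> mA; rewrite -[X in measurable X]setTI; apply: measurable_ray. Qed.

Lemma ray_measureE v d A : ray_measure v d A =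
  ((Num.sqrt 2)%:E * mu (nonneg `&` trace v (vec d) A))%E.
Proof.
rewrite /ray_measure /segment_measure; congr (_ * mu _)%E.
by apply/seteqP; split=> t /= [] => [[h _] h'|h h']; split=> //; split=> //; rewrite leey.
Qed.

Lemma ray_measure_opposite v d A : measurable A -> ray_measure v (opposite d) A =
  ((Num.sqrt 2)%:E * mu (nonpos `&` trace v (vec d) A))%E.
Proof.
move=> mA; rewrite ray_measureE -[in RHS]lebesgue_measure_opp; last first.
  apply: measurableI; last exact: measurable_trace.
  by rewrite /nonpos -set_itvNyc; apply: measurable_itv.
congr (_ * mu _)%E; apply/seteqP.
by split=> t; rewrite /trace /nonneg /nonpos /= rayN oppr_le0.
Qed.

Lemma measurable_segment_dom s : measurable (segment_dom s).
Proof.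
rewrite /segment_dom; case: (len s) => [r||].
- rewrite (_ : mkset _ = [set t : RM | (0 : RM) <= t <= r]); first exact: measurable_cc.
  by apply/seteqP; split=> t /=; rewrite lee_fin => /andP.
- rewrite (_ : mkset _ = [set t : RM | (0 : RM) <= t]).
    by rewrite -set_itvcy; apply: measurable_itv.
  by apply/seteqP; split=> t /=; rewrite leey; [case|].
- rewrite (_ : mkset _ = set0); first exact: measurable0.
  by apply/seteqP; split=> t //= [].
Qed.

(** Near [v] the segment is empty, a ray or a full line, according to the position of the parameter
    [t0] of [v] relative to the two ends. *)
Lemma segment_germ s v : segment_ok s -> plane v -> exists2 e : R, 0 < e &
  forall A : set (@R3 R), measurable A -> A `<=` ball v e -> segment_measure s A =
    ((leaves s v)%:R%:E * ray_measure v (dir s) A +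
     (enters s v)%:R%:E * ray_measure v (opposite (dir s)) A)%E.
Proof.
case: s => o d l m /and3P[/= /set_mem po l0 _] pv.
have [cv|cv] := eqVneq (constant_coord d v) (constant_coord d o); last first.
  exists `|constant_coord d v - constant_coord d o|; first by rewrite normr_gt0 subr_eq0.
  move=> A mA Av; rewrite /segment_measure /=.
  have -> : segment_dom (Segment o d l m) `&` segment_param (Segment o d l m) @^-1` A = set0.
    apply/seteqP; split=> // t /= [_ /Av/(ball_constant d)].
    by rewrite /segment_param /= constant_coord_ray distrC ltxx.
  have -> : leaves (Segment o d l m) v = false.
    by apply/asboolP => -[t [_ _ /= ve]]; rewrite ve constant_coord_ray eqxx in cv.
  have -> : enters (Segment o d l m) v = false.
    by apply/asboolP => -[t [_ _ /= ve]]; rewrite ve constant_coord_ray eqxx in cv.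
  by rewrite measure0 mule0 !mul0e adde0.
have := on_line po pv cv; set t0 := along d v - along d o => ve.
(* [e1] and [e2] are the distances in parameter from [v] to the two ends; the default 1 is used when
   [v] is that end or there is none. *)
pose e1 := if t0 == 0 then 1 else `|t0|.
pose e2 := if l is r%:E then if t0 == r then 1 else `|r - t0| else 1.
have e1_gt0 : 0 < e1 by rewrite /e1; case: eqP => // /eqP h; rewrite normr_gt0.
have e2_gt0 : 0 < e2.
  by rewrite /e2; case: (l) => // r; case: eqVneq => // h; rewrite normr_gt0 subr_eq0 eq_sym.
exists (Num.min e1 e2); first by rewrite lt_min e1_gt0.
move=> A mA Av; pose X : set RM := trace v (vec d) A.
pose Y : set RM := [set t | 0 <= t0 + t /\ ((t0 + t)%:E <= l)%E].
have mX : measurable X by apply: measurable_trace.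
have Xe t : X t -> `|t| < e1 /\ `|t| < e2.
  by move=> /Av/(ball_along d); rewrite along_ray addrAC subrr add0r lt_min => /andP.
pose Z := segment_dom (Segment o d l m) `&` segment_param (Segment o d l m) @^-1` A.
have mZ : measurable Z.
  by apply: measurableI; [apply: measurable_segment_dom | apply: (@measurable_trace o (vec d) A mA)].
rewrite [LHS](_ : _ = ((Num.sqrt 2)%:E * mu (Y `&` X))%E); last first.
  rewrite /segment_measure -/Z -(lebesgue_measure_shift t0 mZ); congr (_ * mu _)%E.
  apply/seteqP; split=> t /=; rewrite /Z /X /trace /segment_dom /segment_param /= ve rayD //.
rewrite ray_measure_opposite // ray_measureE -/X.
have lE : leaves (Segment o d l m) v = (0 <= t0) && (t0%:E < l)%E.
  by rewrite {1}ve (leavesE (Segment o d l m)).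
have eE : enters (Segment o d l m) v = (0 < t0) && (t0%:E <= l)%E.
  by rewrite {1}ve (entersE (Segment o d l m)).
rewrite lE eE /=.
have lo t : X t -> (0 <= t0 + t) = if t0 == 0 then 0 <= t else 0 < t0.
  move=> /Xe[+ _]; rewrite /e1; case: eqVneq => [->|t00]; first by rewrite add0r.
  rewrite ltr_norml; case: (ltgtP t0 0) t00 => // h _; rewrite ?(gtr0_norm h) ?(ltr0_norm h) => /andP[h1 h2].
    by apply/negbTE; rewrite -ltNge; lra.
  by apply/idP; lra.
have hi t : X t -> ((t0 + t)%:E <= l)%E = if t0%:E == l then t <= 0 else (t0%:E < l)%E.
  move=> /Xe[_]; rewrite /e2; case: (l) => [r||] //; last by rewrite leey ltry.
  rewrite eqe lte_fin lee_fin; case: eqVneq => [->|tr]; first by rewrite -lerBrDl subrr.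
  rewrite ltr_norml; case: (ltgtP t0 r) tr => // h _.
    by rewrite gtr0_norm ?subr_gt0 // => /andP[h1 h2]; apply/idP; lra.
  by rewrite ltr0_norm ?subr_lt0 // => /andP[h1 h2]; apply/negbTE; rewrite -ltNge; lra.
have half b (Y' : set RM) : Y `&` X = Y' ->
   ((Num.sqrt 2)%:E * mu Y')%E = b -> ((Num.sqrt 2)%:E * mu (Y `&` X))%E = b.
  by move=> ->.
have [tn|tp|t00] := ltgtP t0 0.
- apply: (half _ set0).
    apply/seteqP; split=> // t /= [[h _] Xt]; move: h; rewrite lo // lt_eqF // ltNge => /negP; apply.
    exact: ltW.
  by rewrite measure0 mule0 !mul0e adde0.
- have [tl|tl|tl] := ltgtP t0%:E l; rewrite ?mul1e ?mul0e ?add0e ?adde0.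
  + apply: (half _ X).
      apply/seteqP; split=> t /=; [by case|move=> Xt; split=> //; rewrite /Y /=].
      by rewrite lo // hi // gt_eqF // lt_eqF.
    by rewrite (lebesgue_measure_split mX) ge0_muleDr.
  + apply: (half _ set0); last by rewrite measure0 mule0.
    apply/seteqP; split=> // t /= [[_ h] Xt]; move: h; rewrite hi // gt_eqF // ltNge => /negP; apply.
    exact: ltW.
  + apply: (half _ (nonpos `&` X)) => //.
    apply/seteqP; split=> t /=.
      by case=> -[_ h] Xt; split=> //; move: h; rewrite hi // tl eqxx.
    by case=> h Xt; split=> //; rewrite /Y /= lo // hi // tl eqxx gt_eqF.
- rewrite t00 l0 mul1e mul0e adde0.
  apply: (half _ (nonneg `&` X)) => //.
  apply/seteqP; split=> t /=.
    by case=> -[h _] Xt; split=> //; move: h; rewrite lo // t00 eqxx.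
  by case=> h Xt; split=> //; rewrite /Y /= lo // hi // t00 eqxx lt_eqF.
Qed.

Lemma diagram_germ D v : diagram D -> plane v -> exists2 e : R, 0 < e &
  forall A : set (@R3 R), measurable A -> A `<=` ball v e ->
    diagram_measure D A = (\sum_d (germ D v d)%:R%:E * ray_measure v d A)%E.
Proof.
move=> + pv; elim: D => [_|s D IH /andP[sok /IH[e e0 eP]]].
  exists 1 => // A _ _; rewrite /diagram_measure big_nil big1 // => d _.
  by rewrite /germ big_nil mul0e.
have [e' e'0 e'P] := segment_germ sok pv; exists (Num.min e e'); first by rewrite lt_min e0.
move=> A mA Av; rewrite /diagram_measure big_cons -/(diagram_measure D A).
rewrite eP //; last by apply: subset_trans Av _; apply: le_ball; rewrite ge_min lexx.
rewrite e'P //; last by apply: subset_trans Av _; apply: le_ball; rewrite ge_min lexx orbT.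
have [r rE r0] : exists2 r : cardinal -> \bar R, forall d, ray_measure v d A = r d &
    forall d, (0 <= r d)%E.
  exists (fun d => ray_measure v d A) => // d; rewrite ray_measureE mule_ge0 ?lee_fin ?sqrtr_ge0 //.
have nat0 k : (0 <= (k%:R : R)%:E)%E by rewrite lee_fin.
rewrite !rE; under eq_bigr do rewrite rE; under [RHS]eq_bigr do rewrite rE.
have pick d0 x : (\sum_d ((d0 == d) * x)%:R%:E * r d = (x%:R : R)%:E * r d0)%E.
  rewrite (bigD1 d0) //= eqxx mul1n big1 ?adde0 // => d; rewrite eq_sym => /negbTE ->.
  by rewrite mul0e.
rewrite ge0_muleDr ?mule_ge0 // !muleA -!EFinM -!natrM -!pick -!big_split /=.
apply: eq_bigr => d _; rewrite -!ge0_muleDl ?nat0 // -!EFinD -!natrD.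
by rewrite [in RHS]/germ big_cons -/(germ D v d) mulnDr ![(multiplicity s * (_ * _))%N]mulnCA.
exact: nat0.
Qed.

Lemma rays_measure v (m : cardinal -> nat) A :
  diagram_measure (rays_from v m) A = (\sum_d (m d)%:R%:E * ray_measure v d A)%E.
Proof.
rewrite /diagram_measure /rays_from big_map big_enum /= [RHS](bigID (fun d => 0 < m d)%N) /=.
rewrite [X in (_ + X)%E]big1 ?adde0 //.
by move=> d; rewrite -eqn0Ngt => /eqP ->; rewrite mul0e.
Qed.

Lemma germ_emanating D v : diagram D -> plane v -> emanating D v (germ D v).
Proof.
move=> dD pv; have [e e0 eP] := diagram_germ dD pv; exists (ball v e); first exact: nbhsx_ballx.
by move=> A mA Av; rewrite eP // rays_measure.
Qed.

Definition open_itv (a e : RM) : set RM := [set t | a - e < t < a + e].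

Definition box (c : P3) (e : R) : set (@R3 R) :=
  (open_itv c.1.1 e `*` open_itv c.1.2 e) `*` open_itv c.2 e.

Lemma measurable_box c e : measurable (box c e).
Proof.
have m (a : RM) : measurable (open_itv a e) by exact: measurable_oo.
exact: (measurableX (measurableX (m _) (m _)) (m _)).
Qed.

Lemma boxE (c p : P3) e : box c e p <-> [/\ c.1.1 - e < p.1.1 < c.1.1 + e,
  c.1.2 - e < p.1.2 < c.1.2 + e & c.2 - e < p.2 < c.2 + e].
Proof. by split=> [[[]]|[]]. Qed.

Lemma box_ball v d e : 0 < e -> box (v + e *: vec d) (e / 4) `<=` ball v (2 * e).
Proof.
move=> e0 p /boxE; case: v p => [ [v1 v2] v3] [ [p1 p2] p3].
by case: d; rewrite /= /GRing.scale /= ?mulr0 ?mulr1 ?mulrN1;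
  move=> [/andP[? ?] /andP[? ?] /andP[? ?]]; (split; first split); rewrite /ball /= ltr_norml;
  apply/andP; split; lra.
Qed.

(** Half-width [e / 4] is small enough for the box to miss the other five rays. *)
Lemma ray_box v d d' e : 0 < e ->
  ray_measure v d' (box (v + e *: vec d) (e / 4)) =
  if d' == d then (Num.sqrt 2 * (e / 2))%:E else 0%E.
Proof.
move=> e0; rewrite ray_measureE.
case: v => [ [v1 v2] v3]; case: eqP => [->{d'}|dd].
  rewrite (_ : _ `&` _ = open_itv e (e / 4)).
    rewrite lebesgue_measure_oo; last by lra.
    by rewrite -EFinM; congr (_ * _)%:E; lra.
  apply/seteqP; split=> t; rewrite /open_itv /=.
    move=> [_ /boxE]; case: d; rewrite /= /GRing.scale /= ?mulr0 ?mulr1 ?mulrN1;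
     move=> [/andP[? ?] /andP[? ?] /andP[? ?]]; apply/andP; split; lra.
  move=> /andP[h1 h2]; split; first by rewrite /nonneg /=; lra.
  apply/boxE; case: d; rewrite /= /GRing.scale /= ?mulr0 ?mulr1 ?mulrN1;
    split; apply/andP; split; lra.
rewrite (_ : _ `&` _ = set0) ?measure0 ?mule0 //.
apply/seteqP; split=> // t /= [t0 /boxE]; rewrite /nonneg /= in t0.
by case: d d' dd => -[] // _; rewrite /= /GRing.scale /= ?mulr0 ?mulr1 ?mulrN1;
  move=> [/andP[? ?] /andP[? ?] /andP[? ?]]; lra.
Qed.

(** A small box on the ray in direction [d] has measure proportional to [m d] alone, so the local
    multiplicities are determined by the measure. *)
Lemma emanating_germ D v m : diagram D -> plane v -> emanating D v m -> m =1 germ D v.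
Proof.
move=> dD pv [U /nbhs_ballP[r /= r0 rU] mU] d.
have [r' r'0 gU] := diagram_germ dD pv.
pose e := Num.min r r' / 2.
have e0 : 0 < e by rewrite divr_gt0 // lt_min r0.
pose A := box (v + e *: vec d) (e / 4).
have Ar : A `<=` ball v (Num.min r r').
  have -> : Num.min r r' = 2 * e by rewrite mulrC divfK.
  exact: box_ball.
have mA : measurable A by apply: measurable_box.
have := mU A mA (subset_trans Ar (subset_trans (le_ball _) rU)).
rewrite ge_min lexx => /(_ isT).
rewrite (gU A mA); last by apply: subset_trans Ar _; apply: le_ball; rewrite ge_min lexx orbT.
have one (f : cardinal -> nat) : (\sum_d' (f d')%:R%:E * ray_measure v d' A =
    ((f d)%:R * (Num.sqrt 2 * (e / 2)))%:E)%E.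
  rewrite (bigD1 d) //= big1 ?adde0 => [|d' /negbTE dd]; first by rewrite /A ray_box // eqxx -EFinM.
  by rewrite /A ray_box // dd mule0.
rewrite rays_measure !one => -[/mulIf h]; apply/eqP; rewrite -(eqr_nat R) h //.
by rewrite mulf_neq0 // ?gt_eqF ?sqrtr_gt0 // divr_gt0.
Qed.

Lemma germ_equivalent D D' v : diagram D -> diagram D' -> equivalent D D' -> plane v ->
  germ D v =1 germ D' v.
Proof.
move=> dD dD' DD' pv d; apply: (emanating_germ dD' pv).
have [U nU h] := germ_emanating dD pv; exists U => // A mA AU.
by rewrite -DD' // h.
Qed.
End Germ.

HB.instance Definition _ (R : realType) := gen_eqMixin (segment R).

(** * Zero tension in terms of oriented edges *)

Section Honey.
Variable R : realType.
Local Notation P3 := (R * R * R)%type.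
Local Notation vec := (@cardinal_vec R).
Implicit Types (d : cardinal) (s : segment R) (D : seq (segment R)) (v o p : P3) (c : 'I_3).

Definition line_class d : 'I_3 := match d with
  | Northwest | Southeast => 0 | Northeast | Southwest => 1 | North | South => 1 + 1 end.

Definition boundary_dir c : cardinal :=
  match val c with 0%N => Northwest | 1%N => Northeast | _ => South end.

Definition positive d : bool :=
  match d with Northwest | Northeast | South => true | _ => false end.

Lemma cardinal_eqE d d' : (d == d') = (match d, d' with
  | Northwest, Northwest | North, North | Northeast, Northeast
  | Southeast, Southeast | South, South | Southwest, Southwest => true | _, _ => false end).
Proof. by apply/eqP; case: d; case: d'. Qed.

Lemma positiveE d : (d \in [:: Northwest; Northeast; South]) = positive d.
Proof. by rewrite !inE !cardinal_eqE; case: d. Qed.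

Definition coord c v : R := match val c with 0%N => v.1.1 | 1%N => v.1.2 | _ => v.2 end.

Lemma constant_coordE d v : constant_coord d v = coord (line_class d) v.
Proof. by case: d. Qed.

Lemma coord_constant c v : constant_coord (boundary_dir c) v = coord c v.
Proof. by move: c; apply: I3_ind. Qed.

Lemma along_boundary_dir c v : along (boundary_dir c) v = coord (c + 1) v.
Proof. by move: c; apply: I3_ind. Qed.

Lemma line_class_boundary_dir c : line_class (boundary_dir c) = c.
Proof. by move: c; apply: I3_ind. Qed.

Lemma positive_boundary_dir c : positive (boundary_dir c).
Proof. by move: c; apply: I3_ind. Qed.

Lemma dir_class d :
  d = if positive d then boundary_dir (line_class d) else opposite (boundary_dir (line_class d)).
Proof. by case: d. Qed.

Lemma oppositeK d : opposite (opposite d) = d.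
Proof. by case: d. Qed.

Lemma line_class_opposite d : line_class (opposite d) = line_class d.
Proof. by case: d. Qed.

Lemma sum_coord v : plane v <-> \sum_c coord c v = 0.
Proof. by rewrite sum_I3_012. Qed.

Lemma coord_inj v v' : (forall c, coord c v = coord c v') -> v = v'.
Proof.
case: v v' => -[x y] z [[x' y'] z'] h.
by have := (h 0, h 1, h (1 + 1)); rewrite /coord /= => -[[-> ->] ->].
Qed.

Definition all_dirs : seq cardinal := [:: Northwest; Southeast; Northeast; Southwest; South; North].

Lemma sum_dirs (V : nmodType) (f : cardinal -> V) :
  \sum_d f d = \sum_(d <- all_dirs) f d.
Proof.
rewrite -big_enum; apply: perm_big; apply: uniq_perm; rewrite ?enum_uniq //.
  by rewrite /= !inE !cardinal_eqE.
by move=> d; rewrite mem_enum !inE !cardinal_eqE; case: d.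
Qed.

(** The three boundary directions satisfy only the relation that their sum is zero. So tension
    vanishes exactly when the net multiplicity, direction minus opposite, is the same for all three
    classes; the equations avoid subtraction. *)
Lemma tension_sum (m : cardinal -> nat) :
  (\sum_d vec d *+ m d = 0) <-> (forall c c', m (boundary_dir c) + m (opposite (boundary_dir c')) =
    m (boundary_dir c') + m (opposite (boundary_dir c)))%N.
Proof.
have e c : coord c (\sum_d vec d *+ m d) = \sum_d coord c (vec d) * (m d)%:R.
  have cD (x y : P3) : coord c (x + y) = coord c x + coord c y by move: c; apply: I3_ind.
  have c0 : coord c (0 : P3) = 0 by clear cD; move: c; apply: I3_ind.
  rewrite (big_morph (coord c) cD c0); apply: eq_bigr => d _; rewrite mulr_natr.
  by elim: (m d) => [|k IH]; rewrite ?mulr0n // !mulrS cD IH.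
have nz (a b a' b' : nat) : (a + b = a' + b')%N <-> a%:R + b%:R = a'%:R + b'%:R :> R.
  by rewrite -!natrD; split=> [->//|/eqP]; rewrite eqr_nat => /eqP.
split=> [s0|h].
  have ec c : \sum_d coord c (vec d) * (m d)%:R = 0 by rewrite -e s0; move: c; apply: I3_ind.
  have := (ec 0, ec 1, ec (1 + 1)); rewrite !sum_dirs /all_dirs !big_cons !big_nil /coord /=.
  case=> -[e0 e1] e2.
  by apply: I3_ind; apply: I3_ind => //=; apply/nz; lra.
apply: coord_inj => c; rewrite e; transitivity (0 : R); last by move: c; apply: I3_ind.
have h01 := (nz _ _ _ _).1 (h 0 1); have h12 := (nz _ _ _ _).1 (h 1 (1 + 1)).
move: h01 h12; rewrite /= sum_dirs /all_dirs !big_cons !big_nil => h01 h12.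
by move: c; apply: I3_ind; rewrite /coord /=; lra.
Qed.

Definition far_end s : P3 := origin s + fine (len s) *: vec (dir s).
(** Each segment is oriented along the boundary direction of its class, so that it reads as a web
    edge from [start] to [stop]; [None] marks the end at infinity. *)
Definition start s : P3 := if positive (dir s) then origin s else far_end s.
Definition stop s : option P3 :=
  if positive (dir s) then (if half_infinite s then None else Some (far_end s))
  else Some (origin s).

Definition tidy D := diagram D /\ all (fun s => half_infinite s ==> positive (dir s)) D.

Lemma segment_ends s v : segment_ok s ->
  (leaves s v + (~~ half_infinite s && (v == far_end s)) = enters s v + (v == origin s))%N.
Proof.
case/and3P => _ l0 _.
have [[t ve]|nv] := pselect (exists t, v = origin s + t *: vec (dir s)); last first.
  have n t : (v == origin s + t *: vec (dir s)) = false.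
    by apply/eqP => ve; apply: nv; exists t.
  have -> : leaves s v = false by apply/asboolP => -[t [_ _ ve]]; apply: nv; exists t.
  have -> : enters s v = false by apply/asboolP => -[t [_ _ ve]]; apply: nv; exists t.
  by rewrite /far_end n andbF -[origin s]addr0 -(scale0r (vec (dir s))) n.
have eqt t' : (v == origin s + t' *: vec (dir s)) = (t == t').
  by rewrite ve; apply/eqP/eqP => [/ray_inj|->].
rewrite /far_end eqt -[X in v == X]addr0 -(scale0r (vec (dir s))) eqt ve leavesE entersE.
rewrite /half_infinite; case: (len s) l0 => [r||] //=; rewrite ?lte_fin ?lee_fin ?ltry ?leey => r0.
  by case: (ltgtP t 0) => h1; case: (ltgtP t r) => h2 //; exfalso; clear ve eqt; lra.
by rewrite !andbT; case: (ltgtP t 0).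
Qed.

Definition starts D c v := (\sum_(s <- D | line_class (dir s) == c) multiplicity s * (start s == v))%N.
Definition stops D c v := (\sum_(s <- D | line_class (dir s) == c) multiplicity s * (stop s == Some v))%N.

(** A segment passing through [v] counts once in each of the two opposite directions and cancels;
    only ends at [v] remain. *)
Lemma germ_ends D c v : tidy D ->
  (germ D v (boundary_dir c) + stops D c v = germ D v (opposite (boundary_dir c)) + starts D c v)%N.
Proof.
case; elim: D => [_ _|s D IH /andP[sok dD] /andP[sp tD]]; first by rewrite /germ /stops /starts !big_nil.
have {}IH := IH dD tD; rewrite /germ /stops /starts !big_cons.
rewrite -!/(germ D v _) -/(stops D c v) -/(starts D c v).
set b := boundary_dir c in IH *.
have bo : (opposite b == b) = false /\ (b == opposite b) = false.
  by rewrite !cardinal_eqE /b; move: (c); apply: I3_ind.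
have [ec|nc] := eqVneq (line_class (dir s)) c; last first.
  have nd d : line_class d = c -> (dir s == d) = false /\ (opposite (dir s) == d) = false.
    move=> dc; split; apply/eqP => e; apply: (negP nc); apply/eqP; first by rewrite e.
    by rewrite -line_class_opposite e.
  have [-> ->] := nd b (line_class_boundary_dir c).
  have [|-> ->] := nd (opposite b); first by rewrite line_class_opposite line_class_boundary_dir.
  by rewrite !mul0n !addn0 !muln0 !add0n.
have se := congr1 (muln (multiplicity s)) (segment_ends v sok); rewrite !mulnDr in se.
have := dir_class (dir s); rewrite ec -/b /start /stop.
case: (positive (dir s)) sp => sp ->; rewrite ?oppositeK !eqxx ?bo.1 ?bo.2 !mul1n !mul0n ?addn0 ?add0n.
  have -> : ((if half_infinite s then None else Some (far_end s)) == Some v) =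
      ~~ half_infinite s && (v == far_end s) by case: half_infinite => //; rewrite eq_sym.
  by rewrite [origin s == v]eq_sym; lia.
have hs : half_infinite s = false by apply/negP => h; rewrite h in sp.
rewrite (_ : (Some (origin s) == Some v) = (v == origin s)); last by rewrite eq_sym.
by move: se; rewrite hs /= [far_end s == v]eq_sym; lia.
Qed.

Lemma zero_tension_ends D v : tidy D -> plane v ->
  zero_tension D v <-> (forall c c', starts D c v + stops D c' v = starts D c' v + stops D c v)%N.
Proof.
move=> tD pv; have [dD _] := tD.
have key : (\sum_d vec d *+ germ D v d = 0) <->
    (forall c c', starts D c v + stops D c' v = starts D c' v + stops D c v)%N.
  rewrite tension_sum; split=> h c c'; have := h c c';
    have := germ_ends c v tD; have := germ_ends c' v tD; lia.
rewrite -key; split=> [[m em m0]|s0]; last by exists (germ D v) => //; apply: germ_emanating.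
by rewrite -[RHS]m0; apply: eq_bigr => d _; rewrite (emanating_germ dD pv em).
Qed.

Lemma germ_gt0 D v d : (0 < germ D v d)%N -> exists2 s, s \in D &
  (dir s = d /\ leaves s v) \/ (opposite (dir s) = d /\ enters s v).
Proof.
rewrite lt0n => h; apply: contrapT => n; move: h => /eqP; apply; rewrite /germ big1_seq // => s /andP[_ sD].
case: eqP => [e1|_]; case: eqP => [e2|_]; rewrite ?mul0n ?mul1n ?addn0 ?add0n ?muln0 //.
- case: (boolP (leaves s v)) => l; first by case: n; exists s => //; left.
  by case: (boolP (enters s v)) => e; [case: n; exists s => //; right | rewrite muln0].
- by case: (boolP (leaves s v)) => l; [case: n; exists s => //; left | rewrite muln0].
- by case: (boolP (enters s v)) => e; [case: n; exists s => //; right | rewrite muln0].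
Qed.

Lemma leaves_germ D s v : s \in D -> segment_ok s -> leaves s v -> (0 < germ D v (dir s))%N.
Proof.
move=> sD /and3P[_ _ m0] l; rewrite lt0n /germ; apply/negP => /eqP.
move/eqP; rewrite sum_nat_seq_eq0 => /allP/(_ _ sD) /=; rewrite eqxx l muln_eq0.
by rewrite eqn0Ngt m0 /= addn_eq0.
Qed.

(** The direction of half-infinite edges is assumed for one representative only. Far out on a
    half-infinite segment of [D'] the germ of [D] is positive too, and no finite segment of [D]
    reaches that far. *)
Lemma honeycomb_tidy D D' : honeycomb_diagram D -> diagram D' -> equivalent D D' -> tidy D'.
Proof.
move=> [dD _ _ hD] dD' e; split=> //; apply/allP => s sD'; apply/implyP => hs.
apply: contraT => np; set d := dir s in np.
have sok : segment_ok s by move/allP: dD' => /(_ _ sD').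
have po : plane (origin s) by case/and3P: sok => /set_mem.
pose f (s' : segment R) := `|along d (origin s') - along d (origin s)| + `|fine (len s')|.
(* Large enough that [v] lies beyond the origin and the far end of every finite segment of [D],
   measured along [d]. *)
pose t := \sum_(s' <- D) f s' + 1.
have f0 s' : 0 <= f s' by rewrite addr_ge0.
have ft s' : s' \in D -> f s' < t.
  move=> s'D; apply: le_lt_trans (_ : \sum_(s' <- D) f s' < _); last by rewrite ltrDl.
  by rewrite (big_rem s' s'D) lerDl sumr_ge0.
have t0 : 0 <= t by rewrite addr_ge0 // sumr_ge0.
pose v := origin s + t *: vec d.
have pv : plane v.
  by move: po; rewrite /v /plane ray_coords /=; case: (d) => /=; lra.
have lv : leaves s v by rewrite /v /d leavesE t0 (eqP hs) ltry.
have := leaves_germ sD' sok lv; rewrite -(germ_equivalent dD dD' e pv) => /germ_gt0[s' s'D].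
have /andP[a1 a2] : (-t < along d (origin s') - along d (origin s) < t) && (`|along d (origin s') - along d (origin s)| + `|fine (len s')| < t).
  have h := ft _ s'D; rewrite -/(f s') h andbT -ltr_norml; apply: le_lt_trans h.
  by rewrite lerDl.
have al : along d v = along d (origin s) + t by rewrite /v along_ray.
case=> -[e1 /asboolP[t' [t'0 tl ve]]]; move: al; rewrite ve.
  rewrite e1 along_ray => al.
  have fin : ~~ half_infinite s'.
    move/allP: hD => /(_ _ s'D)/implyP h; apply/negP => /h; rewrite e1 positiveE => pd.
    by rewrite pd in np.
  move: tl fin a2; rewrite /half_infinite; case: (len s') => [r||] //=.
  rewrite lte_fin => tr _ a2; have := ler_norm (along d (origin s') - along d (origin s)).
  by have := ler_norm r; lra.
have -> : origin s' + t' *: vec (dir s') = origin s' + (- t') *: vec d.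
  have -> : vec d = vec (opposite (dir s')) by rewrite e1.
  by rewrite rayN opprK.
by rewrite along_ray; lra.
Qed.

Lemma boundary_prod D c :
  \prod_(x <- boundary D (boundary_dir c)) ('X - x%:P) =
  \prod_(s <- D | half_infinite s && (dir s == boundary_dir c))
    ('X - (coord c (origin s))%:P) ^+ multiplicity s.
Proof.
rewrite /boundary; have := perm_sort >=%O (flatten
  [seq nseq (multiplicity s) (constant_coord (boundary_dir c) (origin s))
     | s <- D & half_infinite s && (dir s == boundary_dir c)]).
move=> p; rewrite (perm_big _ (permEl p)) /= big_flatten big_map big_filter.
by apply: eq_bigr => s _; rewrite big_nseq iter_mulr_1 coord_constant.
Qed.

(** Turns a list of edges between points into an injection between positions, so that coinciding
    points become distinct vertices. *)
Lemma matching (X : eqType) (x0 : X) (L : seq (X * option X)) (PU PW : seq X) :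
  perm_eq (map fst L) PU -> perm_eq (pmap snd L) PW ->
  exists2 phi : 'I_(size PW) -> 'I_(size PU), injective phi &
    forall w, (nth x0 PU (phi w), Some (nth x0 PW w)) \in L.
Proof.
move=> pU pW; pose Lf := [seq x <- L | isSome x.2]; pose Li := [seq x <- L | ~~ isSome x.2].
have pL : perm_eq (Lf ++ Li) L by rewrite perm_filterC.
have /(perm_iotaP x0)[Is pI eI] : perm_eq (map fst (Lf ++ Li)) PU.
  exact: perm_trans (perm_map fst pL) pU.
pose ends := map (fun x : X * option X => odflt x0 x.2) Lf.
have eE : pmap snd L = ends.
  rewrite /ends /Lf; elim: (L) => //= -[x [y|]] l IH //=; by rewrite IH.
have /(perm_iotaP x0)[Js pJ eJ] : perm_eq PW ends by rewrite -eE perm_sym.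
have sJ : size Js = size PW by rewrite eJ size_map.
have sI : size Is = size PU by rewrite (perm_size pI) size_iota.
have uI : uniq Is by rewrite (perm_uniq pI) iota_uniq.
have uJ : uniq Js by rewrite (perm_uniq pJ) iota_uniq.
have Jlt w : (w < size PW)%N -> (nth 0 Js w < size Lf)%N.
  move=> wl; have : nth 0%N Js w \in Js by rewrite mem_nth ?sJ.
  by rewrite (perm_mem pJ) mem_iota /ends size_map.
have sLf : (size Lf <= size Is)%N.
  by move/(congr1 size): eI; rewrite !size_map size_cat => <-; apply: leq_addr.
have Ilt w : (w < size PW)%N -> (nth 0 Is (nth 0 Js w) < size PU)%N.
  move=> wl; have : nth 0%N Is (nth 0%N Js w) \in Is.
    by rewrite mem_nth // (leq_trans (Jlt _ wl)).
  by rewrite (perm_mem pI) mem_iota.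
exists (fun w : 'I_(size PW) => Ordinal (Ilt w (ltn_ord w))).
  move=> w w' /(congr1 val) /= /eqP; rewrite nth_uniq //; try exact: leq_trans (Jlt _ (ltn_ord _)) sLf.
  by rewrite nth_uniq ?sJ // => /eqP /ord_inj.
move=> w; have wl := ltn_ord w; rewrite /=.
have kl := Jlt w wl; set k := nth 0%N Js w in kl *.
have -> : nth x0 PU (nth 0%N Is k) = (nth (x0, None) Lf k).1.
  have := congr1 (fun l => nth x0 l k) eI; rewrite /= (nth_map 0%N) ?(leq_trans kl) // => <-.
  by rewrite (nth_map (x0, None)) ?size_cat ?(leq_trans kl) ?leq_addr // nth_cat kl.
have -> : nth x0 PW w = odflt x0 (nth (x0, None) Lf k).2.
  have E j : (j < size PW)%N -> nth x0 PW j = nth x0 ends (nth 0%N Js j).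
    by move=> jl; rewrite {1}eJ (nth_map 0%N) ?sJ.
  by rewrite E // -/k /ends (nth_map (x0, None)).
have : nth (x0, None) Lf k \in Lf by rewrite mem_nth.
by rewrite mem_filter; case: (nth _ _ _) => x [y|].
Qed.
End Honey.

(** * Diagrams and webs *)

Section HoneyWeb.
Variable R : realType.
Local Notation P3 := (R * R * R)%type.
Local Notation vec := (@cardinal_vec R).
Implicit Types (d : cardinal) (s : segment R) (D : seq (segment R)) (v o p : P3) (c : 'I_3).

Definition copies (X : eqType) (V : seq X) (f : X -> nat) : seq X :=
  flatten [seq nseq (f x) x | x <- V].

Lemma count_copies (X : eqType) (V : seq X) (f : X -> nat) x : uniq V ->
  count_mem x (copies V f) = ((x \in V) * f x)%N.
Proof.
rewrite /copies; elim: V => [|y V IH] //= /andP[yV uV]; rewrite count_cat IH // count_nseq inE /=.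
have [e|yx] := eqVneq y x; rewrite /= ?mul0n ?mul1n ?add0n //.
by rewrite -e (negbTE yV) mul0n addn0.
Qed.

Lemma plane_ray o (t : R) d : plane o -> plane (o + t *: vec d).
Proof. by rewrite /plane ray_coords /=; case: d => /=; lra. Qed.

Lemma plane_far_end s : segment_ok s -> plane (far_end s).
Proof. by case/and3P => /set_mem po _ _; apply: plane_ray. Qed.

Lemma plane_start s : segment_ok s -> plane (start s).
Proof.
by move=> sok; rewrite /start; case: ifP => _; [case/and3P: sok => /set_mem | apply: plane_far_end].
Qed.

Lemma stop_start s v : segment_ok s -> (half_infinite s -> positive (dir s)) -> stop s = Some v ->
  [/\ plane v, coord (line_class (dir s)) v = coord (line_class (dir s)) (start s) &
      coord (line_class (dir s) + 1) (start s) <= coord (line_class (dir s) + 1) v].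
Proof.
move=> sok hp; have pf := plane_far_end sok; case/and3P: (sok) => /set_mem po l0 _.
have l1 : ~~ half_infinite s -> 0 <= fine (len s).
  by rewrite /half_infinite; case: (len s) l0 => //= r; rewrite lte_fin => /ltW.
have cf : coord (line_class (dir s)) (far_end s) = coord (line_class (dir s)) (origin s).
  by rewrite -!constant_coordE constant_coord_ray.
have af : along (dir s) (far_end s) = along (dir s) (origin s) + fine (len s) by rewrite along_ray.
have ed := dir_class (dir s); move: ed cf af hp; rewrite /stop /start.
set c := line_class (dir s); case: (positive (dir s)) => ed cf af hp.
  move: af; rewrite {1 2}ed !along_boundary_dir => af.
  by case: ifP => // hi [<-]; rewrite cf af lerDl l1 ?hi.
move=> [<-]; split=> //.
have al p : along (opposite (boundary_dir c)) p = coord (c + 1 + 1) p by move: (c); apply: I3_ind.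
move: af; rewrite {1 2}ed !al => af.
have hn : ~~ half_infinite s by apply/negP => /hp.
have s0 p : plane p -> coord (c + 1) p = - coord c p - coord (c + 1 + 1) p.
  by rewrite /plane; move: (c); apply: I3_ind; rewrite /coord /=; lra.
by rewrite !s0 // cf af; have := l1 hn; lra.
Qed.

Definition edges D c : seq (P3 * option P3) :=
  flatten [seq nseq (multiplicity s) (start s, stop s) | s <- D & line_class (dir s) == c].

Lemma count_edges D c (a : pred (P3 * option P3)) : count a (edges D c) =
  (\sum_(s <- D | line_class (dir s) == c) multiplicity s * a (start s, stop s))%N.
Proof.
rewrite /edges count_flatten -map_comp sumnE big_map big_filter; apply: eq_bigr => s _.
by rewrite /= count_nseq mulnC.
Qed.

Lemma mem_edges D c e : e \in edges D c -> exists2 s, s \in D &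
  line_class (dir s) = c /\ e = (start s, stop s).
Proof.
case/flattenP => l /mapP[s]; rewrite mem_filter => /andP[/eqP sc sD] -> /nseqP[-> _].
by exists s.
Qed.

(* Inserting edges of length zero at every point v until each type has the same
   number N v of edges starting at v, the zero-tension condition makes the number
   of edges ending at v independent of the type as well. *)
Lemma honeycomb_web D : tidy D -> (forall v, plane v -> zero_tension D v) ->
  exists (U W : finType) (A : {set U}) (B : {set W}) phi (q : 'I_3 -> U -> R),
    web A B phi q /\ forall c, web_poly A B phi q c =
      \prod_(x <- boundary D (boundary_dir c)) ('X - x%:P).
Proof.
move=> tD zt; have [dD hD] := tD.
have sokD s : s \in D -> segment_ok s by move/allP: dD; apply.
have posD s : s \in D -> half_infinite s -> positive (dir s).
  by move=> sD; apply/implyP; move/allP: hD; apply.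
have bal v c c' : plane v -> (starts D c v + stops D c' v = starts D c' v + stops D c v)%N.
  by move=> pv; apply: (zero_tension_ends tD pv).1; apply: zt.
pose V := undup (flatten [seq start s :: seq_of_opt (stop s) | s <- D]).
have uV : uniq V by apply: undup_uniq.
have pV v : v \in V -> plane v.
  rewrite mem_undup => /flattenP[l /mapP[s sD ->]]; rewrite inE => /predU1P[->|].
    exact: plane_start (sokD _ sD).
  case E : (stop s) => [w|] //=; rewrite inE => /eqP ->.
  by have [] := stop_start (sokD _ sD) (posD _ sD) E.
have sV s : s \in D -> start s \in V.
  by move=> sD; rewrite mem_undup; apply/flattenP; exists (start s :: seq_of_opt (stop s)); rewrite ?mem_head //; apply/mapP; exists s.
have eV s w : s \in D -> stop s = Some w -> w \in V.
  move=> sD E; rewrite mem_undup; apply/flattenP; exists (start s :: seq_of_opt (stop s)).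
    by apply/mapP; exists s.
  by rewrite E /= !inE eqxx orbT.
have starts0 c v : v \notin V -> starts D c v = 0%N.
  move=> vV; rewrite /starts big1_seq // => s /andP[_ sD].
  by case: eqP => [e|_]; [rewrite -e sV in vV | rewrite muln0].
have stops0 c v : v \notin V -> stops D c v = 0%N.
  move=> vV; rewrite /stops big1_seq // => s /andP[_ sD].
  by case: eqP => [e|_]; [rewrite (eV _ _ sD e) in vV | rewrite muln0].
(* [N] dominates the number of starts of each type. Zero tension makes starts minus stops
   independent of the type, so padding all starts to [N v] pads all stops to the common value
   [M v]. *)
pose N v := (starts D (0%R : 'I_3) v + starts D (1%R : 'I_3) v + starts D (1 + 1)%R v)%N.
have Nc c v : (starts D c v <= N v)%N by rewrite /N; move: c; apply: I3_ind; lia.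
pose M v := (N v - starts D 0%R v + stops D 0%R v)%N.
pose L c := edges D c ++ [seq (x, Some x) | x <- copies V (fun v => N v - starts D c v)%N].
pose PU := copies V N; pose PW := copies V M.
have permU c : perm_eq (map fst (L c)) PU.
  rewrite /L map_cat -map_comp map_id; apply/allP => v _; apply/eqP.
  rewrite count_cat !count_copies // count_map count_edges.
  rewrite (_ : (\sum_(s <- D | _) _)%N = starts D c v) //.
  case: (boolP (v \in V)) => vV; first by rewrite !mul1n subnKC.
  by rewrite !mul0n (starts0 _ _ vV).
have permW c : perm_eq (pmap snd (L c)) PW.
  have e1 (l : seq P3) : pmap snd [seq (x, Some x) | x <- l] = l by elim: l => //= x l ->.
  have e2 v (l : seq (P3 * option P3)) : count_mem v (pmap snd l) = count (fun e => e.2 == Some v) l.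
    by elim: l => //= -[x [y|]] l IH //=; rewrite IH.
  rewrite /L pmap_cat e1; apply/allP => v _; apply/eqP.
  rewrite count_cat !count_copies // e2 count_edges.
  rewrite (_ : (\sum_(s <- D | _) _)%N = stops D c v) //.
  case: (boolP (v \in V)) => vV; last by rewrite !mul0n (stops0 _ _ vV).
  rewrite !mul1n; have := bal v c 0 (pV v vV); have := Nc c v; have := Nc 0 v; rewrite /M; lia.
pose x0 : P3 := 0.
have /choice[phi phiP] : forall c, exists phi : 'I_(size PW) -> 'I_(size PU), injective phi /\
    forall w, (nth x0 PU (phi w), Some (nth x0 PW w)) \in L c.
  by move=> c; have [phi h1 h2] := matching x0 (permU c) (permW c); exists phi.
have pU (u : 'I_(size PU)) : plane (nth x0 PU u).
  have : nth x0 PU u \in PU by apply: mem_nth.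
  by case/flattenP => l /mapP[v vV ->] /nseqP[-> _]; apply: pV.
have LP c p p' : (p, Some p') \in L c ->
    [/\ plane p', coord c p' = coord c p & coord (c + 1) p <= coord (c + 1) p'].
  rewrite mem_cat => /orP[/mem_edges[s sD [<- [-> /esym E]]]|/mapP[x xV [-> ->]]].
    exact: stop_start (sokD _ sD) (posD _ sD) E.
  by split=> //; case/flattenP: xV => l /mapP[v vV ->] /nseqP[-> _]; apply: pV.
pose q c (u : 'I_(size PU)) : R := coord c (nth x0 PU u).
have Lw c w := LP c _ _ ((phiP c).2 w).
have wb : web [set: 'I_(size PU)] [set: 'I_(size PW)] phi q.
  split.
  - by move=> c; split=> [w w' _ _|w _]; [apply: (phiP c).1 | rewrite inE].
  - by move=> u _; apply/sum_coord.
  - move=> w _; have [pw _ _] := Lw 0 w; apply: etrans ((sum_coord _).1 pw).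
    by apply: eq_bigr => c _; have [_ -> _] := Lw c w.
  - move=> c w _; have [_ _ h] := Lw c w; have [_ e _] := Lw (c + 1) w.
    by rewrite /q -e.
exists 'I_(size PU), 'I_(size PW), [set: _], [set: _], phi, q; split=> // c.
pose F (p : P3) : {poly R} := 'X - (coord c p)%:P.
have nzF (X : Type) (r : seq X) (P : pred X) (f : X -> P3) : \prod_(x <- r | P x) F (f x) != 0.
  by apply: monic_neq0; apply: monic_prod_XsubC.
have allU : \prod_(u < size PU) F (nth x0 PU u) = \prod_(e <- L c) F e.1.
  rewrite -(big_mkord xpredT (fun i => F (nth x0 PU i))) -(big_nth x0 xpredT).
  by rewrite -(perm_big _ (permU c)) big_map.
have allW : \prod_(w < size PW) F (nth x0 PW w) = \prod_(e <- L c | isSome e.2) F e.1.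
  rewrite -(big_mkord xpredT (fun i => F (nth x0 PW i))) -(big_nth x0 xpredT).
  rewrite -(perm_big _ (permW c)) /=.
  have : {subset L c <= L c} by [].
  elim: {1 3 4}(L c) => [|[p [p'|]] l IH] sl; rewrite ?big_nil // !big_cons /= IH //;
    try by move=> e el; apply: sl; rewrite inE el orbT.
  by rewrite /F; have [_ -> _] := LP c p p' (sl _ (mem_head _ _)).
(* The starts split into boundary ones and those matched by [phi c] with ends of equal coordinate
   [c]; the factor of the latter is cancelled below. *)
have bd : web_poly [set: 'I_(size PU)] [set: 'I_(size PW)] phi q c * \prod_(w < size PW) F (nth x0 PW w) =
    \prod_(u < size PU) F (nth x0 PU u).
  rewrite /web_poly /web_bdry [RHS](bigID (fun u => u \in phi c @: [set: 'I_(size PW)])) /= mulrC.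
  congr (_ * _); last by apply: eq_bigl => u; rewrite !inE andbT.
  rewrite (eq_bigl (fun u => u \in phi c @: [set: 'I_(size PW)])) // big_imset /=; last first.
    by move=> w w' _ _; apply: (phiP c).1.
  rewrite [RHS](eq_bigl xpredT); last by move=> w; rewrite inE.
  by apply: eq_bigr => w _; rewrite /F; have [_ -> _] := Lw c w.
have Wnz : \prod_(w < size PW) F (nth x0 PW w) != 0 by apply: nzF.
apply: (mulIf Wnz); rewrite bd allU allW (bigID (fun e => isSome e.2)) /= mulrC; congr (_ * _).
rewrite /L big_cat /= [X in _ * X]big1_seq ?mulr1; last first.
  by move=> e /andP[h /mapP[x _ ee]]; rewrite ee in h.
rewrite /edges big_flatten big_map big_filter boundary_prod.
rewrite big_mkcond [RHS]big_mkcond /=; apply: eq_big_seq => s sD.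
rewrite big_nseq_cond /= /stop /start.
have := dir_class (dir s); have := posD _ sD; case: (half_infinite s) => [/(_ isT) ->|_].
  move=> ed; rewrite /= iter_mulr_1; have -> : (line_class (dir s) == c) = (dir s == boundary_dir c).
    by apply/eqP/eqP => [<-|->]; rewrite ?line_class_boundary_dir.
  by [].
by case: ifP; case: ifP.
Qed.

Section FromWeb.
Variables (U W : finType) (A : {set U}) (B : {set W}) (phi : 'I_3 -> W -> U) (q : 'I_3 -> U -> R).
Hypothesis wb : web A B phi q.

Definition up_point (u : U) : P3 := (q 0 u, q 1 u, q (1 + 1) u).
Definition down_point (w : W) : P3 :=
  (q 0 (phi 0 w), q 1 (phi 1 w), q (1 + 1) (phi (1 + 1) w)).

Definition gap c w : R := coord (c + 1) (down_point w) - coord (c + 1) (up_point (phi c w)).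

(** Edges of length zero are dropped, since a segment must have positive length. *)
Definition web_segments c : seq (segment R) :=
  [seq Segment (up_point (phi c w)) (boundary_dir c) (gap c w)%:E 1
     | w <- enum B & 0 < gap c w] ++
  [seq Segment (up_point u) (boundary_dir c) +oo%E 1 | u <- enum (web_bdry A B phi c)].

Definition web_diagram : seq (segment R) :=
  web_segments 0 ++ (web_segments 1 ++ web_segments (1 + 1)).

Lemma coord_up c u : coord c (up_point u) = q c u.
Proof. by move: c; apply: I3_ind. Qed.

Lemma coord_down c w : coord c (down_point w) = q c (phi c w).
Proof. by move: c; apply: I3_ind. Qed.

Lemma gap_ge0 c w : w \in B -> 0 <= gap c w.
Proof.
by case: wb => _ _ _ h wB; rewrite /gap coord_up coord_down subr_ge0; apply: h.
Qed.

Lemma plane_up u : u \in A -> plane (up_point u).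
Proof.
case: wb => _ h _ _ uA; apply/sum_coord; apply: etrans (h u uA).
by apply: eq_bigr => c _; rewrite coord_up.
Qed.

Lemma plane_down w : w \in B -> plane (down_point w).
Proof.
case: wb => _ _ h _ wB; apply/sum_coord; apply: etrans (h w wB).
by apply: eq_bigr => c _; rewrite coord_down.
Qed.

Lemma phiA c w : w \in B -> phi c w \in A.
Proof. by case: wb => h _ _ _ wB; have [_ h'] := h c; apply: h'. Qed.

Lemma down_up c w : w \in B ->
  down_point w = up_point (phi c w) + gap c w *: vec (boundary_dir c).
Proof.
move=> wB; rewrite [LHS](@on_line R (boundary_dir c) (up_point (phi c w)) (down_point w)).
- by rewrite !along_boundary_dir.
- exact: plane_up (phiA c wB).
- exact: plane_down.
- by rewrite !coord_constant coord_up coord_down.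
Qed.

Lemma mem_web_segments c s : s \in web_segments c -> [/\ segment_ok s, dir s = boundary_dir c &
  half_infinite s -> positive (dir s)].
Proof.
rewrite mem_cat => /orP[/mapP[w]|/mapP[u]].
  rewrite mem_filter mem_enum => /andP[g0 wB] ->; split=> //.
  by rewrite /segment_ok /= lte_fin g0 andbT; apply/mem_set/plane_up/phiA.
rewrite mem_enum => ub ->; split=> //=; last by rewrite positive_boundary_dir.
rewrite /segment_ok /= ltry !andbT; apply/mem_set/plane_up.
by move: ub; rewrite finset.in_setD => /andP[].
Qed.

Lemma mem_web_diagram s : s \in web_diagram -> exists c, s \in web_segments c.
Proof.
rewrite /web_diagram (mem_cat s (web_segments 0)) (mem_cat s (web_segments 1)).
by case/or3P => h; [exists 0|exists 1|exists (1 + 1)].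
Qed.

Lemma web_diagram_tidy : tidy web_diagram.
Proof.
split; apply/allP => s /mem_web_diagram[c /mem_web_segments[h1 h2 h3]] //.
exact/implyP.
Qed.

Lemma big_web_diagram (T : Type) (idx : T) (op : Monoid.com_law idx) (F : segment R -> T) c :
  \big[op/idx]_(s <- web_diagram | line_class (dir s) == c) F s =
  \big[op/idx]_(s <- web_segments c) F s.
Proof.
have cl c' : \big[op/idx]_(s <- web_segments c' | line_class (dir s) == c) F s =
    if c' == c then \big[op/idx]_(s <- web_segments c') F s else idx.
  case: eqP => [<-|n].
    rewrite big_seq_cond [RHS]big_seq; apply: eq_bigl => s; case: (boolP (s \in _)) => //= h.
    by have [_ -> _] := mem_web_segments h; rewrite line_class_boundary_dir eqxx.
  rewrite big_seq_cond big_pred0 // => s; case: (boolP (s \in _)) => //= h.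
  by have [_ -> _] := mem_web_segments h; rewrite line_class_boundary_dir; apply/eqP.
have bc (l1 l2 l3 : seq (segment R)) P : \big[op/idx]_(s <- l1 ++ (l2 ++ l3) | P s) F s =
    op (\big[op/idx]_(s <- l1 | P s) F s)
      (op (\big[op/idx]_(s <- l2 | P s) F s) (\big[op/idx]_(s <- l3 | P s) F s)).
  by rewrite !big_cat.
rewrite /web_diagram bc !cl; move: c {cl}; apply: I3_ind => /=;
  by rewrite ?Monoid.mulm1 ?Monoid.mul1m.
Qed.

(** Together with [web_stops]: dropped edges correct starts and stops equally, so their difference
    counts up vertices minus down vertices at [v], whatever the class. *)
Lemma web_starts c v : plane v ->
  (starts web_diagram c v + \sum_(w in B) ((gap c w == 0%R) && (down_point w == v)) =
   \sum_(u in A) (up_point u == v))%N.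
Proof.
move=> pv; rewrite /starts big_web_diagram /web_segments big_cat !big_map big_filter /=.
rewrite !big_enum_cond /=.
have phiI : {in B &, injective (phi c)} by case: wb => h _ _ _; have [] := h c.
have phB : phi c @: B \subset A by apply/fintype.subsetP => u /imsetP[w wB ->]; apply: phiA.
rewrite (big_setID (phi c @: B)) /= (finset.setIidPr phB) big_imset //= [in RHS]addnC.
rewrite addnAC addnC; congr (_ + _)%N.
  by apply: eq_big => [u|u _]; rewrite ?andbT // /start /= positive_boundary_dir mul1n.
rewrite big_mkcondr -big_split /=; apply: eq_bigr => w wB.
have g0 := gap_ge0 c wB; rewrite /start /= positive_boundary_dir mul1n (down_up c wB).
by case: (ltgtP (gap c w) 0) g0 => // h _; rewrite /= ?addn0 // h scale0r addr0.
Qed.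

Lemma web_stops c v : plane v ->
  (stops web_diagram c v + \sum_(w in B) ((gap c w == 0%R) && (down_point w == v)) =
   \sum_(w in B) (down_point w == v))%N.
Proof.
move=> pv; rewrite /stops big_web_diagram /web_segments big_cat !big_map big_filter /=.
rewrite [X in (_ + X + _)%N]big1 ?addn0; last first.
  by move=> u _; rewrite /stop /= positive_boundary_dir.
rewrite !big_enum_cond /= big_mkcondr -big_split /=; apply: eq_bigr => w wB.
have g0 := gap_ge0 c wB; rewrite /stop /= positive_boundary_dir mul1n (down_up c wB) /far_end /=.
by case: (ltgtP (gap c w) 0) g0 => // _ _; rewrite addn0.
Qed.

Definition crossings (l : seq R) : seq P3 :=
  [seq (x, y, - x - y) | x <- l, y <- l] ++
  ([seq (x, - x - y, y) | x <- l, y <- l] ++ [seq (- x - y, x, y) | x <- l, y <- l]).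

Lemma crossingsP l v c c' : plane v -> c != c' -> coord c v \in l -> coord c' v \in l ->
  v \in crossings l.
Proof.
case: v => -[x y] z; rewrite /plane /= => pv.
have [hx hy hz] : [/\ x = - y - z, y = - x - z & z = - x - y] by split; lra.
have a1 : x \in l -> y \in l -> (x, y, z) \in crossings l.
  by move=> xl yl; rewrite !mem_cat hz allpairs_f.
have a2 : x \in l -> z \in l -> (x, y, z) \in crossings l.
  move=> xl zl; rewrite !mem_cat; apply/orP; right; apply/orP; left.
  by rewrite [in X in X \in _]hy; apply: (allpairs_f (fun x z => (x, - x - z, z))).
have a3 : y \in l -> z \in l -> (x, y, z) \in crossings l.
  move=> yl zl; rewrite !mem_cat; apply/orP; right; apply/orP; right.
  by rewrite [in X in X \in _]hx; apply: (allpairs_f (fun y z => (- y - z, y, z))).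
by move: c; apply: I3_ind; move: c'; apply: I3_ind; rewrite ?eqxx //= => _ h1 h2; auto.
Qed.

(** A class contains two directions, so three rays involve two classes: a vertex is a crossing of
    two of the finitely many supporting lines. *)
Lemma finite_vertices D : diagram D -> finite_set (vertex D).
Proof.
move=> dD; pose l := [seq coord (line_class (dir s)) (origin s) | s <- D].
have sub : (vertex D `<=` [set` crossings l])%classic.
  move=> v [pv [m em m2]] /=.
  have cl d : (0 < m d)%N -> coord (line_class d) v \in l.
    rewrite (emanating_germ dD pv em) => /germ_gt0[s sD h].
    have [ed ve] : line_class d = line_class (dir s) /\ exists t, v = origin s + t *: vec (dir s).
      case: h => -[<- /asboolP[t [_ _ ve]]]; split; try by exists t.
        by [].
      by rewrite line_class_opposite.
    apply/mapP; exists s => //; case: ve => t ->.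
    by rewrite ed -!constant_coordE constant_coord_ray.
  have [d d0] : exists d, (0 < m d)%N.
    by case/card_gt0P: (leq_ltn_trans (leq0n _) m2) => d; rewrite inE; exists d.
  have [[d' d'0 dd']|n] := pselect (exists2 d', (0 < m d')%N & line_class d != line_class d').
    exact: crossingsP pv dd' (cl _ d0) (cl _ d'0).
  have : (#|[pred d : cardinal | (0 < m d)%N]| <= #|[set d; opposite d]|)%N.
    apply: subset_leq_card; apply/fintype.subsetP => d'; rewrite inE => d'0.
    have e : line_class d = line_class d' by apply/eqP/negP => /negP h; apply: n; exists d'.
    have := dir_class d; have := dir_class d'; rewrite -e; rewrite !inE.
    move: (boundary_dir (line_class d)) => b.
    by case: (positive d); case: (positive d') => hd' hd; rewrite hd' hd ?oppositeK eqxx ?orbT.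
  by rewrite leqNgt cards2; case: (d != _); [move: m2; lia|move: m2; lia].
by apply: sub_finite_set sub _; apply: finite_seq.
Qed.

Lemma web_honeycomb : honeycomb_diagram web_diagram.
Proof.
have [dD hD] := web_diagram_tidy; split=> //.
- move=> v pv; apply/(zero_tension_ends web_diagram_tidy pv) => c c'.
  have := web_starts c pv; have := web_starts c' pv.
  have := web_stops c pv; have := web_stops c' pv; lia.
- exact: finite_vertices.
- by apply: sub_all hD => s; rewrite positiveE.
Qed.

Lemma web_boundary c : \prod_(x <- boundary web_diagram (boundary_dir c)) ('X - x%:P) =
  web_poly A B phi q c.
Proof.
rewrite boundary_prod; transitivity (\prod_(s <- web_diagram | line_class (dir s) == c)
    if half_infinite s then ('X - (coord c (origin s))%:P) ^+ multiplicity s else 1).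
  rewrite -big_mkcondr big_seq_cond [RHS]big_seq_cond; apply: eq_bigl => s.
  case: (boolP (s \in web_diagram)) => //= sD; rewrite andbC; apply: andb_id2r => hs.
  have [_ /allP/(_ _ sD)/implyP/(_ hs) ps] := web_diagram_tidy.
  have := dir_class (dir s); rewrite ps => ed.
  by apply/eqP/eqP => [->|<-//]; rewrite line_class_boundary_dir.
rewrite big_web_diagram /web_segments big_cat !big_map /=.
rewrite [X in X * _]big1 ?mul1r //.
by rewrite /web_poly big_enum /=; apply: eq_bigr => u _; rewrite expr1 coord_up.
Qed.
End FromWeb.
End HoneyWeb.

Section Assembly.
Variable R : realType.
Local Notation C := R[i].
Local Open Scope complex_scope.
Local Open Scope sesquilinear_scope.

Lemma herm3_size n (l : 'I_3 -> seq R) s : herm3 n l -> size (l s) = n.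
Proof.
case=> A [_ _ /(_ s) h]; have := size_char_poly (A s).
by rewrite h size_prod_XsubC => -[].
Qed.

Lemma herm3_hiveable n (l : 'I_3 -> seq R) : (forall s, sorted >=%O (l s)) ->
  herm3 n l -> hiveable n l.
Proof.
move=> sl hl; have [U [Uu sz ss]] := herm3_semistable sl hl.
have Uu' s : U s \in unitmx by apply: unitarymx_unit.
apply: hiveable_ext (semistable_hiveable (flag_chain Uu') _ ss) => [s|].
  by rewrite flag_spectrum.
move=> s i j /andP[ij jn]; have im := leq_ltn_trans ij jn.
have tr : transitive (>=%O : rel R) by move=> y1 y2 y3 h2 h3; apply: le_trans h3 h2.
by apply: (sorted_leq_nth tr (fun y => lexx y) 0 (sl s)); rewrite ?inE ?sz.
Qed.

Definition boundary3 (b : seq R * seq R * seq R) (s : 'I_3) : seq R :=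
  match val s with 0%N => b.1.1 | 1%N => b.1.2 | _ => b.2 end.

Lemma boundary3_dir D s : boundary3 (boundary D Northwest, boundary D Northeast, boundary D South) s
  = boundary D (boundary_dir s).
Proof. by move: s; apply: I3_ind. Qed.

Lemma herm3_honeycomb n (b : seq R * seq R * seq R) : (0 < n)%N ->
  (forall s, size (boundary3 b s) = n) ->
  (forall s, sorted >=%O (boundary3 b s)) ->
  herm3 n (boundary3 b) <-> exists H, n_honeycomb n H /\ boundary_values H b.
Proof.
move=> n0 sz sb; split.
  move=> hb.
  have [h hh hbd] := herm3_hiveable sb hb.
  case: n n0 hb sz hh hbd => // n _ hb sz hh hbd.
  pose q : 'I_3 -> _ := @slope R n h; have wb := hive_web hh.
  pose D := web_diagram (up_triangles n) (down_triangles n) (@step_up n) q.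
  have hD : honeycomb_diagram D := web_honeycomb wb.
  have bD s : boundary D (boundary_dir s) = boundary3 b s.
    (* Equal boundary polynomials give the same list up to order, and both lists are sorted. *)
    apply: (@sorted_eq _ >=%O).
    - by move=> y1 y2 y3 h2 h3; apply: le_trans h3 h2.
    - by move=> y1 y2 h2; apply: le_anti; rewrite andbC.
    - by rewrite /boundary; apply: sort_sorted => y1 y2; apply: le_total.
    - exact: sb.
    apply: prod_XsubC_perm; rewrite (web_boundary wb) (@hive_web_poly R n h (boundary3 b)) //.
    by move=> t; have [h1 _ h3] := hbd t.
  pose H := [set D' | diagram D' /\ equivalent D D']%classic.
  have HD : H D by split=> //; case: hD.
  have bv : boundary_values H b.
    exists D => //; case: b {sb hb sz hbd} bD => -[b0 b1] b2 bD.
    by have := (bD 0, bD 1, bD (1 + 1)); rewrite /boundary_dir /boundary3 /= => -[[-> ->] ->].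
  exists H; split=> //; split; first by exists D.
  by exists b => //; split; [exact: (sz 0) | exact: (sz 1) | exact: (sz (1 + 1))].
case=> H [[[D hD ->] [b' [D1 [dD1 e1] b1] [s0 s1 s2]]] [D2 [dD2 e2] b2]].
(* The boundary values are those of another representative [D2], to which the direction condition
   and zero tension are transferred. *)
have t2 := honeycomb_tidy hD dD2 e2.
have z2 v : plane v -> zero_tension D2 v.
  move=> pv; have [_ zt _ _] := hD; have [m [U nU em] m0] := zt v pv.
  exists m => //; exists U => // A mA AU; rewrite -em //.
  by apply/esym/e2.
have [U [W [A [B [phi [q [wb bp]]]]]]] := honeycomb_web t2 z2.
have hb : herm3 (#|A| - #|B|) (boundary3 b).
  by apply: web_herm3 wb _ => s; rewrite bp -b2 boundary3_dir.
by rewrite -(sz 0) (herm3_size 0 hb).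
Qed.

Lemma spectrum_opp n (A : 'M[C]_n) (l : n.-tuple R) : A \is hermsymmx -> has_spectrum A l ->
  - A \is hermsymmx /\ char_poly (- A) = \prod_(x <- rev [seq - x | x <- l]) ('X - (x%:C)%:P).
Proof.
move=> hA lA; have [U Uu AE] := herm_diagonalize hA lA.
pose l' := [seq - x | x <- l].
have sz : size l' = n by rewrite size_map size_tuple.
have -> : - A = U^t* *m diagr n (nth 0 l') *m U.
  rewrite AE -mulNmx -mulmxN; congr (_ *m _ *m _).
  apply/matrixP => i j; rewrite !mxE -mulNrn /l' (nth_map 0) ?size_tuple ?ltn_ord //.
  by rewrite rmorphN.
have [h c] := herm_of_diag Uu sz; split=> //; rewrite c.
by rewrite (perm_big _ (permEl (perm_rev _))).
Qed.

Lemma herm3_sum_spectra n (lam mu nu : n.-tuple R) :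
  (exists Hlam Hmu Hnu : 'M[C]_n,
      [/\ Hlam \is hermsymmx, Hmu \is hermsymmx & Hnu \is hermsymmx] /\
      [/\ has_spectrum Hlam lam, has_spectrum Hmu mu, has_spectrum Hnu nu
        & Hlam + Hmu = Hnu]) <->
  herm3 n (boundary3 (tval lam, tval mu, rev [seq - x | x <- nu])).
Proof.
split=> [[H0 [H1 [H2 [[h0 h1 h2] [s0 s1 s2 e]]]]]|[A [h e s]]].
  have [h2' s2'] := spectrum_opp h2 s2.
  exists (fun c => match val c with 0%N => H0 | 1%N => H1 | _ => - H2 end); split.
  - by apply: I3_ind.
  - by rewrite !big_ord_recl big_ord0 /= addr0 addrA e subrr.
  - by apply: I3_ind.
exists (A 0), (A 1), (- A (1 + 1)).
have [g2 c2] : - A (1 + 1) \is hermsymmx /\ has_spectrum (- A (1 + 1)) nu.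
  have sz : size (rev [seq - x | x <- nu]) == n by rewrite size_rev size_map size_tuple.
  have [g2 c2] := @spectrum_opp n (A (1 + 1)) (Tuple sz) (h _) (s _).
  split=> //; rewrite /has_spectrum c2 /= map_rev revK -map_comp.
  by rewrite (eq_map (g := id)) ?map_id // => x /=; rewrite opprK.
split; first by split.
split; [exact: (s 0)|exact: (s 1)|exact: c2|].
have e' : A 0 + A 1 + A (1 + 1) = 0.
  by rewrite -[RHS]e !big_ord_recl big_ord0 addr0 addrA; congr (A _ + A _ + A _); exact: val_inj.
by apply/eqP; rewrite -addr_eq0 e'.
Qed.
End Assembly.

Theorem theorem1 (R : realType) (n : nat) (lam mu nu : n.-tuple R) :
  (0 < n)%N ->
  sorted >=%O lam -> sorted >=%O mu -> sorted >=%O nu ->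
  (exists Hlam Hmu Hnu : 'M[R[i]]_n,
      [/\ Hlam \is hermsymmx, Hmu \is hermsymmx & Hnu \is hermsymmx] /\
      [/\ has_spectrum Hlam lam, has_spectrum Hmu mu, has_spectrum Hnu nu
        & Hlam + Hmu = Hnu])
  <->
  (exists H : set (seq (segment R)),
      n_honeycomb n H /\
      boundary_values H (tval lam, tval mu, rev [seq - x | x <- nu])).
Proof.
move=> n0 sl sm sn; rewrite herm3_sum_spectra; apply: herm3_honeycomb => //.
  by apply: I3_ind; rewrite /boundary3 /= ?size_rev ?size_map ?size_tuple.
apply: I3_ind => //; rewrite /boundary3 /= rev_sorted sorted_map.
by apply: sub_sorted sn => x y /=; rewrite lerN2.
Qed.
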